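(* Let $\alpha\in(0,2)$, $T>0$, let $U,H$ be separable Hilbert spaces and let $L$ be a canonical $\alpha$-stable cylindrical Lévy process on $U$ defined on a filtered probability space $(\Omega,\mathcal{F},P,(\mathcal{F}_t))$. Then every adapted $L_{\rm HS}(U,H)$-valued process $\Psi$ on $[0,T]$ with càglàd paths satisfies $$\sup_{r>0} r^\alpha P\left(\sup_{t\in[0,T]}\left\|\int_0^t\Psi(s)\,\mathrm{d}L(s)\right\|>r\right)\le c_{2,\alpha}\,E\left[\int_0^T\|\Psi(s)\|_{L_{\rm HS}(U,H)}^\alpha\,\mathrm{d}s\right]$$ with $c_{2,\alpha}=c_{1,\alpha}\frac{4-\alpha}{2-\alpha}$, where $c_{1,\alpha}=\frac{c\,\Gamma(\frac12)}{c_\alpha\,\Gamma(\frac{1+\alpha}{2})}$.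
   Context: $L_{\rm HS}(U,H)$ denotes the Hilbert–Schmidt operators from $U$ to $H$; $U$ is identified with its dual. Constants: $c_\alpha:=-\alpha\cos(\frac{\alpha\pi}{2})\Gamma(-\alpha)$ for $\alpha\ne1$ and $c_1:=\frac{\pi}{2}$ (i.e. $c_\alpha=\pi/2$ for $\alpha=1$). $c>0$ is a constant (depending on $\alpha$) such that $\sup_{r>0}r^\alpha\mu(\|x\|>r)\le c\lim_{r\to\infty}r^\alpha\mu(\|x\|>r)$ for every symmetric $\alpha$-stable probability measure $\mu$ on $\mathcal{B}(H)$; such $c$ exists by a known result. Cylindrical Lévy processes: $L^0(\Omega,\mathcal{F},P)$ is the space of (classes of) real random variables with convergence in probability. A cylindrical random variable is a linear continuous map $U\to L^0(\Omega,\mathcal{F},P)$. A cylindrical Lévy process is a family $(L(t):t\ge0)$ of cylindrical random variables such that for all $n$ and $u_1,\dots,u_n\in U$ the process $(L(t)u_1,\dots,L(t)u_n)_{t\ge0}$ is a Lévy process in $\mathbb{R}^n$ with respect to $(\mathcal{F}_t)$. It is called canonical $\alpha$-stable if $E[e^{iL(t)u}]=e^{-t\|u\|^\alpha}$ for all $u\in U$, $t\ge0$. Stochastic integral: for $\psi\in L_{\rm HS}(U,H)$ and $0\le s<t$ there is an $\mathcal{F}_t$-measurable $H$-valued random variable $\psi(L(t)-L(s))$ with $\langle\psi(L(t)-L(s)),h\rangle=(L(t)-L(s))(\psi^*h)$ a.s. for all $h\in H$. For a simple integrand $\Psi=\Psi_0\mathbf{1}_{\{0\}}+\sum_{i=1}^{N-1}\Psi_i\mathbf{1}_{(t_i,t_{i+1}]}$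 with $0=t_1<\dots<t_N=T$, $\Psi_i=\sum_j\mathbf{1}_{A_{i,j}}\psi_{i,j}$ (finite sum; for each $i$ the sets $A_{i,j}\in\mathcal{F}_{t_i}$ partition $\Omega$, $\psi_{i,j}\in L_{\rm HS}(U,H)$), put $\int_0^T\Psi\,\mathrm{d}L=\sum_i\sum_j\mathbf{1}_{A_{i,j}}\psi_{i,j}(L(t_{i+1})-L(t_i))$, and similarly for $\int_0^t$. The class $\Lambda$ of admissible integrands consists of all adapted $L_{\rm HS}(U,H)$-valued processes on $[0,T]$ with càglàd paths; the integral extends to it by continuity (if $\Psi_n\to\Psi$ in probability in the Skorokhod space of càglàd functions, then $\int_0^t\Psi_n\,\mathrm{d}L\to\int_0^t\Psi\,\mathrm{d}L$ in probability for every $t\in[0,T]$). The integral process has càdlàg paths. *)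

(* Defs.v *)
From HB Require Import structures.
From mathcomp Require Import all_boot all_order all_algebra.
From mathcomp Require Import all_classical all_reals all_analysis.

Set Implicit Arguments.
Unset Strict Implicit.
Unset Printing Implicit Defensive.

Import Order.TTheory GRing.Theory Num.Theory.
Import numFieldNormedType.Exports.

Local Open Scope classical_set_scope.
Local Open Scope ring_scope.

(* Real Hilbert spaces: U and H are real because L(t)u is a real random
   variable depending linearly on u in U. *)
HB.mixin Record isHilbert (R : realType) V of CompleteNormedModule R V := {
  hdot : V -> V -> R;
  hdotC : forall x y, hdot x y = hdot y x;
  hdot_linear : forall z a x y, hdot (a *: x + y) z = a * hdot x z + hdot y z;
  hdot_norm : forall x, hdot x x = `|x| ^+ 2
}.

#[short(type="hilbertType")]
HB.structure Definition Hilbert (R : realType) :=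
  {V of CompleteNormedModule R V & isHilbert R V}.

Definition separable (V : topologicalType) : Prop :=
  exists D : set V, countable D /\ dense D.

Section hilbert_schmidt.
Context {R : realType}.

Definition orthonormal (U : hilbertType R) (B : set U) : Prop :=
  forall x y, B x -> B y -> hdot x y = (x == y)%:R.

Definition orthonormal_basis (U : hilbertType R) (B : set U) : Prop :=
  orthonormal B /\ forall x, (forall e, B e -> hdot x e = 0) -> x = 0.

Definition onb (U : hilbertType R) : set U := get (@orthonormal_basis U).
Arguments onb : clear implicits.

Lemma onbP (U : hilbertType R) : orthonormal_basis (onb U).
Proof.
apply: getPex.
have [F FP Ftot|B [oB maxB]] := @Zorn_bigcup U (@orthonormal U).
  move=> x y [X FX Xx] [Y FY Yy].
  have [XY|YX] := Ftot _ _ FX FY.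
  - by apply: (FP _ FY) => //; exact: XY.
  - by apply: (FP _ FX) => //; exact: YX.
exists B; split => // x xB; apply/eqP; apply/negPn/negP => x0.
have nx0 : `|x| != 0 by rewrite normr_eq0.
have hZ (a : R) (u v : U) : hdot (a *: u) v = a * hdot u v.
  have h0 : hdot (0 : U) v = 0.
    have /eqP := hdot_linear v 1 0 0.
    by rewrite scaler0 addr0 mul1r addrC -subr_eq subrr eq_sym => /eqP.
  by have := hdot_linear v a u 0; rewrite !addr0 h0 addr0.
pose e := `|x|^-1 *: x.
have eB b : B b -> hdot e b = 0 by move=> Bb; rewrite hZ xB ?mulr0.
have ee : hdot e e = 1.
  by rewrite hZ hdotC hZ hdot_norm expr2 mulKf// mulVf.
have nBe : ~ B e by move=> /eB; rewrite ee => /eqP; rewrite oner_eq0.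
apply: (maxB (B `|` [set e])).
  by split=> [y By|sub]; [left|apply/nBe/sub; right].
move=> y z [By|->] [Bz|->].
- exact: oB.
- rewrite hdotC eB//; case: eqP => // ye; by rewrite -ye in nBe.
- rewrite eB//; case: eqP => // ez; by rewrite -ez in Bz.
- by rewrite ee eqxx.
Qed.

Section operators.
Context {U H : hilbertType R}.

Definition hs_norm2 (psi : U -> H) : \bar R :=
  \esum_(e in onb U) (`|psi e| ^+ 2)%:E.

Definition hilbert_schmidt : set (U -> H) :=
  [set psi | [/\ linear psi, continuous psi & (hs_norm2 psi < +oo)%E]].

Definition hs_norm (psi : U -> H) : R := Num.sqrt (fine (hs_norm2 psi)).

(* Outside hilbert_schmidt the sets are arbitrary; only
   Hilbert-Schmidt-valued processes are tested against them. *)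
Definition hs_open : set (set (U -> H)) :=
  [set O | forall psi, hilbert_schmidt psi -> O psi ->
     exists2 e : R, 0 < e &
       forall phi, hilbert_schmidt phi -> hs_norm (phi - psi) < e -> O phi].

Definition adjoint (psi : U -> H) (h : H) : U :=
  get [set v : U | forall u, hdot (psi u) h = hdot u v].

End operators.
End hilbert_schmidt.
Arguments onb {R} U.

Section paths.
Context {R : realType}.

Definition cadlag_on (T : R) (V : topologicalType) (f : R -> V) : Prop :=
  (forall t : R, 0 <= t < T -> f s @[s --> t^'+] --> f t) /\
  (forall t : R, 0 < t <= T -> exists l : V, f s @[s --> t^'-] --> l).

Context {U H : hilbertType R}.

Definition hs_caglad_on (T : R) (f : R -> U -> H) : Prop :=
  (forall t : R, 0 < t <= T -> hs_norm (f s - f t) @[s --> t^'-] --> (0 : R)) /\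
  (forall t : R, 0 <= t < T -> exists2 l : U -> H, hilbert_schmidt l &
     hs_norm (f s - l) @[s --> t^'+] --> (0 : R)).

Definition time_change (T : R) (lam : R -> R) : Prop :=
  set_bij `[0, T] `[0, T] lam /\ {in `[0, T] &, {homo lam : s t / s < t}}.

(* The J1 distance on functions [0,T] -> L_HS(U,H). *)
Definition skorokhod_dist (T : R) (f g : R -> U -> H) : \bar R :=
  ereal_inf [set ereal_sup
      [set (Num.max `|lam t - t| (hs_norm (f (lam t) - g t)))%:E
        | t in `[0, T]]
    | lam in time_change T].

End paths.

Section probability.
Context {R : realType} {d : measure_display} {Omega : measurableType d}.
Variables (P : probability Omega R) (F : R -> set (set Omega)).

(* F t matters for t >= 0 only. *)
Definition filtration : Prop :=
  [/\ forall t : R, 0 <= t -> sigma_algebra setT (F t),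
      forall t : R, 0 <= t -> F t `<=` measurable
    & forall s t : R, 0 <= s -> s <= t -> F s `<=` F t].

Definition borel_measurable (V : Type) (opens : set (set V))
    (G : set (set Omega)) (X : Omega -> V) : Prop :=
  forall B, <<s opens >> B -> G (X @^-1` B).

(* L(t)u is a class of random variables, so paths are only required to be
   stochastically continuous. *)
Definition levy_process (n : nat) (X : R -> Omega -> 'rV[R]_n) : Prop :=
  [/\ forall t : R, 0 <= t -> borel_measurable open (F t) (X t),
      {ae P, forall w, X 0 w = 0},
      forall (s t : R) A B, 0 <= s -> s <= t -> F s A -> <<s @open 'rV[R]_n >> B ->
        P (A `&` (X t \- X s) @^-1` B) =
        (P A * P ((X t \- X s)%R @^-1` B))%E,
      forall (s t : R) B, 0 <= s -> s <= t -> <<s @open 'rV[R]_n >> B ->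
        P ((X t \- X s) @^-1` B) = P (X (t - s) @^-1` B)
    & forall t eps : R, 0 <= t -> 0 < eps ->
        P [set w | eps < `|X s w - X t w|] @[s --> within [set s | 0 <= s] (nbhs t)]
          --> 0%E].

Section cylindrical.
Context {U : hilbertType R}.

(* A continuous linear map U -> L^0, given by representatives: linearity holds
   almost surely, continuity is for convergence in probability. *)
Definition cylindrical_rv (Z : U -> Omega -> R) : Prop :=
  [/\ forall u, measurable_fun setT (Z u),
      forall a u v, {ae P, forall w, Z (a *: u + v) w = a * Z u w + Z v w}
    & forall u (eps : R), 0 < eps ->
        P [set w | eps < `|Z v w - Z u w|] @[v --> u] --> 0%E].

Definition cylindrical_levy (L : R -> U -> Omega -> R) : Prop :=
  (forall t : R, 0 <= t -> cylindrical_rv (L t)) /\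
  forall (n : nat) (u : 'I_n -> U), levy_process (fun t w => \row_i L t (u i) w).

(* E[exp(i L(t)u)] = exp(- t |u|^alpha), by real and imaginary parts *)
Definition canonical_stable (alpha : R) (L : R -> U -> Omega -> R) : Prop :=
  cylindrical_levy L /\
  forall (t : R) (u : U), 0 <= t ->
    ('E_P[fun w => cos (L t u w)] = (expR (- t * `|u| `^ alpha))%:E)%E /\
    ('E_P[fun w => sin (L t u w)] = 0)%E.

Context {H : hilbertType R}.
Variables (L : R -> U -> Omega -> R) (T : R).

(* The H-valued variable psi(L(t) - L(s)), determined almost surely since H is
   separable. *)
Definition hs_increment (psi : U -> H) (s t : R) : Omega -> H :=
  get [set Y : Omega -> H | borel_measurable open (F t) Y /\
    forall h, {ae P, forall w,
      hdot (Y w) h = L t (adjoint psi h) w - L s (adjoint psi h) w}].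

(* The data of
     Psi_0 1_{0} + sum_(1 <= i < N) Psi_i 1_(t_i, t_(i+1)],
     Psi_i = sum_(j < npieces i) 1_(piece i j) (coef i j),
   with the convention t_0 = 0, so that Psi_0 is F 0-measurable. *)
Record simple_integrand := SimpleIntegrand {
  nknots : nat;
  knot : nat -> R;
  npieces : nat -> nat;
  piece : nat -> nat -> set Omega;
  coef : nat -> nat -> U -> H }.

Definition simple_on (S : simple_integrand) : Prop :=
  [/\ knot S 0 = 0, knot S 1 = 0, knot S (nknots S) = T,
      forall i, (0 < i < nknots S)%N -> knot S i < knot S i.+1
    & forall i, (i < nknots S)%N ->
      [/\ forall j, (j < npieces S i)%N -> F (knot S i) (piece S i j),
          trivIset `I_(npieces S i) (piece S i),
          \bigcup_(j in `I_(npieces S i)) piece S i j = setT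
        & forall j, (j < npieces S i)%N -> hilbert_schmidt (coef S i j)]].

Definition simple_step (S : simple_integrand) (i : nat) (w : Omega) : U -> H :=
  \sum_(0 <= j < npieces S i) (\1_(piece S i j) w : R) *: coef S i j.

Definition simple_process (S : simple_integrand) (t : R) (w : Omega) : U -> H :=
  (\1_[set 0] t : R) *: simple_step S 0 w +
  \sum_(1 <= i < nknots S)
    (\1_(`]knot S i, knot S i.+1]%classic) t : R) *: simple_step S i w.

Definition simple_integral (S : simple_integrand) (t : R) (w : Omega) : H :=
  \sum_(1 <= i < nknots S | knot S i < t)
    \sum_(0 <= j < npieces S i)
      (\1_(piece S i j) w : R) *:
        hs_increment (coef S i j) (knot S i) (Num.min (knot S i.+1) t) w.

Definition admissible (Psi : R -> Omega -> U -> H) : Prop :=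
  [/\ forall (t : R) w, 0 <= t <= T -> hilbert_schmidt (Psi t w),
      forall t : R, 0 <= t <= T -> borel_measurable hs_open (F t) (Psi t)
    & forall w, hs_caglad_on T (Psi ^~ w)].

Definition simple_approx (S : nat -> simple_integrand)
    (Psi : R -> Omega -> U -> H) : Prop :=
  (forall n, simple_on (S n)) /\
  forall eps : R, 0 < eps ->
    P [set w | (eps%:E <
          skorokhod_dist T ((simple_process (S n)) ^~ w) (Psi ^~ w))%E]
      @[n --> \oo] --> 0%E.

(* I is the process (int_0^t Psi dL)_(0 <= t <= T): the extension by continuity
   of the integral of simple integrands. The existence clause prevents the last
   clause from being vacuous; it holds for every admissible Psi when the
   filtration is right-continuous at 0. *)
Definition stochastic_integral (Psi : R -> Omega -> U -> H)
    (I : R -> Omega -> H) : Prop :=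
  [/\ forall t : R, 0 <= t <= T -> borel_measurable open measurable (I t),
      forall w, cadlag_on T (I ^~ w),
      exists S, simple_approx S Psi
    & forall S, simple_approx S Psi ->
      forall t eps : R, 0 <= t <= T -> 0 < eps ->
        P [set w | eps < `|simple_integral (S n) t w - I t w|]
          @[n --> \oo] --> 0%E].

End cylindrical.
End probability.

Section constants.
Context {R : realType}.

(* For x <= 0, the analytic continuation Gamma x = Gamma (x + n) /
   (x (x + 1) ... (x + n - 1)) with x + n > 0; meaningful unless x is a
   nonpositive integer. *)
Definition Gamma (x : R) : R :=
  let n := if 0 < x then 0%N else (Num.truncn (- x)).+1 in
  (\int[lebesgue_measure]_(t in `]0, +oo[) (t `^ (x + n%:R - 1) * expR (- t)))
    / \prod_(k < n) (x + k%:R).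

Definition c_stable (alpha : R) : R :=
  if alpha == 1 then pi / 2 else - alpha * cos (alpha * pi / 2) * Gamma (- alpha).

Definition c1 (c alpha : R) : R :=
  c * Gamma (1 / 2) / (c_stable alpha * Gamma ((1 + alpha) / 2)).

Definition c2 (c alpha : R) : R := c1 c alpha * ((4 - alpha) / (2 - alpha)).

Context {H : hilbertType R}.

Local Notation borel := (g_sigma_algebraType (@open H)).

Definition symmetric_measure (mu : probability borel R) : Prop :=
  forall B : set borel, measurable B -> mu [set x | B (- (x : H))] = mu B.

(* If X, Y are independent with law mu, then a X + b Y has the law of
   (a^alpha + b^alpha)^(1/alpha) X + z. *)
Definition stable_measure (alpha : R) (mu : probability borel R) : Prop :=
  forall a b : R, 0 < a -> 0 < b -> exists z : H,
    forall B : set borel, measurable B ->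
      (mu \x mu)%E [set p | B (a *: (p.1 : H) + b *: (p.2 : H))] =
      mu [set x | B ((a `^ alpha + b `^ alpha) `^ alpha^-1 *: (x : H) + z)].

Definition scaled_tail (alpha : R) (mu : probability borel R) (r : R) : \bar R :=
  ((r `^ alpha)%:E * mu [set x | (r < `|(x : H)|)%R])%E.

Definition tail_constant (alpha c : R) : Prop :=
  forall mu : probability borel R,
    symmetric_measure mu -> stable_measure alpha mu ->
    (ereal_sup [set scaled_tail alpha mu r | r in `]0%R, +oo[] <=
      c%:E * lim (scaled_tail alpha mu r @[r --> +oo%R]))%E.

End constants.
Arguments tail_constant {R} H alpha c.

(* Main.v *)
(* The test function g(x) = exp (- lam |x|^2) is a limit of products of cosines
   cos (sqrt (2 lam / m) <x, e>) over orthonormal vectors e, and the expectation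
   of a cosine of L(t)u is known. Splitting cos a cos b into
   (cos (a + b) + cos (a - b)) / 2 and using that x^(alpha/2) is concave, one
   finds, for psi Hilbert-Schmidt and Z measurable at time s,
     E g(Z) - E g(Z + psi (L(t) - L(s))) <= (2 lam)^(alpha/2) (t - s) |psi|^alpha.
   Summing this along the steps of a simple integral stopped on leaving the ball
   of radius r gives
     (1 - exp (- lam r^2)) P (sup |int Psi dL| > r) <=
       (2 lam)^(alpha/2) E int |Psi|^alpha,
   first on finite sets of times; a truncation of the mass int |Psi|^alpha lets
   it pass to caglad integrands and, by right continuity, to all times.
   With x = lam r^2 the constant is (2 x)^(alpha/2) / (1 - exp (- x)). It is at
   most c2 for x = 2 (alpha <= 1) or x = 2/5 (alpha >= 1) by convexity of Gamma,
   because c >= 1: the law of L(1)u times a unit vector of H is symmetric and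
   stable, and its tail has a positive finite supremum, which bounds the limit
   from above. *)
Require Import Defs.
From HB Require Import structures.
From mathcomp Require Import all_boot all_order all_algebra.
From mathcomp Require Import all_classical all_reals all_analysis.
From mathcomp Require Import measurable_realfun.
From mathcomp Require Import ring lra.

Set Implicit Arguments.
Unset Strict Implicit.
Unset Printing Implicit Defensive.

Import Order.TTheory GRing.Theory Num.Theory.
Import numFieldNormedType.Exports.

Local Open Scope classical_set_scope.
Local Open Scope ring_scope.

(** * Hilbert spaces and Hilbert-Schmidt operators *)

(** The increments of [L] have no second moment, so no square-integrable martingale inequality
    applies to the integral; a bounded test function of the norm takes its place. The Gaussian is
    chosen because it factorizes along an orthonormal basis and each factor is a limit of powers of
    cosines, so that only the Fourier transforms of real increments enter. The squared norms of the
    vectors [adjoint psi (g k)] then add up to the squared Hilbert-Schmidt norm. Two obstacles shape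
    the rest. Adjoints and increments are chosen by [get] and mean nothing before their existence is
    proved; as the filtration need not contain the null sets, exceptional sets have to be removed
    inside it. Moreover the Skorokhod distance is an infimum over uncountably many time changes, and
    its level sets have to be measurable before Borel-Cantelli turns convergence in probability into
    almost sure convergence of the masses. No domination of these masses is available, hence the
    truncation. In the final comparison a large x favours small alpha and a small x favours alpha
    near 2, hence the two values of x. *)

Section inner_product.
Context {R : realType} {V : hilbertType R}.
Implicit Types (x y z : V) (a : R).

Lemma hdotDl x y z : hdot (x + y) z = hdot x z + hdot y z.
Proof. by rewrite -{1}[x]scale1r hdot_linear mul1r. Qed.

Lemma hdot0l z : hdot 0 z = 0 :> R.
Proof. by apply: (addrI (hdot (0 : V) z)); rewrite -hdotDl !addr0. Qed.

Lemma hdotZl a x z : hdot (a *: x) z = a * hdot x z.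
Proof. by rewrite -{1}[a *: x]addr0 hdot_linear hdot0l addr0. Qed.

Lemma hdotNl x z : hdot (- x) z = - hdot x z.
Proof. by rewrite -scaleN1r hdotZl mulN1r. Qed.

Lemma hdotBl x y z : hdot (x - y) z = hdot x z - hdot y z.
Proof. by rewrite hdotDl hdotNl. Qed.

Lemma hdotDr x y z : hdot z (x + y) = hdot z x + hdot z y.
Proof. by rewrite hdotC hdotDl !(hdotC z). Qed.

Lemma hdot0r z : hdot z 0 = 0 :> R.
Proof. by rewrite hdotC hdot0l. Qed.

Lemma hdotZr a x z : hdot z (a *: x) = a * hdot z x.
Proof. by rewrite hdotC hdotZl hdotC. Qed.

Lemma hdotNr x z : hdot z (- x) = - hdot z x.
Proof. by rewrite hdotC hdotNl hdotC. Qed.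

Lemma hdotBr x y z : hdot z (x - y) = hdot z x - hdot z y.
Proof. by rewrite hdotDr hdotNr. Qed.

Lemma hdot_suml (I : Type) (r : seq I) (Q : pred I) (f : I -> V) z :
  hdot (\sum_(i <- r | Q i) f i) z = \sum_(i <- r | Q i) hdot (f i) z.
Proof.
by elim/big_rec2: _ => [|i ? ? _ <-]; rewrite ?hdot0l ?hdotDl.
Qed.

Lemma hdot_sumr (I : Type) (r : seq I) (Q : pred I) (f : I -> V) z :
  hdot z (\sum_(i <- r | Q i) f i) = \sum_(i <- r | Q i) hdot z (f i).
Proof. by rewrite hdotC hdot_suml; apply: eq_bigr => i _; rewrite hdotC. Qed.

Lemma normD_sqr x y : `|x + y| ^+ 2 = `|x| ^+ 2 + 2 * hdot x y + `|y| ^+ 2.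
Proof.
rewrite -!hdot_norm !hdotDl !hdotDr (hdotC y x); ring.
Qed.

Lemma normB_sqr x y : `|x - y| ^+ 2 = `|x| ^+ 2 - 2 * hdot x y + `|y| ^+ 2.
Proof. by rewrite normD_sqr hdotNr normrN mulrN. Qed.

Lemma cauchy_schwarz x y : `|hdot x y| <= `|x| * `|y|.
Proof.
have [->|y0] := eqVneq y 0; first by rewrite hdot0r !normr0 mulr0.
have ny : 0 < `|y| ^+ 2 by rewrite exprn_gt0// normr_gt0.
rewrite -(@ler_pXn2r _ 2) ?nnegrE ?mulr_ge0// exprMn real_normK ?num_real//.
have := sqr_ge0 `|x - (hdot x y / `|y| ^+ 2) *: y|.
rewrite normB_sqr hdotZr normrZ exprMn real_normK ?num_real//.
have -> : `|x| ^+ 2 - 2 * (hdot x y / `|y| ^+ 2 * hdot x y) +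
  (hdot x y / `|y| ^+ 2) ^+ 2 * `|y| ^+ 2 = `|x| ^+ 2 - hdot x y ^+ 2 / `|y| ^+ 2.
  by field; rewrite gt_eqF// normr_gt0.
by rewrite subr_ge0 ler_pdivrMr.
Qed.

Lemma continuous_hdotl z : continuous (hdot ^~ z : V -> R).
Proof.
move=> x; apply/cvgrPdist_lt => e e0; near=> y.
rewrite -hdotBl (le_lt_trans (cauchy_schwarz _ _))//.
rewrite (@le_lt_trans _ _ (`|x - y| * (`|z| + 1)))//.
  by rewrite ler_wpM2l// lerDl.
rewrite -ltr_pdivlMr ?ltr_wpDl//.
by near: y; apply: cvgr_dist_lt => //; rewrite divr_gt0// ltr_wpDl.
Unshelve. all: by end_near. Qed.

Lemma continuous_hdotr z : continuous (hdot z : V -> R).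
Proof.
rewrite (_ : hdot z = hdot ^~ z); first exact: continuous_hdotl.
by apply/funext => y; rewrite hdotC.
Qed.

End inner_product.

(** * Orthonormal sequences in separable Hilbert spaces *)

Section orthonormal_sequences.
Context {R : realType} {V : hilbertType R}.
Implicit Types (x : V) (h : nat -> V) (a : nat -> R).

(* A complete orthonormal system listed as a sequence, padded with zeros so
   that finite-dimensional spaces are covered. *)
Definition onseq h :=
  [/\ forall i j, i != j -> hdot (h i) (h j) = 0,
      forall i, h i != 0 -> hdot (h i) (h i) = 1 &
      forall x, (forall i, hdot x (h i) = 0) -> x = 0].

(** Pythagoras. The coefficients at padding zeros must vanish, since there [a k ^+ 2] would count on
    the right side only. *)
Lemma onseq_sqr h a (m n : nat) : onseq h -> (forall k, h k = 0 -> a k = 0) ->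
  `|\sum_(m <= k < n) a k *: h k| ^+ 2 = \sum_(m <= k < n) a k ^+ 2.
Proof.
move=> [ho h1 _] ah; rewrite -hdot_norm hdot_suml big_seq [RHS]big_seq.
apply: eq_bigr => i; rewrite mem_index_iota => mi.
rewrite hdot_sumr (bigD1_seq i) ?mem_index_iota ?iota_uniq//=.
rewrite big1 ?addr0 => [|j ji]; last by rewrite hdotZl hdotZr ho ?mulr0// eq_sym.
case: (eqVneq (h i) 0) => [hi|hi]; first by rewrite ah// expr0n hi scaler0 hdot0l.
by rewrite hdotZl hdotZr h1// mulr1 expr2.
Qed.

(** By [onseq_sqr] the blocks of the vector series have the same squared norms as the blocks of a
    convergent real series, so the partial sums are Cauchy. *)
Lemma riesz_fischer h a (M : R) : onseq h -> (forall k, h k = 0 -> a k = 0) ->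
  (forall n, \sum_(0 <= k < n) a k ^+ 2 <= M) ->
  exists v, [/\ (\sum_(0 <= k < n) a k *: h k) @[n --> \oo] --> v,
    forall k, hdot v (h k) = a k &
    (\sum_(0 <= k < n) a k ^+ 2) @[n --> \oo] --> `|v| ^+ 2].
Proof.
move=> hh ah aM.
have ca : cvgn (series (fun k => a k ^+ 2)).
  apply: nondecreasing_is_cvgn.
    apply/nondecreasing_seqP => n; rewrite /series/= big_nat_recr//=.
    by rewrite lerDl sqr_ge0.
  by exists M => _ [n _ <-]; exact: aM.
have cs : cvgn (series (fun k => a k *: h k)).
  apply/cauchy_cvgP/cauchy_seriesP => e e0.
  have /cauchy_cvgP/cauchy_seriesP/(_ (e ^+ 2)) := ca.
  rewrite exprn_gt0// => /(_ isT); apply: filterS => n /=.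
  rewrite ger0_norm; last by apply: sumr_ge0 => k _; exact: sqr_ge0.
  by move=> ?; rewrite -(@ltr_pXn2r _ 2) ?nnegrE ?(ltW e0)// onseq_sqr.
move/cvg_ex: cs => [v cv].
exists v; split => //.
  move=> k.
  have c1 : hdot (series (fun k => a k *: h k) n) (h k) @[n --> \oo] --> hdot v (h k).
    exact: (@continuous_cvg _ _ _ _ _ _ (hdot ^~ (h k)) _ (@continuous_hdotl _ _ _ _)).
  suff : hdot (series (fun k => a k *: h k) n) (h k) @[n --> \oo] --> a k.
    by move=> c2; apply: (cvg_unique _ c1 c2).
  apply: cvg_near_cst; exists k.+1 => // n /= kn.
  case: hh => ho h1 _; rewrite hdot_suml.
  rewrite (bigD1_seq k) ?mem_index_iota ?iota_uniq//=.
  rewrite big1 ?addr0 => [|j ji]; last by rewrite hdotZl ho ?mulr0.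
  rewrite hdotZl; have [hk|hk] := eqVneq (h k) 0; last by rewrite h1 ?mulr1.
  by rewrite ah// mul0r.
under eq_fun do rewrite -(onseq_sqr _ _ hh ah).
rewrite expr2; under eq_fun do rewrite expr2.
by apply: cvgM; apply: cvg_norm.
Qed.

Lemma bessel h x (n : nat) : onseq h ->
  \sum_(0 <= k < n) hdot x (h k) ^+ 2 <= `|x| ^+ 2.
Proof.
move=> hh; have := sqr_ge0 `|x - \sum_(0 <= k < n) hdot x (h k) *: h k|.
rewrite normB_sqr hdot_sumr onseq_sqr//; last by move=> k ->; rewrite hdot0r.
under eq_bigr do rewrite hdotZr -expr2.
lra.
Qed.

Lemma onseq_expansion h x : onseq h ->
  (\sum_(0 <= k < n) hdot x (h k) *: h k) @[n --> \oo] --> x.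
Proof.
move=> hh; have [//|v [cv vh _]] := riesz_fischer hh _ (fun n => bessel x n hh).
  by move=> k ->; rewrite hdot0r.
have xv : x = v.
  by apply/eqP; rewrite -subr_eq0; apply/eqP; case: hh => _ _; apply => k; rewrite hdotBl vh subrr.
by rewrite [X in _ --> X]xv.
Qed.

Lemma parseval h x : onseq h ->
  (\sum_(0 <= k < n) hdot x (h k) ^+ 2) @[n --> \oo] --> `|x| ^+ 2.
Proof.
move=> hh; have h0 k : h k = 0 -> hdot x (h k) = 0 by move=> ->; rewrite hdot0r.
under eq_fun do rewrite -(onseq_sqr _ _ hh h0).
rewrite expr2; under eq_fun do rewrite expr2.
by apply: cvgM; apply: cvg_norm; exact: onseq_expansion.
Qed.

(** Distinct orthonormal vectors are at distance sqrt 2, so points of a dense set chosen within 1/2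
    of each are distinct. *)
Lemma orthonormal_countable (B : set V) : separable V -> Defs.orthonormal B -> countable B.
Proof.
move=> [D [cD dD]] oB.
have nb x : exists y, D y /\ `|x - y| < 2^-1.
  have [|y []] := dD (interior (ball x (2^-1 : R))) _ (open_interior _).
    exists x; apply: nbhsx_ballx; lra.
  by move=> /interior_subset; rewrite -ball_normE /= => xy Dy; exists y.
have [f fP] := choice nb.
have fi : set_inj B f.
  move=> x y /set_mem Bx /set_mem By fxy; apply/eqP/negPn/negP => xy.
  have := normB_sqr x y; rewrite -!hdot_norm !(oB x, oB y)// !eqxx (negbTE xy).
  have : `|x - y| < 1.
    rewrite -(subrK (f x) x) {2}fxy -addrA (le_lt_trans (ler_normD _ _))//.
    rewrite (splitr 1) ltrD ?div1r ?(fP x).2// distrC (fP y).2//.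
  move=> h; have : `|x - y| ^+ 2 < 1 by rewrite expr_lt1.
  by rewrite hdot_norm => h1 h2; move: h1; rewrite h2 mulr0 subr0 mulr1n; lra.
have /countable_injP[g gi] := cD.
apply/countable_injP; exists (g \o f) => x y Bx By /= gxy.
by apply: fi => //; apply: gi => //; apply/mem_set; exact: (fP _).1.
Qed.

End orthonormal_sequences.
Arguments onseq_expansion {R V h} x _.
Arguments parseval {R V h} x _.

(** An injection [f] of the basis into the naturals lists it: [h n] is the basis vector of code [n],
    or 0 if there is none. The second clause replaces the unordered sum in the Hilbert-Schmidt norm
    by a series; [f 0 = 0] makes the padding harmless. *)
Lemma onb_seq (R : realType) (V : hilbertType R) : separable V ->
  exists h : nat -> V, onseq h /\
    forall f : V -> \bar R, (forall x, (0 <= f x)%E) -> f 0 = 0%E ->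
    (\esum_(x in onb V) f x = \sum_(0 <= k <oo) f (h k))%E.
Proof.
move=> sV; have [oB tB] := onbP V.
have /countable_injP[f fi] := orthonormal_countable sV oB.
pose Q n := [set x | onb V x /\ f x = n].
pose p := [pred n | `[< Q n !=set0 >]].
pose e n := xget (0 : V) (Q n).
have eQ n : p n -> Q n (e n).
  by move=> /asboolP[x Qx]; exact: xgetI Qx.
have ef x : onb V x -> e (f x) = x.
  move=> Bx; have [Bx' fx'] : Q (f x) (e (f x)) by apply: eQ; apply/asboolP; exists x.
  by apply: fi => //; exact/mem_set.
have epi : set_inj [set n | p n] e.
  move=> m n /set_mem/eQ[_ fm] /set_mem/eQ[_ fn] emn; by rewrite -fm -fn emn.
have eB : onb V = [set e n | n in [set n | p n]].
  apply/seteqP; split => [x Bx|_ [n /eQ[? _] <-]//].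
  by exists (f x); [apply/asboolP; exists x|rewrite ef].
pose h n := if p n then e n else 0.
have hB n : p n -> onb V (h n) by rewrite /h => pn; rewrite pn; case: (eQ _ pn).
exists h; split; first split.
- move=> i j ij; rewrite /h; case: ifP => [pi|_]; last by rewrite hdot0l.
  case: ifP => [pj|_]; last by rewrite hdot0r.
  rewrite oB; [|by case: (eQ _ pi)|by case: (eQ _ pj)].
  case: eqP => // eij; exfalso; move/eqP: ij; apply.
  by apply: epi => //; exact/mem_set.
- move=> i; rewrite /h; case: ifP => [pi _|_]; last by rewrite eqxx.
  by rewrite oB ?eqxx//; case: (eQ _ pi).
- move=> x hx; apply: tB => y By; rewrite -(ef _ By).
  have := hx (f y); rewrite /h; case: ifP => // /negP; case; apply/asboolP.
  by exists y.
move=> F F0 F00; rewrite eB (@esum_pred_image _ _ _ _ p)//.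
rewrite [LHS]eseries_mkcond; apply: eq_eseriesr => n _.
by rewrite /h; case: ifP.
Qed.

(** * The Hilbert-Schmidt norm and the adjoint *)

Section hilbert_schmidt_operators.
Context {R : realType} {U H : hilbertType R}.
Hypothesis sU : separable U.
Implicit Types (phi psi : U -> H) (u : U) (h : H) (a : R).

Lemma hs_norm_ge0 psi : 0 <= hs_norm psi.
Proof. exact: sqrtr_ge0. Qed.

Lemma hs_norm2_ge0 psi : (0 <= hs_norm2 psi)%E.
Proof. by apply: esum_ge0 => x _; rewrite lee_fin sqr_ge0. Qed.

Lemma hs_norm_sqr psi : hilbert_schmidt psi -> ((hs_norm psi ^+ 2)%:E = hs_norm2 psi)%E.
Proof.
move=> [_ _ hf]; rewrite /hs_norm sqr_sqrtr ?fine_ge0 ?hs_norm2_ge0//.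
by rewrite fineK// ge0_fin_numE ?hs_norm2_ge0.
Qed.

Lemma hs_norm2_series (e : nat -> U) psi :
  (forall f : U -> \bar R, (forall x, (0 <= f x)%E) -> f 0 = 0%E ->
    (\esum_(x in onb U) f x = \sum_(0 <= k <oo) f (e k))%E) -> psi 0 = 0 ->
  (hs_norm2 psi = \sum_(0 <= k <oo) (`|psi (e k)| ^+ 2)%:E)%E.
Proof.
move=> he p0; apply: he => [x|]; first by rewrite lee_fin sqr_ge0.
by rewrite p0 normr0 expr0n.
Qed.

Lemma linear_map0 psi : linear psi -> psi 0 = 0.
Proof.
move=> lp; have := lp 1 0 0; rewrite !scale1r addr0 => h.
by apply: (addrI (psi 0)); rewrite -h addr0.
Qed.

(** Interface for norm inequalities: the norm is used and estimated through real finite sums along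
    one fixed basis, away from the sum over [onb U] in the extended reals. *)
Lemma hs_basis : exists e : nat -> U, [/\ onseq e,
  forall psi, hilbert_schmidt psi ->
    forall n, \sum_(0 <= k < n) `|psi (e k)| ^+ 2 <= hs_norm psi ^+ 2 &
  forall psi M, linear psi -> continuous psi ->
    (forall n, \sum_(0 <= k < n) `|psi (e k)| ^+ 2 <= M) ->
    hilbert_schmidt psi /\ hs_norm psi ^+ 2 <= M].
Proof.
have [e [oe he]] := onb_seq sU; exists e; split => //.
  move=> psi hp n; rewrite -lee_fin hs_norm_sqr// (hs_norm2_series he); last first.
    by case: hp => /linear_map0.
  rewrite -sumEFin; apply: nneseries_lim_ge => k _ _.
  by rewrite lee_fin sqr_ge0.
move=> psi M lp cp hM.
have hle : (hs_norm2 psi <= M%:E)%E.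
  rewrite (hs_norm2_series he) ?linear_map0//.
  apply: lime_le; first by apply: is_cvg_nneseries => k _ _; rewrite lee_fin sqr_ge0.
  by near=> n; rewrite sumEFin lee_fin.
have hs : hilbert_schmidt psi by split => //; rewrite (le_lt_trans hle)// ltry.
by split => //; rewrite -lee_fin hs_norm_sqr.
Unshelve. all: by end_near. Qed.

(** Minkowski's inequality, from (x + y)^2 <= (1 + t/s) x^2 + (1 + s/t) y^2 at s = A, t = B. Both
    are first enlarged slightly because they may vanish. *)
Lemma sqr_sum_le (A B : R) : 0 <= A -> 0 <= B ->
  forall n (x y : nat -> R),
  \sum_(0 <= k < n) x k ^+ 2 <= A ^+ 2 -> \sum_(0 <= k < n) y k ^+ 2 <= B ^+ 2 ->
  \sum_(0 <= k < n) (x k + y k) ^+ 2 <= (A + B) ^+ 2.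
Proof.
move=> A0 B0 n x y xA yB.
have main (s t : R) : 0 < s -> 0 < t -> A <= s -> B <= t ->
    \sum_(0 <= k < n) (x k + y k) ^+ 2 <= (s + t) ^+ 2.
  move=> s0 t0 As Bt.
  have -> : (s + t) ^+ 2 = (1 + t / s) * s ^+ 2 + (1 + s / t) * t ^+ 2.
    by field; rewrite !gt_eqF.
  apply: (@le_trans _ _ (\sum_(0 <= k < n) ((1 + t / s) * x k ^+ 2 + (1 + s / t) * y k ^+ 2))).
    apply: ler_sum => k _.
    have -> : (1 + t / s) * x k ^+ 2 + (1 + s / t) * y k ^+ 2 =
      (x k + y k) ^+ 2 + (t * x k - s * y k) ^+ 2 / (s * t).
      by field; rewrite !gt_eqF.
    by rewrite lerDl divr_ge0 ?sqr_ge0// mulr_ge0 ?ltW.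
  rewrite big_split/= -!mulr_sumr lerD// ler_wpM2l ?addr_ge0 ?divr_ge0 ?(ltW s0) ?(ltW t0)//.
    by rewrite (le_trans xA)// lerXn2r ?nnegrE ?(ltW s0).
  by rewrite (le_trans yB)// lerXn2r ?nnegrE ?(ltW t0).
apply/ler_addgt0Pr => d d0.
have [d' d'0 d'd] : exists2 d', 0 < d' & (A + d' + (B + d')) ^+ 2 <= (A + B) ^+ 2 + d.
  (* Enlarging both terms by r <= 1 adds 4 r (A + B) + 4 r^2 <= 4 r (A + B + 1) to the square. *)
  exists (Num.min 1 (d / (4 * (A + B + 1)))).
    by rewrite lt_min ltr01 divr_gt0// mulr_gt0// ltr_wpDl// addr_ge0//.
  set r := Num.min _ _.
  have r1 : r <= 1 by rewrite ge_min lexx.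
  have r0 : 0 <= r by rewrite le_min ler01 divr_ge0 ?(ltW d0)// mulr_ge0// !addr_ge0.
  have rd : r * (4 * (A + B + 1)) <= d.
    rewrite -ler_pdivlMr ?ge_min ?lexx ?orbT// mulr_gt0// ltr_wpDl// addr_ge0//.
  nra.
by apply: le_trans d'd; apply: main; rewrite ?ltr_wpDl// lerDl ltW.
Qed.

Lemma hs_add phi psi : hilbert_schmidt phi -> hilbert_schmidt psi ->
  hilbert_schmidt (phi + psi) /\ hs_norm (phi + psi) <= hs_norm phi + hs_norm psi.
Proof.
move=> hphi hpsi; have [e [oe le ge]] := hs_basis.
have [|||hs hM] := ge (phi + psi) ((hs_norm phi + hs_norm psi) ^+ 2).
- case: hphi hpsi => l1 _ _ [l2 _ _] a u v.
  by rewrite !fctE l1 l2 scalerDr addrACA.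
- by case: hphi hpsi => _ c1 _ [_ c2 _] x; apply: continuousD; [exact: c1|exact: c2].
- move=> n; apply: (@le_trans _ _ (\sum_(0 <= k < n) (`|phi (e k)| + `|psi (e k)|) ^+ 2)).
    by apply: ler_sum => k _; rewrite lerXn2r ?nnegrE ?addr_ge0// ler_normD.
  by apply: sqr_sum_le; rewrite ?hs_norm_ge0 ?le.
split=> //; rewrite -(@ler_pXn2r _ 2) ?nnegrE ?addr_ge0 ?hs_norm_ge0//.
Qed.

Lemma hs_scale a psi : hilbert_schmidt psi ->
  hilbert_schmidt (a *: psi) /\ hs_norm (a *: psi) <= `|a| * hs_norm psi.
Proof.
move=> hpsi; have [e [oe le ge]] := hs_basis.
have [|||hs hM] := ge (a *: psi) ((`|a| * hs_norm psi) ^+ 2).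
- by case: hpsi => l1 _ _ b u v; rewrite !fctE l1 scalerDr !scalerA (mulrC a).
- by case: hpsi => _ c1 _ x; apply: cvgZr; exact: c1.
- move=> n; rewrite exprMn; under eq_bigr do rewrite fctE normrZ exprMn.
  by rewrite -mulr_sumr ler_wpM2l ?sqr_ge0 ?le.
split=> //; rewrite -(@ler_pXn2r _ 2) ?nnegrE ?mulr_ge0 ?hs_norm_ge0//.
Qed.

Lemma hs_sub phi psi : hilbert_schmidt phi -> hilbert_schmidt psi ->
  hilbert_schmidt (phi - psi).
Proof.
move=> h1 h2; have [h3 _] := hs_scale (-1) h2.
by rewrite -scaleN1r; case: (hs_add h1 h3).
Qed.

Lemma hs_normN psi : hs_norm (- psi) = hs_norm psi.
Proof.
rewrite /hs_norm /hs_norm2; congr (Num.sqrt (fine _)).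
by apply: eq_esum => x _; rewrite fctE normrN.
Qed.

Lemma hs_distC phi psi : hs_norm (phi - psi) = hs_norm (psi - phi).
Proof. by rewrite -hs_normN opprB. Qed.

Lemma hs_norm_triangle phi psi eta : hilbert_schmidt phi -> hilbert_schmidt psi ->
  hilbert_schmidt eta ->
  hs_norm (phi - psi) <= hs_norm (phi - eta) + hs_norm (eta - psi).
Proof.
move=> h1 h2 h3; rewrite -(subrKA eta phi).
by have [_] := hs_add (hs_sub h1 h3) (hs_sub h3 h2).
Qed.

Lemma hs_norm0 : hs_norm (0 : U -> H) = 0.
Proof.
rewrite /hs_norm /hs_norm2 esum1 ?sqrtr0// => x _.
by rewrite [(0 : U -> H) x](_ : _ = 0)// normr0 expr0n.
Qed.

Lemma hs_dist_norm phi psi : hilbert_schmidt phi -> hilbert_schmidt psi ->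
  `|hs_norm phi - hs_norm psi| <= hs_norm (phi - psi).
Proof.
move=> h1 h2; have [_] := hs_add (hs_sub h1 h2) h2.
have [_] := hs_add (hs_sub h2 h1) h1.
rewrite !subrK (hs_distC psi) => a b; rewrite ler_norml; apply/andP; split; lra.
Qed.

Lemma hs_zero : hilbert_schmidt (0 : U -> H).
Proof.
split; first by move=> a u v; rewrite /= scaler0 addr0.
  by move=> x; exact: cvg_cst.
by rewrite /hs_norm2 esum1// => x _; rewrite [(0 : U -> H) x](_ : _ = 0)// normr0 expr0n.
Qed.

(** The [get] in [adjoint] needs a witness: the vector with coordinates [hdot (psi (e k)) h], whose
    squares sum to at most the square of [hs_norm psi * |h|]. *)
Lemma adjointP psi : hilbert_schmidt psi ->
  forall u h, hdot (psi u) h = hdot u (adjoint psi h).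
Proof.
move=> hp u h; move: u; apply: (@getPex _ [set v : U | forall u, hdot (psi u) h = hdot u v]).
have [e [oe le _]] := hs_basis; have [lp cp _] := hp.
have bnd n : \sum_(0 <= k < n) hdot (psi (e k)) h ^+ 2 <= (hs_norm psi * `|h|) ^+ 2.
  apply: (@le_trans _ _ (\sum_(0 <= k < n) `|psi (e k)| ^+ 2 * `|h| ^+ 2)).
    apply: ler_sum => k _; rewrite -exprMn -(real_normK (num_real (hdot _ _))).
    by rewrite lerXn2r ?nnegrE ?mulr_ge0// cauchy_schwarz.
  by rewrite -mulr_suml exprMn ler_wpM2r ?sqr_ge0 ?le.
have [|v [cv vh _]] := riesz_fischer oe _ bnd.
  by move=> k ->; rewrite (linear_map0 lp) hdot0l.
exists v => u.
have c1 := onseq_expansion u oe.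
have c2 : hdot (psi (\sum_(0 <= k < n) hdot u (e k) *: e k)) h @[n --> \oo]
    --> hdot (psi u) h.
  apply: (@continuous_cvg _ _ _ _ _ _ (hdot ^~ h)); first exact: continuous_hdotl.
  by apply: (@continuous_cvg _ _ _ _ _ _ psi) => //; exact: cp.
have psum (n : nat) : psi (\sum_(0 <= k < n) hdot u (e k) *: e k) =
    \sum_(0 <= k < n) hdot u (e k) *: psi (e k).
  elim: n => [|n IH]; first by rewrite !big_nil linear_map0.
  by rewrite !big_nat_recr//= addrC lp IH addrC.
have c3 : hdot u (\sum_(0 <= k < n) hdot (psi (e k)) h *: e k) @[n --> \oo] --> hdot u v.
  by apply: (@continuous_cvg _ _ _ _ _ _ (hdot u)) => //; exact: continuous_hdotr.
apply: (cvg_unique _ c2 _) => //; apply: cvg_trans c3; apply: near_eq_cvg; apply: nearW => n /=.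
rewrite psum hdot_suml hdot_sumr; apply: eq_bigr => k _; by rewrite hdotZl hdotZr mulrC.
Qed.

Lemma hdot_inj (x y : U) : (forall u, hdot u x = hdot u y) -> x = y.
Proof.
move=> xy; apply/eqP; rewrite -subr_eq0 -normr_eq0 -sqrf_eq0 -hdot_norm.
by rewrite hdotBr !xy subrr.
Qed.

Lemma adjoint_linear psi : hilbert_schmidt psi -> linear (adjoint psi).
Proof.
move=> hp a x y; apply: hdot_inj => u.
by rewrite -adjointP// !hdotDr !hdotZr !adjointP.
Qed.

(** Passing to the adjoint does not increase the Hilbert-Schmidt norm: expand by Parseval in [U],
    exchange the sums and apply Bessel in [H]. *)
Lemma adjoint_sqr_sum (g : nat -> H) psi n : onseq g -> hilbert_schmidt psi ->
  \sum_(0 <= j < n) `|adjoint psi (g j)| ^+ 2 <= hs_norm psi ^+ 2.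
Proof.
move=> og hp; have [e [oe le _]] := hs_basis.
have c : (\sum_(0 <= j < n) \sum_(0 <= k < m) hdot (adjoint psi (g j)) (e k) ^+ 2)
    @[m --> \oo] --> \sum_(0 <= j < n) `|adjoint psi (g j)| ^+ 2.
  elim: n => [|n IH].
    by under eq_fun do rewrite big_nil; rewrite big_nil; exact: cvg_cst.
  under eq_fun do rewrite big_nat_recr//=.
  by rewrite big_nat_recr//=; apply: cvgD => //; exact: parseval.
rewrite -(cvg_lim _ c)//; apply: limr_le; first by apply/cvg_ex; eexists; exact: c.
apply: nearW => m; rewrite exchange_big/=.
apply: le_trans (le _ hp m); apply: ler_sum => k _.
apply: le_trans (bessel (psi (e k)) n og); apply: ler_sum => j _.
by rewrite adjointP// (hdotC (e k)).
Qed.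

Lemma adjoint_norm psi h : hilbert_schmidt psi -> `|adjoint psi h| <= hs_norm psi * `|h|.
Proof.
move=> hp; have [e [oe le _]] := hs_basis.
rewrite -(@ler_pXn2r _ 2) ?nnegrE ?mulr_ge0 ?hs_norm_ge0//.
have c := parseval (adjoint psi h) oe.
rewrite -(cvg_lim _ c)//; apply: limr_le; first by apply/cvg_ex; eexists; exact: c.
apply: nearW => m.
apply: (@le_trans _ _ (\sum_(0 <= k < m) `|psi (e k)| ^+ 2 * `|h| ^+ 2)).
  apply: ler_sum => k _; rewrite -exprMn -(real_normK (num_real (hdot _ _))).
  by rewrite lerXn2r ?nnegrE ?mulr_ge0// hdotC -adjointP// cauchy_schwarz.
by rewrite -mulr_suml exprMn ler_wpM2r ?sqr_ge0 ?le.
Qed.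

Lemma continuous_adjoint psi : hilbert_schmidt psi -> continuous (adjoint psi).
Proof.
move=> hp x; apply/cvgrPdist_lt => e e0; near=> y.
have lN := adjoint_linear hp.
have -> : adjoint psi x - adjoint psi y = adjoint psi (x - y).
  by rewrite addrC -scaleN1r -lN scaleN1r addrC.
rewrite (le_lt_trans (adjoint_norm _ hp))//.
rewrite (@le_lt_trans _ _ ((hs_norm psi + 1) * `|x - y|))//.
  by rewrite ler_wpM2r// lerDl.
rewrite mulrC -ltr_pdivlMr ?ltr_wpDl ?hs_norm_ge0//.
by near: y; apply: cvgr_dist_lt => //; rewrite divr_gt0// ltr_wpDl ?hs_norm_ge0.
Unshelve. all: by end_near. Qed.

End hilbert_schmidt_operators.

(** * Expectations and independence *)

Lemma cvgn_le (R : realType) (u : nat -> R) (l M : R) :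
  u n @[n --> \oo] --> l -> (forall n, u n <= M) -> l <= M.
Proof.
move=> ul uM; rewrite -(cvg_lim _ ul)//; apply: limr_le; last exact: nearW.
by apply/cvg_ex; exists l.
Qed.

Lemma cvgn_ge (R : realType) (u : nat -> R) (l M : R) :
  u n @[n --> \oo] --> l -> (forall n, M <= u n) -> M <= l.
Proof.
move=> ul uM; rewrite -(cvg_lim _ ul)//; apply: limr_ge; last exact: nearW.
by apply/cvg_ex; exists l.
Qed.

Lemma cvgn_ler (R : realType) (u v : nat -> R) (a b : R) :
  u n @[n --> \oo] --> a -> v n @[n --> \oo] --> b -> (forall n, u n <= v n) -> a <= b.
Proof.
move=> ua vb uv; rewrite -subr_ge0; apply: (cvgn_ge (cvgB vb ua)) => n /=.
by rewrite subr_ge0.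
Qed.

Section bounded_measurable.
Context {R : realType} {d : measure_display} {Omega : measurableType d}.
Variable P : probability Omega R.
Implicit Types f g : Omega -> R.

(** All expectations below are of bounded functions, so that [Ex] is real valued and linear without
    further integrability conditions. *)
Definition bounded_measurable f :=
  measurable_fun setT f /\ exists M : R, forall w, `|f w| <= M.

Lemma measurable_fun_continuous (h : R -> R) f : continuous h ->
  measurable_fun setT f -> measurable_fun setT (h \o f).
Proof. by move=> /continuous_measurable_fun mh mf; exact: measurableT_comp. Qed.

Lemma bm_integrable f : bounded_measurable f -> P.-integrable setT (EFin \o f).
Proof.
move=> [mf [M fM]]; apply: measurable_bounded_integrable => //.
  by rewrite (le_lt_trans (probability_le1 _ _)) ?ltry.
exists M; split; first exact: num_real.
by move=> x Mx w _ /=; rewrite (le_trans (fM w))// ltW.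
Qed.

Lemma bm_cst a : bounded_measurable (fun=> a).
Proof. by split; [exact: measurable_cst|exists `|a|]. Qed.

Lemma bmD f g : bounded_measurable f -> bounded_measurable g ->
  bounded_measurable (fun w => f w + g w).
Proof.
move=> [mf [M fM]] [mg [N gN]]; split; first exact: measurable_funD.
by exists (M + N) => w; rewrite (le_trans (ler_normD _ _))// lerD.
Qed.

Lemma bmM f g : bounded_measurable f -> bounded_measurable g ->
  bounded_measurable (fun w => f w * g w).
Proof.
move=> [mf [M fM]] [mg [N gN]]; split; first exact: measurable_funM.
by exists (M * N) => w; rewrite normrM ler_pM.
Qed.

Lemma bmZ a f : bounded_measurable f -> bounded_measurable (fun w => a * f w).
Proof. by move=> bf; apply: bmM => //; exact: bm_cst. Qed.

Lemma bmN f : bounded_measurable f -> bounded_measurable (fun w => - f w).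
Proof. by move=> /(bmZ (-1)); under [X in _ X -> _]eq_fun do rewrite mulN1r. Qed.

Lemma bmB f g : bounded_measurable f -> bounded_measurable g ->
  bounded_measurable (fun w => f w - g w).
Proof. by move=> bf /bmN bg; exact: bmD. Qed.

Lemma bm_indic (A : set Omega) : measurable A -> bounded_measurable (\1_A : Omega -> R).
Proof.
move=> mA; split; first exact: measurable_indic.
by exists 1 => w; rewrite indicE; case: (_ \in _); rewrite ?normr1 ?normr0.
Qed.

Lemma bm_cos f : measurable_fun setT f -> bounded_measurable (fun w => cos (f w)).
Proof.
move=> mf; split; first by apply: measurable_fun_continuous => //; exact: continuous_cos.
by exists 1 => w; rewrite ler_norml cos_geN1 cos_le1.
Qed.

Lemma bm_sin f : measurable_fun setT f -> bounded_measurable (fun w => sin (f w)).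
Proof.
move=> mf; split; first by apply: measurable_fun_continuous => //; exact: continuous_sin.
by exists 1 => w; rewrite ler_norml sin_geN1 sin_le1.
Qed.

Lemma bm_prod (I : Type) (r : seq I) (F : I -> Omega -> R) :
  (forall i, bounded_measurable (F i)) ->
  bounded_measurable (fun w => \prod_(i <- r) F i w).
Proof.
move=> bF; elim: r => [|i r IH].
  by under eq_fun do rewrite big_nil; exact: bm_cst.
by under eq_fun do rewrite big_cons; exact: bmM.
Qed.

Lemma bm_sum (I : Type) (r : seq I) (F : I -> Omega -> R) :
  (forall i, bounded_measurable (F i)) ->
  bounded_measurable (fun w => \sum_(i <- r) F i w).
Proof.
move=> bF; elim: r => [|i r IH].
  by under eq_fun do rewrite big_nil; exact: bm_cst.
by under eq_fun do rewrite big_cons; exact: bmD.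
Qed.

Definition Ex f : R := \int[P]_w f w.

Lemma ExE f : bounded_measurable f -> (\int[P]_w (f w)%:E = (Ex f)%:E)%E.
Proof.
move=> /bm_integrable fi; rewrite /Ex /Rintegral fineK//.
exact: integrable_fin_num.
Qed.

Lemma ExD f g : bounded_measurable f -> bounded_measurable g ->
  Ex (fun w => f w + g w) = Ex f + Ex g.
Proof. by move=> /bm_integrable bf /bm_integrable bg; exact: RintegralD. Qed.

Lemma ExB f g : bounded_measurable f -> bounded_measurable g ->
  Ex (fun w => f w - g w) = Ex f - Ex g.
Proof. by move=> /bm_integrable bf /bm_integrable bg; exact: RintegralB. Qed.

Lemma ExZ a f : bounded_measurable f -> Ex (fun w => a * f w) = a * Ex f.
Proof. by move=> /bm_integrable bf; exact: RintegralZl. Qed.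

Lemma Ex_cst a : Ex (fun=> a) = a.
Proof.
by rewrite /Ex /Rintegral integral_cst//= probability_setT mule1.
Qed.

Lemma Ex_le f g : bounded_measurable f -> bounded_measurable g ->
  (forall w, f w <= g w) -> Ex f <= Ex g.
Proof. by move=> /bm_integrable bf /bm_integrable bg fg; apply: le_Rintegral. Qed.

Lemma Ex_ge0 f : (forall w, 0 <= f w) -> 0 <= Ex f.
Proof. by move=> f0; apply: Rintegral_ge0. Qed.

Lemma Ex_sum (I : Type) (r : seq I) (F : I -> Omega -> R) :
  (forall i, bounded_measurable (F i)) ->
  Ex (fun w => \sum_(i <- r) F i w) = \sum_(i <- r) Ex (F i).
Proof.
move=> bF; elim: r => [|i r IH].
  by under [in LHS]eq_fun do rewrite big_nil; rewrite big_nil Ex_cst.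
under [in LHS]eq_fun do rewrite big_cons.
by rewrite big_cons ExD// ?IH//; exact: bm_sum.
Qed.

Lemma Ex_indic (A : set Omega) : measurable A -> Ex \1_A = fine (P A).
Proof. by move=> mA; rewrite /Ex /Rintegral integral_indic// setIT. Qed.

Lemma Ex_ae_eq f g : bounded_measurable f -> bounded_measurable g ->
  {ae P, forall w, f w = g w} -> Ex f = Ex g.
Proof.
move=> [mf _] [mg _] fg; congr fine; apply: ae_eq_integral => //.
- exact/measurable_EFinP.
- exact/measurable_EFinP.
- by apply: filterS fg => w /= -> _.
Qed.

Lemma Ex_cvg (F : nat -> Omega -> R) f (M : R) :
  (forall n, measurable_fun setT (F n)) -> (forall n w, `|F n w| <= M) ->
  (forall w, F n w @[n --> \oo] --> f w) ->
  Ex (F n) @[n --> \oo] --> Ex f.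
Proof.
move=> mF FM Ff.
have mf : measurable_fun setT f by apply: measurable_fun_cvg => //.
have bf : bounded_measurable f.
  by split=> //; exists M => w; apply: (cvgn_le (cvg_norm (Ff w))).
have bF n : bounded_measurable (F n) by split => //; exists M.
suff c : (\int[P]_w (F n w)%:E)%E @[n --> \oo] --> (Ex f)%:E by exact: (fine_cvg c).
rewrite -ExE//.
apply: (@dominated_cvg _ _ _ _ _ _ _ _ (fun=> M%:E)) => //.
- by move=> n; exact/measurable_EFinP.
- by move=> w _; apply: cvg_EFin => //; [exact: nearW|exact: Ff].
- by apply: (bm_integrable (bm_cst M)).
- by move=> n w _; rewrite abse_EFin lee_fin.
Qed.

End bounded_measurable.

(** * Product rule for expectations of independent functions *)

Section independence.
Context {R : realType} {d : measure_display} {Omega : measurableType d}.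
Variable P : probability Omega R.
Implicit Types f g : Omega -> R.

Lemma measurable_slab f (a b : R) : measurable_fun setT f ->
  measurable [set w | a <= f w < b].
Proof.
move=> mf; have -> : [set w | a <= f w < b] = setT `&` f @^-1` `[a, b[%classic.
  by rewrite setTI; apply/seteqP; split => w /=; rewrite in_itv.
exact: mf.
Qed.

(** Approximation from below, within 1/N, of a function with values in [0, 1]. There are N + 1 slabs
    because the value 1 falls into the one with k = N. *)
Let stair (N : nat) f (w : Omega) : R :=
  \sum_(k <- index_iota 0 N.+1) k%:R / N%:R * \1_[set w | k%:R / N%:R <= f w < k.+1%:R / N%:R] w.

Let stairP (N : nat) f w : (0 < N)%N -> 0 <= f w <= 1 ->
  stair N f w <= f w <= stair N f w + N%:R^-1.
Proof.
move=> N0 /andP[f0 f1]; have N0' : 0 < N%:R :> R by rewrite ltr0n.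
pose k := Num.truncn (N%:R * f w).
have /truncn_itv/andP[k1 k2] : 0 <= N%:R * f w by rewrite mulr_ge0.
have kN : (k < N.+1)%N.
  by rewrite ltnS -(ler_nat R) (le_trans k1)// ler_piMr.
have -> : stair N f w = k%:R / N%:R.
  rewrite /stair (bigD1_seq k) ?mem_index_iota ?iota_uniq//= big1.
    rewrite addr0 indicE mem_set ?mulr1//=.
    by rewrite ler_pdivrMr// ltr_pdivlMr// mulrC k1.
  move=> j jk; rewrite indicE memNset ?mulr0//=.
  rewrite ler_pdivrMr// ltr_pdivlMr// mulrC => /truncn_def jE.
  by move: jk; rewrite /k jE eqxx.
rewrite ler_pdivrMr// [f w * _]mulrC k1/= -[X in _ + X]mul1r -mulrDl.
by rewrite ler_pdivlMr// mulrC natr1 ltW.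
Qed.

(** Independence is given for events only. The staircase functions inherit the product rule by
    bilinearity, and replacing them by [f] and [g] costs at most 3/N. *)
Lemma Ex_indep01 f g : measurable_fun setT f -> measurable_fun setT g ->
  (forall w, 0 <= f w <= 1) -> (forall w, 0 <= g w <= 1) ->
  (forall a b a' b', P ([set w | a <= f w < b] `&` [set w | a' <= g w < b']) =
    (P [set w | (a <= f w < b)%R] * P [set w | (a' <= g w < b')%R])%E) ->
  Ex P (fun w => f w * g w) = Ex P f * Ex P g.
Proof.
move=> mf mg f01 g01 ind.
have bm01 (h : Omega -> R) : measurable_fun setT h -> (forall w, 0 <= h w <= 1) -> bounded_measurable h.
  by move=> mh h01; split => //; exists 1 => w; rewrite ger0_norm; case/andP: (h01 w).
have bst N (h : Omega -> R) : measurable_fun setT h -> bounded_measurable (stair N h).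
  move=> mh; apply: bm_sum => k; apply: bmZ; apply: bm_indic.
  exact: measurable_slab.
have Est N : Ex P (fun w => stair N f w * stair N g w) = Ex P (stair N f) * Ex P (stair N g).
  have bi (h : Omega -> R) k : measurable_fun setT h ->
    bounded_measurable (\1_[set w | k%:R / N%:R <= h w < k.+1%:R / N%:R] : Omega -> R).
    by move=> mh; apply: bm_indic; exact: measurable_slab.
  rewrite /stair; under [in LHS]eq_fun do rewrite mulr_suml.
  rewrite Ex_sum; last by move=> k; apply: bmM; [exact/bmZ/bi|exact: bst].
  rewrite !Ex_sum; do ?by move=> k; exact/bmZ/bi.
  rewrite mulr_suml; apply: eq_bigr => k _; rewrite mulr_sumr.
  under [in LHS]eq_fun do rewrite mulr_sumr.
  rewrite Ex_sum; last by move=> j; apply: bmM; exact/bmZ/bi.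
  apply: eq_bigr => j _.
  set A := [set w | _ <= f w < _]; set B := [set w | _ <= g w < _].
  have mA : measurable A by exact: measurable_slab.
  have mB : measurable B by exact: measurable_slab.
  have -> : (fun w => k%:R / N%:R * \1_A w * (j%:R / N%:R * \1_B w)) =
      (fun w => k%:R / N%:R * (j%:R / N%:R) * (\1_(A `&` B) w : R)).
    by apply/funext => w; rewrite indicI/=; ring.
  rewrite !ExZ; do ?by [apply: bm_indic|apply: bm_indic; exact: measurableI].
  rewrite !Ex_indic//; last exact: measurableI.
  rewrite ind fineM ?fin_num_measure//; ring.
have st0 N (h : Omega -> R) w : 0 <= stair N h w.
  by apply: sumr_ge0 => k _; rewrite mulr_ge0 ?divr_ge0 ?ler0n.
have bf := bm01 _ mf f01; have bg := bm01 _ mg g01.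
have main N : (0 < N)%N ->
    `|Ex P (fun w => f w * g w) - Ex P f * Ex P g| <= 3 * N%:R^-1.
  move=> N0; set e := N%:R^-1 : R.
  have e0 : 0 < e by rewrite invr_gt0 ltr0n.
  have e1 : e <= 1 by rewrite invf_le1 ?ltr0n// ler1n.
  have bsf := bst N _ mf; have bsg := bst N _ mg.
  have Ele (h : Omega -> R) : measurable_fun setT h -> (forall w, 0 <= h w <= 1) ->
      [/\ 0 <= Ex P (stair N h), Ex P (stair N h) <= 1,
        Ex P (stair N h) <= Ex P h & Ex P h <= Ex P (stair N h) + e].
    move=> mh h01; have bh := bm01 _ mh h01; have bsh := bst N _ mh.
    have sh w := stairP N0 (h01 w).
    split; first by apply: Ex_ge0 => w.
    - rewrite -[leRHS](Ex_cst P 1); apply: Ex_le => //; first exact: bm_cst.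
      by move=> w; case/andP: (h01 w) => _; apply: le_trans; case/andP: (sh w).
    - by apply: Ex_le => // w; case/andP: (sh w).
    - rewrite -[X in _ + X](Ex_cst P e) -ExD//; last exact: bm_cst.
      apply: Ex_le => //; first by apply: bmD => //; exact: bm_cst.
      by move=> w; case/andP: (sh w).
  have [sf0 sf1 sfl sfr] := Ele _ mf f01; have [sg0 sg1 sgl sgr] := Ele _ mg g01.
  have l1 : Ex P (stair N f) * Ex P (stair N g) <= Ex P (fun w => f w * g w).
    rewrite -Est; apply: Ex_le; [exact: bmM|exact: bmM|] => w.
    by apply: ler_pM => //; [have /andP[] := stairP N0 (f01 w)|have /andP[] := stairP N0 (g01 w)].
  have l2 : Ex P (fun w => f w * g w) <= Ex P (stair N f) * Ex P (stair N g) + 3 * e.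
    rewrite -Est -[X in _ + X](Ex_cst P (3 * e)) -ExD; [|exact: bmM|exact: bm_cst].
    apply: Ex_le; [exact: bmM|by apply: bmD; [exact: bmM|exact: bm_cst]|] => w.
    have /andP[p1 p2] := stairP N0 (f01 w); have /andP[q1 q2] := stairP N0 (g01 w).
    have := st0 N f w; have := st0 N g w; have := f01 w; have := g01 w.
    move: p1 p2 q1 q2; rewrite -/e; move: (stair N f w) (stair N g w) (f w) (g w) => a b x y *.
    nra.
  rewrite ler_norml; apply/andP; split; nra.
apply/eqP; rewrite -subr_eq0 -normr_le0; apply/ler_addgt0Pr => e e0; rewrite add0r.
have [N _ hN] := near_infty_natSinv_lt (PosNum (divr_gt0 e0 (ltr0n R 3))).
have /= := hN N (leqnn N); rewrite ltr_pdivlMr// => h.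
by rewrite (le_trans (main N.+1 _))// mulrC ltW.
Qed.

Lemma Ex_indep f g : measurable_fun setT f -> measurable_fun setT g ->
  (forall w, `|f w| <= 1) -> (forall w, `|g w| <= 1) ->
  (forall a b a' b', P ([set w | a <= f w < b] `&` [set w | a' <= g w < b']) =
    (P [set w | (a <= f w < b)%R] * P [set w | (a' <= g w < b')%R])%E) ->
  Ex P (fun w => f w * g w) = Ex P f * Ex P g.
Proof.
move=> mf mg f1 g1 ind.
pose s (h : Omega -> R) (w : Omega) : R := 2^-1 * h w + 2^-1.
have bm1 (h : Omega -> R) : measurable_fun setT h -> (forall w, `|h w| <= 1) -> bounded_measurable h.
  by move=> mh h1; split => //; exists 1.
have bf := bm1 _ mf f1; have bg := bm1 _ mg g1.
have bs h : bounded_measurable h -> bounded_measurable (s h).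
  by move=> bh; apply: bmD; [exact: bmZ|exact: bm_cst].
have Es h : bounded_measurable h -> Ex P (s h) = 2^-1 * Ex P h + 2^-1.
  by move=> bh; rewrite ExD ?ExZ ?Ex_cst//; [exact: bmZ|exact: bm_cst].
have s01 (h : Omega -> R) : (forall w, `|h w| <= 1) -> forall w, 0 <= s h w <= 1.
  by move=> h1 w; have := h1 w; rewrite ler_norml /s => /andP[? ?]; apply/andP; split; lra.
have slab h a b : [set w | a <= s h w < b] = [set w | 2 * a - 1 <= h w < 2 * b - 1].
  by apply/seteqP; split => w /=; rewrite /s => /andP[? ?]; apply/andP; split; lra.
have := Ex_indep01 (bs _ bf).1 (bs _ bg).1 (s01 _ f1) (s01 _ g1).
move=> /(_ _)/wrap[|].
  by move=> a b a' b'; rewrite !slab ind.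
rewrite !Es//.
have -> : (fun w => s f w * s g w) = (fun w => 4^-1 * (f w * g w) + (4^-1 * f w + (4^-1 * g w + 4^-1))).
  by apply/funext => w; rewrite /s; field.
rewrite !ExD ?ExZ ?Ex_cst; do ?[exact: bmZ|exact: bm_cst|exact: bmM|apply: bmD|apply: bmZ].
all: try by [].
by move=> h; nra.
Qed.

End independence.

Section same_law.
Context {R : realType} {d : measure_display} {Omega : measurableType d}.
Variable P : probability Omega R.

Lemma Ex_same_law (X Y : Omega -> R) (h : R -> R) (M : R) :
  measurable_fun setT X -> measurable_fun setT Y -> continuous h -> (forall x, `|h x| <= M) ->
  (forall B, measurable B -> P (X @^-1` B) = P (Y @^-1` B)) ->
  Ex P (h \o X) = Ex P (h \o Y).
Proof.
move=> mX mY ch hM XY; have mh : measurable_fun setT (EFin \o h).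
  by apply/measurable_EFinP; exact: continuous_measurable_fun.
have bh (Z : Omega -> R) : measurable_fun setT Z -> bounded_measurable (h \o Z).
  by move=> mZ; split; [exact: measurable_fun_continuous|exists M => w; exact: hM].
pose Z1 : {RV P >-> R} := mfun_Sub (mem_set mX).
pose Z2 : {RV P >-> R} := mfun_Sub (mem_set mY).
congr fine.
have -> : (\int[P]_w ((h \o X) w)%:E = \int[distribution P Z1]_y (h y)%:E)%E.
  by rewrite integral_distribution//; exact: (bm_integrable P (bh _ mX)).
have -> : (\int[P]_w ((h \o Y) w)%:E = \int[distribution P Z2]_y (h y)%:E)%E.
  by rewrite integral_distribution//; exact: (bm_integrable P (bh _ mY)).
by apply: eq_measure_integral => A mA _; exact: XY.
Qed.

End same_law.

(** * Measurability with respect to a sub-sigma-algebra *)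

Section sub_sigma_algebra.
Context {R : realType} {d : measure_display} {Omega : measurableType d}.
Implicit Types (G : set (set Omega)) (f g : Omega -> R).

(** Ordinary measurability on the type generated by [G], so that closure properties of measurable
    functions carry over; [meas_in_set] returns to [G] when it is a sigma-algebra. *)
Definition meas_in G f := @measurable_fun _ _ (g_sigma_algebraType G) R setT f.

Lemma meas_in_set G f (B : set R) : sigma_algebra setT G -> meas_in G f -> measurable B ->
  G (f @^-1` B).
Proof.
move=> sG mf mB; rewrite -(sigma_algebra_id sG).
by have := mf measurableT _ mB; rewrite setTI.
Qed.

Lemma measurable_in G (A : set Omega) : G A -> measurable (A : set (g_sigma_algebraType G)).
Proof. exact: sub_sigma_algebra. Qed.

Lemma in_measurable G (A : set Omega) : sigma_algebra setT G ->
  measurable (A : set (g_sigma_algebraType G)) -> G A.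
Proof. by move=> sG; rewrite /measurable/= sigma_algebra_id. Qed.

Lemma meas_inD G f g : meas_in G f -> meas_in G g -> meas_in G (fun w => f w + g w).
Proof. by move=> mf mg; exact: (@measurable_funD _ (g_sigma_algebraType G)). Qed.

Lemma meas_inB G f g : meas_in G f -> meas_in G g -> meas_in G (fun w => f w - g w).
Proof. by move=> mf mg; exact: (@measurable_funB _ (g_sigma_algebraType G)). Qed.

Lemma meas_inM G f g : meas_in G f -> meas_in G g -> meas_in G (fun w => f w * g w).
Proof. by move=> mf mg; exact: (@measurable_funM _ (g_sigma_algebraType G)). Qed.

Lemma meas_in_cst G (a : R) : meas_in G (fun=> a).
Proof. exact: measurable_cst. Qed.

Lemma meas_in_indic G (A : set Omega) : G A -> meas_in G (\1_A : Omega -> R).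
Proof.
by move=> GA; apply: (@measurable_indic _ (g_sigma_algebraType G)); exact: measurable_in.
Qed.

Lemma meas_in_sum G (I : Type) (r : seq I) (f : I -> Omega -> R) :
  (forall i, meas_in G (f i)) -> meas_in G (fun w => \sum_(i <- r) f i w).
Proof.
move=> mf; elim: r => [|i r IH].
  by under eq_fun do rewrite big_nil; exact: meas_in_cst.
by under eq_fun do rewrite big_cons; exact: meas_inD.
Qed.

Lemma meas_in_measurable G f : sigma_algebra setT G -> G `<=` measurable ->
  meas_in G f -> measurable_fun setT f.
Proof. by move=> sG GM mf _ B mB; rewrite setTI; apply: GM; exact: meas_in_set. Qed.

Lemma meas_in_sub G G' f : sigma_algebra setT G -> G `<=` G' ->
  meas_in G f -> meas_in G' f.
Proof.
move=> sG GG' mf _ B mB; rewrite setTI; apply: measurable_in; apply: GG'.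
exact: meas_in_set.
Qed.

Lemma continuous_borel (V : ptopologicalType) (f : V -> R) : continuous f ->
  measurable_fun setT (f : g_sigma_algebraType (@open V) -> R).
Proof.
move=> /continuousP cf; apply: (measurability _ (RGenOpens.measurableE R)) => _ [_ [x [y ->]] <-].
by rewrite setTI; apply: sub_sigma_algebra; apply: cf; exact: interval_open.
Qed.

Lemma borel_meas_in (V : ptopologicalType) G (X : Omega -> V) (f : V -> R) :
  borel_measurable open G X -> continuous f -> meas_in G (f \o X).
Proof.
move=> bX cf _ B mB; rewrite setTI; apply: measurable_in.
by have := continuous_borel cf measurableT mB; rewrite setTI => hB; exact: (bX _ hB).
Qed.

End sub_sigma_algebra.

Section powR_concave.
Context {R : realType}.

(** Concavity of the power p <= 1 is the convexity of the power 1/p >= 1, applied to [a ^ p] and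
    [b ^ p]. *)
Lemma powR_midpoint (p a b : R) : 0 < p -> p <= 1 -> 0 <= a -> 0 <= b ->
  2^-1 * (a `^ p + b `^ p) <= (2^-1 * (a + b)) `^ p.
Proof.
move=> p0 p1 a0 b0; have q1 : 1 <= p^-1 by rewrite invf_ge1.
have h2 : (2^-1 * (a `^ p + b `^ p)) `^ p^-1 <= 2^-1 * (a + b).
  have i01 : 0 <= (2^-1 : R) <= 1 by rewrite invr_ge0 ler0n/= invf_le1// ler1n.
  have := convex_powR q1 (Itv01 (andP i01).1 (andP i01).2) (x := a `^ p) (y := b `^ p).
  rewrite !inE /= !in_itv/= !andbT !powR_ge0 => /(_ isT isT) h.
  rewrite -[leRHS](_ : 2^-1 * (a `^ p) `^ p^-1 + unstable.onem 2^-1 * (b `^ p) `^ p^-1 = _).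
    have {1}-> : 2^-1 * (a `^ p + b `^ p) = 2^-1 * (a `^ p) + unstable.onem 2^-1 * (b `^ p).
      by rewrite /unstable.onem; lra.
    exact: h.
  by rewrite -!powRrM divff ?gt_eqF// !powRr1// /unstable.onem; lra.
rewrite -[leLHS]powRr1 ?mulr_ge0 ?addr_ge0 ?powR_ge0// -[X in _ `^ X <= _](mulVf (lt0r_neq0 p0)).
by rewrite powRrM ge0_ler_powR ?nnegrE ?powR_ge0 ?mulr_ge0 ?addr_ge0// ltW.
Qed.

End powR_concave.

(** * Real increments of the cylindrical process *)

Section increments.
Context {R : realType} {d : measure_display} {Omega : measurableType d} {U : hilbertType R}.
Variables (P : probability Omega R) (F : R -> set (set Omega)) (L : R -> U -> Omega -> R).
Variable alpha : R.
Hypotheses (alpha_gt0 : 0 < alpha) (alpha_lt2 : alpha < 2).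
Hypotheses (Ff : filtration F) (Ls : canonical_stable P F alpha L).
Implicit Types (u v : U) (s t : R).

Definition incr s t u (w : Omega) : R := L t u w - L s u w.

Lemma filt_sigma t : 0 <= t -> sigma_algebra setT (F t).
Proof. by case: Ff => h _ _; exact: h. Qed.

Lemma filt_meas t : 0 <= t -> F t `<=` measurable.
Proof. by case: Ff => _ h _; exact: h. Qed.

Lemma filt_mono s t : 0 <= s -> s <= t -> F s `<=` F t.
Proof. by case: Ff => _ _ h; exact: h. Qed.

Lemma meas_in_filt t (f : Omega -> R) : 0 <= t -> meas_in (F t) f -> measurable_fun setT f.
Proof.
by move=> t0; apply: meas_in_measurable; [exact: filt_sigma|exact: filt_meas].
Qed.

Lemma meas_in_le s t (f : Omega -> R) : 0 <= s -> s <= t -> meas_in (F s) f -> meas_in (F t) f.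
Proof. by move=> s0 st; apply: meas_in_sub; [exact: filt_sigma|exact: filt_mono]. Qed.

Let lev1 u : levy_process P F (fun t w => \row_(_ < 1) L t u w).
Proof. by case: Ls => -[_ h] _; exact: (h 1%N (fun=> u)). Qed.

Let coord (x : 'rV[R]_1) : R := x 0 0.

Let coord_continuous : continuous coord.
Proof. exact: coord_continuous. Qed.

Lemma adapted_L t u : 0 <= t -> meas_in (F t) (L t u).
Proof.
move=> t0; case: (lev1 u) => ad _ _ _ _.
have := borel_meas_in (ad _ t0) coord_continuous.
by congr (meas_in _ _); apply/funext => w; rewrite /coord/= mxE.
Qed.

Lemma adapted_incr s t u : 0 <= s -> s <= t -> meas_in (F t) (incr s t u).
Proof.
move=> s0 st; apply: measurable_funB; first by apply: adapted_L; exact: le_trans st.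
by apply: (meas_in_le s0 st); exact: adapted_L.
Qed.

Lemma measurable_incr s t u : 0 <= s -> s <= t -> measurable_fun setT (incr s t u).
Proof.
by move=> s0 st; apply: (@meas_in_filt t); [exact: le_trans st|exact: adapted_incr].
Qed.

Let borel_coord (B : set R) : measurable B -> <<s @open 'rV[R]_1 >> (coord @^-1` B).
Proof.
by move=> mB; have := continuous_borel coord_continuous measurableT mB; rewrite setTI.
Qed.

Lemma incr_indep s t u (A : set Omega) (B : set R) : 0 <= s -> s <= t -> F s A -> measurable B ->
  P (A `&` incr s t u @^-1` B) = (P A * P (incr s t u @^-1` B))%E.
Proof.
move=> s0 st FA mB; case: (lev1 u) => _ _ ind _ _.
have := ind _ _ _ _ s0 st FA (borel_coord mB).
rewrite (_ : _ @^-1` (coord @^-1` B) = incr s t u @^-1` B)//.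
by apply/seteqP; split => w; rewrite /coord/= !mxE.
Qed.

Lemma incr_law s t u (B : set R) : 0 <= s -> s <= t -> measurable B ->
  P (incr s t u @^-1` B) = P (L (t - s) u @^-1` B).
Proof.
move=> s0 st mB; case: (lev1 u) => _ _ _ st' _.
have := st' _ _ _ s0 st (borel_coord mB).
by congr (P _ = P _); apply/seteqP; split => w; rewrite /coord/= !mxE.
Qed.

Lemma Ex_cos_incr s t u : 0 <= s -> s <= t ->
  Ex P (fun w => cos (incr s t u w)) = expR (- (t - s) * `|u| `^ alpha).
Proof.
move=> s0 st; have ts : 0 <= t - s by rewrite subr_ge0.
have mL : measurable_fun setT (L (t - s) u).
  by apply: (@meas_in_filt (t - s)) => //; exact: adapted_L.
transitivity (Ex P (cos \o L (t - s) u)).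
  apply: (@Ex_same_law _ _ _ _ (incr s t u) _ _ 1) => //; first exact: measurable_incr.
  - exact: continuous_cos.
  - by move=> x; rewrite ler_norml cos_geN1 cos_le1.
  - by move=> B mB; exact: incr_law.
case: Ls => _ /(_ _ u ts)[h _]; apply/EFin_inj; rewrite -h -ExE; last exact: bm_cos.
by rewrite expectation.unlock.
Qed.

Lemma Ex_sin_incr s t u : 0 <= s -> s <= t -> Ex P (fun w => sin (incr s t u w)) = 0.
Proof.
move=> s0 st; have ts : 0 <= t - s by rewrite subr_ge0.
have mL : measurable_fun setT (L (t - s) u).
  by apply: (@meas_in_filt (t - s)) => //; exact: adapted_L.
transitivity (Ex P (sin \o L (t - s) u)).
  apply: (@Ex_same_law _ _ _ _ (incr s t u) _ _ 1) => //; first exact: measurable_incr.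
  - exact: continuous_sin.
  - by move=> x; rewrite ler_norml sin_geN1 sin_le1.
  - by move=> B mB; exact: incr_law.
by case: Ls => _ /(_ _ u ts)[_]; rewrite expectation.unlock => h; rewrite /Ex /Rintegral h.
Qed.

Lemma incr_linear s t a u v : 0 <= s -> s <= t ->
  {ae P, forall w, incr s t (a *: u + v) w = a * incr s t u w + incr s t v w}.
Proof.
move=> s0 st; case: Ls => -[cy _] _.
have [_ l1 _] := cy _ s0; have [_ l2 _] := cy _ (le_trans s0 st).
apply: filterS2 (l1 a u v) (l2 a u v) => w; rewrite /incr => -> ->; ring.
Qed.

Lemma Ex_indep_incr s t u (f : Omega -> R) (h : R -> R) : 0 <= s -> s <= t ->
  meas_in (F s) f -> (forall w, `|f w| <= 1) -> continuous h -> (forall x, `|h x| <= 1) ->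
  Ex P (fun w => f w * h (incr s t u w)) = Ex P f * Ex P (h \o incr s t u).
Proof.
move=> s0 st mf f1 ch h1; have mi := measurable_incr u s0 st.
apply: Ex_indep => //; first exact: meas_in_filt mf.
  exact: measurable_fun_continuous.
move=> a b a' b'; have slabE (g : Omega -> R) x y :
    [set w | (x <= g w < y)%R] = g @^-1` `[x, y[%classic.
  by apply/seteqP; split => w /=; rewrite in_itv.
rewrite (slabE f) (slabE (h \o incr s t u)) comp_preimage.
apply: (incr_indep u s0 st).
  by apply: (meas_in_set _ mf) => //; exact: filt_sigma.
rewrite -[X in measurable X]setTI; exact: continuous_measurable_fun.
Qed.

(** Expand the cosine of the sum: by independence from [F s] the sine of the increment contributes
    its expectation 0, and the cosine its characteristic function. *)
Lemma cos_incr_step s t u (A : set Omega) (z : Omega -> R) : 0 <= s -> s <= t ->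
  F s A -> meas_in (F s) z ->
  Ex P (fun w => \1_A w * cos (z w + incr s t u w)) =
  Ex P (fun w => \1_A w * cos (z w)) * expR (- (t - s) * `|u| `^ alpha).
Proof.
move=> s0 st FA mz; have mA : measurable A by exact: filt_meas FA.
have m1 (h : R -> R) : continuous h -> meas_in (F s) (fun w => \1_A w * h (z w)).
  move=> ch; apply: measurable_funM; first by apply: measurable_indic; exact: measurable_in.
  exact: (measurable_fun_continuous ch).
have b1 (h : R -> R) : (forall x, `|h x| <= 1) -> forall w, `|(\1_A w * h (z w) : R)| <= 1.
  by move=> h1 w; rewrite normrM indicE; case: (_ \in _); rewrite ?normr1 ?mul1r// normr0 mul0r.
have hc (x : R) : `|cos x| <= 1 by rewrite ler_norml cos_geN1 cos_le1.
have hs (x : R) : `|sin x| <= 1 by rewrite ler_norml sin_geN1 sin_le1.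
have -> : (fun w => \1_A w * cos (z w + incr s t u w)) =
   (fun w => \1_A w * cos (z w) * cos (incr s t u w) - \1_A w * sin (z w) * sin (incr s t u w)).
  by apply/funext => w; rewrite cosD; ring.
have cc := @continuous_cos R; have cs := @continuous_sin R.
have mz' := meas_in_filt s0 mz; have mi := measurable_incr u s0 st.
rewrite ExB; [|by do ?[apply: bmM|exact: bm_cos|exact: bm_sin|exact: bm_indic]..].
rewrite (Ex_indep_incr u s0 st (m1 _ cc) (b1 _ hc) cc hc).
rewrite (Ex_indep_incr u s0 st (m1 _ cs) (b1 _ hs) cs hs).
by rewrite Ex_cos_incr// Ex_sin_incr// mulr0 subr0.
Qed.

End increments.

(** * The Gaussian test function of one increment *)

Section cosine_powers.
Context {R : realType}.
Implicit Types x y : R.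

Lemma derive_ge0_le (f df : R -> R) : (forall x, is_derive x 1 f (df x)) ->
  (forall x, 0 <= x -> 0 <= df x) -> forall x, 0 <= x -> f 0 <= f x.
Proof.
move=> fd d0 x; rewrite le_eqVlt => /predU1P[<-//|x0].
have [|c] := @MVT _ f df 0 x x0 (fun y _ => fd y).
- apply: continuous_subspaceT => y; apply: differentiable_continuous.
  by apply/derivable1_diffP; have [] := fd y.
- rewrite in_itv/= => /andP[c0 _] h; rewrite -subr_ge0 h subr0 mulr_ge0 ?(ltW x0)//.
  by apply: d0; exact: ltW.
Qed.

(** This and the next three Taylor bounds form a chain: the derivative of the difference of the two
    sides is the difference in the previous bound, starting from cos <= 1. *)
Lemma sin_le_id x : 0 <= x -> sin x <= x.
Proof.
move=> x0; pose f : R -> R := id - sin.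
have : f 0 <= f x.
  by apply: (@derive_ge0_le f (fun y => 1 - cos y) _ _ x x0) => y _; rewrite subr_ge0 cos_le1.
by rewrite /f !fctE/= sin0; lra.
Qed.

Lemma cos_ge_quadratic x : 0 <= x -> 1 - x ^+ 2 / 2 <= cos x.
Proof.
move=> x0; pose f : R -> R := cos + 2^-1 \*: (id ^+ 2).
have fd y : is_derive y 1 f ((fun y => y - sin y) y).
  by apply: (is_derive_eq (is_deriveD (is_derive_cos y) (is_deriveZ 2^-1 (is_deriveX 2 (is_derive_id y (1 : R)))))); rewrite /GRing.scale/=; field.
have : f 0 <= f x.
  by apply: (derive_ge0_le fd _ x0) => y y0; rewrite subr_ge0 sin_le_id.
by rewrite /f !fctE/= cos0 expr0n scaler0 /GRing.scale/=; lra.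
Qed.

Lemma sin_ge_cubic x : 0 <= x -> x - x ^+ 3 / 6 <= sin x.
Proof.
move=> x0; pose f : R -> R := sin - id + 6^-1 \*: (id ^+ 3).
have fd y : is_derive y 1 f ((fun y => cos y - 1 + y ^+ 2 / 2) y).
  by apply: (is_derive_eq (is_deriveD (is_deriveB (is_derive_sin y) (is_derive_id y (1 : R))) (is_deriveZ 6^-1 (is_deriveX 3 (is_derive_id y (1 : R)))))); rewrite /GRing.scale/=; field.
have : f 0 <= f x.
  by apply: (derive_ge0_le fd _ x0) => y y0; have := cos_ge_quadratic y0; lra.
by rewrite /f !fctE/= sin0 expr0n scaler0 /GRing.scale/=; lra.
Qed.

Lemma cos_le_quartic x : 0 <= x -> cos x <= 1 - x ^+ 2 / 2 + x ^+ 4 / 24.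
Proof.
move=> x0; pose f : R -> R := - cos - 2^-1 \*: (id ^+ 2) + 24^-1 \*: (id ^+ 4).
have fd y : is_derive y 1 f ((fun y => sin y - (y - y ^+ 3 / 6)) y).
  by apply: (is_derive_eq (is_deriveD (is_deriveB (is_deriveN (is_derive_cos y)) (is_deriveZ 2^-1 (is_deriveX 2 (is_derive_id y (1 : R))))) (is_deriveZ 24^-1 (is_deriveX 4 (is_derive_id y (1 : R)))))); rewrite /GRing.scale/=; field.
have : f 0 <= f x.
  by apply: (derive_ge0_le fd _ x0) => y y0; rewrite subr_ge0 sin_ge_cubic.
by rewrite /f !fctE/= cos0 !expr0n !scaler0 /GRing.scale/=; lra.
Qed.

Lemma cos_expR_bounds x : 0 <= x <= 1 ->
  expR (- (x ^+ 2 / 2) - x ^+ 4 / 2) <= cos x <= expR (- (x ^+ 2 / 2)).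
Proof.
move=> /andP[x0 x1]; set y := x ^+ 2 / 2.
have y0 : 0 <= y by rewrite divr_ge0 ?sqr_ge0.
have y1 : y <= 2^-1 by rewrite /y ler_pdivrMr// mulVf// expr_le1.
have x4 : x ^+ 4 = 4 * y ^+ 2 by rewrite /y; field.
apply/andP; split.
  apply: le_trans (cos_ge_quadratic x0); rewrite -/y x4.
  rewrite -opprD expRN -[leLHS]mul1r ler_pdivrMr ?expR_gt0//.
  (* The product equals 1 + y^2 (1 - 2 y), and y <= 1/2. *)
  apply: (@le_trans _ _ ((1 - y) * (1 + (y + 4 * y ^+ 2 / 2)))); first nra.
  by rewrite ler_wpM2l ?expR_ge1Dx//; lra.
apply: le_trans (cos_le_quartic x0) _; rewrite -/y x4.
(* 1 - y + y^2/6 <= (1 - y/2)^2, so that the bound 1 - y/2 <= exp (- y/2) only has to be squared. *)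
have -> : - y = 2%:R * - (y / 2) by field.
rewrite expRM_natl; apply: (@le_trans _ _ ((1 - y / 2) ^+ 2)); first nra.
by rewrite lerXn2r ?nnegrE ?expR_ge0 ?expR_ge1Dx//; lra.
Qed.

(** With m = n + 1 and c^2 = 2 a / m, the m-th powers of the bounds on cos c are exp (- a - 2 a^2 /
    m) and exp (- a). *)
Lemma cos_pow_cvg (lam x : R) : 0 <= lam ->
  cos (Num.sqrt (2 * lam / n.+1%:R) * x) ^+ n.+1 @[n --> \oo] --> expR (- (lam * x ^+ 2)).
Proof.
move=> lam0; set a := lam * x ^+ 2.
have a0 : 0 <= a by rewrite mulr_ge0 ?sqr_ge0.
have lo : expR (- a - 2 * a ^+ 2 * n.+1%:R^-1) @[n --> \oo] --> expR (- a).
  apply: (@continuous_cvg _ _ _ _ _ _ expR); first exact: continuous_expR.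
  rewrite -[X in _ --> X]subr0 -[X in _ - X](mulr0 (2 * a ^+ 2)).
  apply: cvgB; first exact: cvg_cst.
  by apply: cvgMr; exact: cvg_harmonic.
apply: (squeeze_cvgr _ lo); last exact: cvg_cst.
near=> n; set c := Num.sqrt (2 * lam / n.+1%:R) * `|x|.
have n0 : 0 < n.+1%:R :> R by rewrite ltr0n.
have c2 : c ^+ 2 = 2 * a / n.+1%:R.
  rewrite exprMn sqr_sqrtr ?divr_ge0 ?mulr_ge0//.
  by rewrite real_normK ?num_real// /a; field; rewrite gt_eqF.
have c0 : 0 <= c by rewrite mulr_ge0 ?sqrtr_ge0.
have c1 : c <= 1.
  rewrite -(@expr_le1 _ 2)// c2 ler_pdivrMr// mul1r.
  near: n; exists (Num.truncn (2 * a)).+1 => // m /= mM.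
  by rewrite ltW// (lt_le_trans (truncnS_gt _))// ler_nat (leq_trans mM).
have -> : cos (Num.sqrt (2 * lam / n.+1%:R) * x) = cos c.
  rewrite /c; case: (ger0P x) => // _; by rewrite mulrN cosN.
have /andP[l u] : expR (- (c ^+ 2 / 2) - c ^+ 4 / 2) <= cos c <= expR (- (c ^+ 2 / 2)).
  by apply: cos_expR_bounds; rewrite c0.
apply/andP; split.
  have -> : - a - 2 * a ^+ 2 * n.+1%:R^-1 = n.+1%:R * (- (c ^+ 2 / 2) - c ^+ 4 / 2).
    by rewrite (exprM c 2 2) c2 -(natr1 n); field; rewrite natr1 gt_eqF.
  by rewrite expRM_natl lerXn2r ?nnegrE ?expR_ge0// (le_trans _ l)// expR_ge0.
have -> : - a = n.+1%:R * (- (c ^+ 2 / 2)) by rewrite c2 -(natr1 n); field; rewrite natr1 gt_eqF.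
by rewrite expRM_natl lerXn2r ?nnegrE ?expR_ge0// (le_trans _ l)// expR_ge0.
Unshelve. all: by end_near. Qed.

End cosine_powers.

Section cosine_products.
Context {R : realType} {d : measure_display} {Omega : measurableType d} {U : hilbertType R}.
Variables (P : probability Omega R) (F : R -> set (set Omega)) (L : R -> U -> Omega -> R).
Variable alpha : R.
Hypotheses (alpha_gt0 : 0 < alpha) (alpha_lt2 : alpha < 2).
Hypotheses (Ff : filtration F) (Ls : canonical_stable P F alpha L).
Implicit Types (u v : U) (s t : R).

Local Notation incr := (incr L).

(* Replacing two factors by the half sum of cos (a + b) and cos (a - b) keeps
   |u|^2 + |v|^2 constant on average, and x |-> x^(alpha/2) is concave. *)
Lemma cos_prod_lower s t (A : set Omega) (z : nat -> Omega -> R) (u : nat -> U)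
    (l : seq nat) (z0 : Omega -> R) (u0 : U) :
  0 <= s -> s <= t -> F s A -> (forall k, meas_in (F s) (z k)) -> meas_in (F s) z0 ->
  Ex P (fun w => \1_A w * cos (z0 w) * \prod_(k <- l) cos (z k w)) -
    fine (P A) * (t - s) * (`|u0| ^+ 2 + \sum_(k <- l) `|u k| ^+ 2) `^ (alpha / 2) <=
  Ex P (fun w => \1_A w * cos (z0 w + incr s t u0 w) *
    \prod_(k <- l) cos (z k w + incr s t (u k) w)).
Proof.
move=> s0 st FA mz; have mA : measurable A by exact: (filt_meas Ff s0).
have ts : 0 <= t - s by rewrite subr_ge0.
have mi v := measurable_incr Ff Ls v s0 st.
have mzM k : measurable_fun setT (z k) by exact: (meas_in_filt Ff s0).
elim: l z0 u0 => [|k l IH] z0 u0 mz0.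
  under eq_fun do rewrite big_nil mulr1; under [in leRHS]eq_fun do rewrite big_nil mulr1.
  rewrite big_nil addr0 (cos_incr_step Ff Ls)//.
  set E := Ex P _; set x := (t - s) * `|u0| `^ alpha.
  have -> : (`|u0| ^+ 2) `^ (alpha / 2) = `|u0| `^ alpha.
    by rewrite -powR_mulrn// -powRrM mulrC divfK.
  have x0 : 0 <= x by rewrite mulr_ge0 ?powR_ge0.
  have mz0M : measurable_fun setT z0 by exact: (meas_in_filt Ff s0).
  have EP : E <= fine (P A).
    rewrite -Ex_indic//; apply: Ex_le; [by apply: bmM; [exact: bm_indic|exact: bm_cos]|exact: bm_indic|].
    by move=> w; rewrite ler_piMr ?cos_le1// indicE.
  (* A single cosine loses E (1 - exp (- x)), which is at most P(A) x because E <= P(A) and 1 - exp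
     (- x) <= x. *)
  have := expR_ge1Dx (- x); have : expR (- x) <= 1 by rewrite -[leRHS]expR0 ler_expR oppr_le0.
  have P0 : 0 <= fine (P A) by rewrite fine_ge0.
  rewrite -mulrA -/x mulNr -/x; move: (expR (- x)) => y y1 yx.
  have := ler_wpM2r (_ : 0 <= 1 - y) EP; rewrite subr_ge0 => /(_ y1) h1.
  have := ler_wpM2l P0 yx; lra.
set Q := fun w => \prod_(j <- l) cos (z j w + incr s t (u j) w).
set Q0 := fun w => \prod_(j <- l) cos (z j w).
have bQ : bounded_measurable Q.
  by apply: bm_prod => j; apply: bm_cos; exact: measurable_funD.
have bQ0 : bounded_measurable Q0 by apply: bm_prod => j; exact: bm_cos.
have mz0M : measurable_fun setT z0 by exact: (meas_in_filt Ff s0).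
have bA : bounded_measurable (\1_A : Omega -> R) by exact: bm_indic.
have mp : meas_in (F s) (fun w => z0 w + z k w) by exact: meas_inD.
have mm : meas_in (F s) (fun w => z0 w - z k w) by exact: meas_inB.
have hp := IH _ (u0 + u k) mp; have hm := IH _ (u0 - u k) mm.
have bc (f : Omega -> R) (G : Omega -> R) : measurable_fun setT f -> bounded_measurable G ->
    bounded_measurable (fun w => \1_A w * cos (f w) * G w).
  by move=> mf bG; apply: bmM => //; apply: bmM => //; exact: bm_cos.
have -> : Ex P (fun w => \1_A w * cos (z0 w) * \prod_(j <- k :: l) cos (z j w)) =
   2^-1 * (Ex P (fun w => \1_A w * cos (z0 w + z k w) * Q0 w) +
           Ex P (fun w => \1_A w * cos (z0 w - z k w) * Q0 w)).
  have b1 := bc _ _ (meas_in_filt Ff s0 mp) bQ0.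
  have b2 := bc _ _ (meas_in_filt Ff s0 mm) bQ0.
  rewrite -(ExD P b1 b2) -(ExZ P _ (bmD b1 b2)).
  by congr Ex; apply/funext => w; rewrite big_cons -/(Q0 w) cosD cosB; field.
have -> : Ex P (fun w => \1_A w * cos (z0 w + incr s t u0 w) *
      \prod_(j <- k :: l) cos (z j w + incr s t (u j) w)) =
   2^-1 * (Ex P (fun w => \1_A w * cos (z0 w + z k w + incr s t (u0 + u k) w) * Q w) +
           Ex P (fun w => \1_A w * cos (z0 w - z k w + incr s t (u0 - u k) w) * Q w)).
  have b1 := bc _ _ (measurable_funD (meas_in_filt Ff s0 mp) (mi (u0 + u k))) bQ.
  have b2 := bc _ _ (measurable_funD (meas_in_filt Ff s0 mm) (mi (u0 - u k))) bQ.
  rewrite -(ExD P b1 b2) -(ExZ P _ (bmD b1 b2)).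
  (* Additivity of [L t] in its vector argument holds only almost surely, so expectations are
     compared and not functions. *)
  apply: Ex_ae_eq.
  - under eq_fun do rewrite big_cons mulrA.
    apply: bmM => //; apply: bmM; last by apply: bm_cos; exact: measurable_funD.
    by apply: bmM => //; apply: bm_cos; exact: measurable_funD.
  - exact: (bmZ _ (bmD b1 b2)).
  apply: filterS2 (incr_linear Ls 1 (u k) u0 s0 st) (incr_linear Ls (-1) (u k) u0 s0 st) => w.
  rewrite /= scale1r scaleN1r mul1r mulN1r (addrC (u k)) (addrC (- u k)) => -> ->.
  rewrite big_cons -/(Q w).
  have -> : z0 w + z k w + (incr s t (u k) w + incr s t u0 w) =
    (z0 w + incr s t u0 w) + (z k w + incr s t (u k) w) by ring.
  have -> : z0 w - z k w + (- incr s t (u k) w + incr s t u0 w) =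
    (z0 w + incr s t u0 w) - (z k w + incr s t (u k) w) by ring.
  by rewrite [in RHS]cosD [in RHS]cosB; field.
have h2 := @powR_midpoint R (alpha / 2) (`|u0 + u k| ^+ 2 + \sum_(j <- l) `|u j| ^+ 2)
  (`|u0 - u k| ^+ 2 + \sum_(j <- l) `|u j| ^+ 2).
have S0 : 0 <= \sum_(j <- l) `|u j| ^+ 2 by apply: sumr_ge0 => j _; rewrite sqr_ge0.
have {h2} := h2 _ _ (addr_ge0 (sqr_ge0 _) S0) (addr_ge0 (sqr_ge0 _) S0).
have -> : 2^-1 * (`|u0 + u k| ^+ 2 + \sum_(j <- l) `|u j| ^+ 2 +
    (`|u0 - u k| ^+ 2 + \sum_(j <- l) `|u j| ^+ 2)) =
    `|u0| ^+ 2 + \sum_(j <- k :: l) `|u j| ^+ 2.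
  by rewrite normD_sqr normB_sqr big_cons; field.
move=> h2; have {}h2 := h2 (divr_gt0 alpha_gt0 (ltr0n R 2)).
have a1 : alpha / 2 <= 1 by rewrite ler_pdivrMr// mul1r ltW.
have P0 : 0 <= fine (P A) by rewrite fine_ge0.
have := ler_wpM2l (mulr_ge0 P0 ts) (h2 a1).
move: hp hm; rewrite -/Q -/Q0; lra.
Qed.

End cosine_products.

Section gaussian_estimate.
Context {R : realType} {d : measure_display} {Omega : measurableType d} {U H : hilbertType R}.
Variables (P : probability Omega R) (F : R -> set (set Omega)) (L : R -> U -> Omega -> R).
Variable alpha : R.
Hypotheses (alpha_gt0 : 0 < alpha) (alpha_lt2 : alpha < 2).
Hypotheses (sU : separable U) (sH : separable H).
Hypotheses (Ff : filtration F) (Ls : canonical_stable P F alpha L).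
Implicit Types (s t lam : R) (psi : U -> H) (Y Z : Omega -> H).

Local Notation incr := (incr L).

(** Coordinates reduce sums and limits of H-valued functions to real ones; [borel_weak] and
    [weak_borel] translate from and to Borel measurability. *)
Definition weak_meas_in (G : set (set Omega)) Z := forall h, meas_in G (fun w => hdot (Z w) h).

Definition gauss lam (x : H) : R := expR (- (lam * `|x| ^+ 2)).

Lemma prod_flatten_nseq (m : nat) (r : seq nat) (f : nat -> R) :
  \prod_(k <- flatten (nseq m r)) f k = (\prod_(k <- r) f k) ^+ m.
Proof.
elim: m => [|m IH]; first by rewrite big_nil.
by rewrite /= big_cat IH exprS.
Qed.

Lemma sum_flatten_nseq (m : nat) (r : seq nat) (f : nat -> R) :
  \sum_(k <- flatten (nseq m r)) f k = m%:R * (\sum_(k <- r) f k).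
Proof.
elim: m => [|m IH]; first by rewrite big_nil mul0r.
by rewrite /= big_cat/= IH mulrSr mulrDl mul1r addrC.
Qed.

Lemma cvg_prod (r : seq nat) (f : nat -> nat -> R) (l : nat -> R) :
  (forall k, f n k @[n --> \oo] --> l k) ->
  \prod_(k <- r) f n k @[n --> \oo] --> \prod_(k <- r) l k.
Proof.
move=> fl; elim: r => [|k r IH].
  by under eq_fun do rewrite big_nil; rewrite big_nil; exact: cvg_cst.
by under eq_fun do rewrite big_cons; rewrite big_cons; exact: cvgM.
Qed.

Lemma norm_prod_le1 (I : Type) (r : seq I) (f : I -> R) : (forall i, `|f i| <= 1) ->
  `|\prod_(i <- r) f i| <= 1.
Proof.
move=> f1; elim: r => [|i r IH]; first by rewrite big_nil normr1.
by rewrite big_cons normrM mulr_ile1.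
Qed.

Lemma gauss_cvg (g : nat -> H) lam (x : H) : onseq g ->
  \prod_(0 <= k < n) expR (- (lam * hdot x (g k) ^+ 2)) @[n --> \oo] --> gauss lam x.
Proof.
move=> og; rewrite /gauss.
have -> : (fun n => \prod_(0 <= k < n) expR (- (lam * hdot x (g k) ^+ 2))) =
    (fun n => expR (- (lam * \sum_(0 <= k < n) hdot x (g k) ^+ 2))).
  apply/funext => n; elim: n => [|n IH]; first by rewrite !big_nil mulr0 oppr0 expR0.
  by rewrite !big_nat_recr//= IH -expRD mulrDr opprD.
apply: (@continuous_cvg _ _ _ _ _ _ expR); first exact: continuous_expR.
apply: cvgN; apply: cvgMr; exact: parseval.
Qed.

(* The factors exp (- lam x^2) are limits of cos (sqrt (2 lam / m) x)^m, that
   is, cos_prod_lower is applied to m copies of each vector sqrt (2 lam / m) v_k. *)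
Lemma gauss_prod_lower s t lam (A : set Omega) (z : nat -> Omega -> R) (v : nat -> U)
    (r : seq nat) :
  0 <= s -> s <= t -> 0 <= lam -> F s A -> (forall k, meas_in (F s) (z k)) ->
  Ex P (fun w => \1_A w * \prod_(k <- r) expR (- (lam * z k w ^+ 2))) -
    fine (P A) * (t - s) * (2 * lam * \sum_(k <- r) `|v k| ^+ 2) `^ (alpha / 2) <=
  Ex P (fun w => \1_A w * \prod_(k <- r) expR (- (lam * (z k w + incr s t (v k) w) ^+ 2))).
Proof.
move=> s_ge0 st lam_ge0 FA mz; set K := fine (P A) * _ * _.
have mA : measurable A by exact: (filt_meas Ff s_ge0).
have bA : bounded_measurable (\1_A : Omega -> R) by exact: bm_indic.
have mzM k := meas_in_filt Ff s_ge0 (mz k).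
have miu u := measurable_incr Ff Ls u s_ge0 st.
have A1 w : `|\1_A w : R| <= 1 by rewrite indicE; case: (_ \in _); rewrite ?normr1 ?normr0.
have lim (x : nat -> Omega -> R) : (forall k, measurable_fun setT (x k)) ->
    Ex P (fun w => \1_A w * (\prod_(k <- r) cos (Num.sqrt (2 * lam / m.+1%:R) * x k w)) ^+ m.+1)
      @[m --> \oo] --> Ex P (fun w => \1_A w * \prod_(k <- r) expR (- (lam * x k w ^+ 2))).
  move=> mx; apply: (@Ex_cvg _ _ _ _ _ _ 1).
  - move=> m; apply: measurable_funM; first exact: bA.1.
    apply: measurable_funX; apply: (proj1 (bm_prod _ _)) => k.
    by apply: bm_cos; apply: measurable_funM.
  - move=> m w; rewrite normrM mulr_ile1//.
    rewrite normrX exprn_ile1//; apply: norm_prod_le1 => k.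
    by rewrite ler_norml cos_geN1 cos_le1.
  - move=> w; apply: cvgMr.
    under eq_fun do rewrite -prodrXl; apply: cvg_prod => k.
    exact: cos_pow_cvg.
have lim1 := lim _ mzM.
have lim2 := lim _ (fun k => measurable_funD (mzM k) (miu (v k))).
apply: cvgn_ler (cvgB lim1 (cvg_cst K)) lim2 _ => m /=.
set c := Num.sqrt _.
have m0 : 0 < m.+1%:R :> R by rewrite ltr0n.
have c2 : m.+1%:R * c ^+ 2 = 2 * lam.
  by rewrite sqr_sqrtr ?divr_ge0 ?mulr_ge0// mulrC divfK// gt_eqF.
pose z' k w := c * z k w; pose u k := c *: v k.
have mz' k : meas_in (F s) (z' k) by apply: meas_inM; [exact: meas_in_cst|exact: mz].
(* The distinguished factor of [cos_prod_lower] is made trivial by [z0 = 0] and [u0 = 0]. *)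
have := cos_prod_lower alpha_gt0 alpha_lt2 Ff Ls u (flatten (nseq m.+1 r))
  0 s_ge0 st FA mz' (@meas_in_cst _ _ _ (F s) 0).
under eq_fun do rewrite cos0 mulr1 prod_flatten_nseq.
rewrite normr0 expr0n add0r sum_flatten_nseq.
have -> : m.+1%:R * (\sum_(k <- r) `|u k| ^+ 2) = 2 * lam * \sum_(k <- r) `|v k| ^+ 2.
  rewrite -c2 -mulrA; congr (_ * _).
  under eq_bigr do rewrite normrZ exprMn real_normK ?num_real//.
  by rewrite mulr_sumr.
move=> h; apply: le_trans h _.
rewrite le_eqVlt; apply/orP; left; apply/eqP; apply: Ex_ae_eq.
- apply: bmM; first by apply: bmM => //; apply: bm_cos; apply: measurable_funD.
  apply: bm_prod => k; apply: bm_cos; apply: measurable_funD => //.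
  exact: (meas_in_filt Ff s_ge0 (mz' k)).
- apply: bmM => //; under eq_fun do rewrite -prod_flatten_nseq.
  apply: bm_prod => k; apply: bm_cos; apply: measurable_funM => //.
  exact: measurable_funD.
have i0 : {ae P, forall w, incr s t 0 w = 0}.
  have := incr_linear Ls 1 0 0 s_ge0 st; apply: filterS => w.
  rewrite scaler0 addr0 mul1r => h0; lra.
have ik : {ae P, forall w, forall k, incr s t (u k) w = c * incr s t (v k) w}.
  apply: ae_foralln => k.
  apply: filterS2 (incr_linear Ls c (v k) 0 s_ge0 st) i0 => w.
  by rewrite addr0 => -> ->; rewrite addr0.
apply: filterS2 i0 ik => w h0 hk; rewrite h0 addr0 cos0 mulr1 prod_flatten_nseq.
congr (_ * _ ^+ _); apply: eq_bigr => k _.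
by rewrite hk /z' -mulrDr.
Qed.

(** By Parseval in [H] the Gaussian is a limit of products over the coordinates of [g], and the
    coordinates of [Y] are increments of [L] at [adjoint psi (g k)]. Their squared norms sum to at
    most [hs_norm psi ^+ 2] whatever the number of factors, so the loss stays bounded in the
    limit. *)
Lemma gauss_step s t lam (A : set Omega) psi Y Z :
  0 <= s -> s <= t -> 0 <= lam -> F s A -> hilbert_schmidt psi ->
  weak_meas_in (F s) Z -> weak_meas_in (F t) Y ->
  (forall h, {ae P, forall w, hdot (Y w) h = incr s t (adjoint psi h) w}) ->
  Ex P (fun w => \1_A w * gauss lam (Z w)) -
    fine (P A) * (t - s) * (2 * lam * hs_norm psi ^+ 2) `^ (alpha / 2) <=
  Ex P (fun w => \1_A w * gauss lam (Z w + Y w)).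
Proof.
move=> s_ge0 st lam_ge0 FA hpsi mZ mY Yincr; set K := _ * _ `^ _.
have mA : measurable A by exact: (filt_meas Ff s_ge0).
have [g [og _]] := onb_seq sH.
have bA : bounded_measurable (\1_A : Omega -> R) by exact: bm_indic.
have mZM h := meas_in_filt Ff s_ge0 (mZ h).
have mYM h := meas_in_filt Ff (le_trans s_ge0 st) (mY h).
have A1 w : `|\1_A w : R| <= 1 by rewrite indicE; case: (_ \in _); rewrite ?normr1 ?normr0.
have e1 (x : R) : `|expR (- (lam * x ^+ 2))| <= 1.
  rewrite ger0_norm ?expR_ge0// -[leRHS]expR0 ler_expR oppr_le0.
  by rewrite mulr_ge0 ?sqr_ge0.
have be (x : Omega -> R) : measurable_fun setT x -> bounded_measurable (fun w => expR (- (lam * x w ^+ 2))).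
  move=> mx; split; last by exists 1 => w.
  apply: measurable_fun_continuous; first exact: continuous_expR.
  by apply: measurable_funN; apply: measurable_funM => //; apply: measurable_funX.
have lim (X : Omega -> H) : (forall h, measurable_fun setT (fun w => hdot (X w) h)) ->
    Ex P (fun w => \1_A w * \prod_(0 <= k < n) expR (- (lam * hdot (X w) (g k) ^+ 2)))
      @[n --> \oo] --> Ex P (fun w => \1_A w * gauss lam (X w)).
  move=> mX; apply: (@Ex_cvg _ _ _ _ _ _ 1).
  - move=> n; apply: measurable_funM; first exact: bA.1.
    by apply: (proj1 (bm_prod _ _)) => k; exact: be.
  - by move=> n w; rewrite normrM mulr_ile1//; apply: norm_prod_le1 => k.
  - by move=> w; apply: cvgMr; exact: gauss_cvg.
have mZY h : measurable_fun setT (fun w => hdot (Z w + Y w) h).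
  by under eq_fun do rewrite hdotDl; exact: measurable_funD.
apply: cvgn_ler (cvgB (lim _ mZM) (cvg_cst K)) (lim _ mZY) _ => n /=.
have := gauss_prod_lower (fun k => adjoint psi (g k)) (index_iota 0 n) s_ge0 st lam_ge0 FA
  (fun k => mZ (g k)).
move=> h; apply: le_trans (le_trans _ h) _.
  rewrite lerD2l lerN2 /K ler_wpM2l ?mulr_ge0 ?fine_ge0 ?subr_ge0//.
  rewrite ge0_ler_powR ?nnegrE ?divr_ge0 ?(ltW alpha_gt0) ?mulr_ge0 ?sumr_ge0 ?hs_norm_ge0 ?sqr_ge0//.
  by rewrite ler_wpM2l ?mulr_ge0// adjoint_sqr_sum.
rewrite le_eqVlt; apply/orP; left; apply/eqP; apply: Ex_ae_eq.
- apply: bmM => //; apply: bm_prod => k; apply: be; apply: measurable_funD => //.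
  exact: (measurable_incr Ff Ls).
- by apply: bmM => //; apply: bm_prod => k; exact: be.
apply: filterS (ae_foralln (fun k => Yincr (g k))) => w hw.
by congr (_ * _); apply: eq_bigr => k _; rewrite hdotDl hw.
Qed.

End gaussian_estimate.

(** * Existence of the increments psi (L t - L s) *)

Lemma separable_seq (R : realType) (V : hilbertType R) : separable V ->
  exists f : nat -> V, forall x (e : R), 0 < e -> exists n, `|x - f n| < e.
Proof.
move=> [D [cD dD]]; have /countable_injP[g gi] := cD.
pose f n := xget (0 : V) [set x | D x /\ g x = n].
exists f => x e e0; have [|y []] := dD (interior (ball x e)) _ (open_interior _).
  by exists x; exact: nbhsx_ballx.
move=> /interior_subset; rewrite -ball_normE /= => xy Dy; exists (g y).
have [Df gf] : [set z | D z /\ g z = g y] (f (g y)) by apply: (@xgetI _ _ _ y).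
by rewrite (gi _ _ _ _ gf)//; exact/mem_set.
Qed.

(** * Scalar and Borel measurability in separable spaces *)

Section weak_measurability.
Context {R : realType} {d : measure_display} {Omega : measurableType d} {H : hilbertType R}.
Hypothesis sH : separable H.
Implicit Types (G : set (set Omega)) (Z Y : Omega -> H).

Lemma weak_measD G Y Z : weak_meas_in G Y -> weak_meas_in G Z ->
  weak_meas_in G (fun w => Y w + Z w).
Proof. by move=> mY mZ h; under eq_fun do rewrite hdotDl; exact: meas_inD. Qed.

Lemma weak_measZ G (f : Omega -> R) Z : meas_in G f -> weak_meas_in G Z ->
  weak_meas_in G (fun w => f w *: Z w).
Proof. by move=> mf mZ h; under eq_fun do rewrite hdotZl; exact: meas_inM. Qed.

Lemma weak_meas_cst G (x : H) : weak_meas_in G (fun=> x).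
Proof. by move=> h; exact: meas_in_cst. Qed.

Lemma weak_measB G Y Z : weak_meas_in G Y -> weak_meas_in G Z ->
  weak_meas_in G (fun w => Y w - Z w).
Proof. by move=> mY mZ h; under eq_fun do rewrite hdotBl; exact: meas_inB. Qed.

Lemma weak_meas_sum G (I : Type) (r : seq I) (Z : I -> Omega -> H) :
  (forall i, weak_meas_in G (Z i)) -> weak_meas_in G (fun w => \sum_(i <- r) Z i w).
Proof.
move=> mZ h; under eq_fun do rewrite hdot_suml.
by apply: meas_in_sum => i; exact: mZ.
Qed.

Lemma borel_weak G Z : borel_measurable open G Z -> weak_meas_in G Z.
Proof. by move=> bZ h; exact: (borel_meas_in bZ (@continuous_hdotl _ _ h)). Qed.

Lemma meas_in_cvg G (f : nat -> Omega -> R) (l : Omega -> R) :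
  (forall n, meas_in G (f n)) -> (forall w, f n w @[n --> \oo] --> l w) -> meas_in G l.
Proof.
move=> mf fl; rewrite /meas_in.
by apply: (measurable_fun_cvg (h := f : nat -> g_sigma_algebraType G -> R)) => // w _; exact: fl.
Qed.

Lemma weak_norm_sqr G Z : weak_meas_in G Z -> meas_in G (fun w => `|Z w| ^+ 2).
Proof.
have [g [og _]] := onb_seq sH; move=> mZ.
apply: (@meas_in_cvg _ (fun n w => \sum_(0 <= k < n) hdot (Z w) (g k) ^+ 2)).
  move=> n; apply: meas_in_sum => k; under eq_fun do rewrite expr2.
  by apply: meas_inM; exact: mZ.
by move=> w; exact: parseval.
Qed.

Lemma weak_norm_lt G Z (r : R) : sigma_algebra setT G -> weak_meas_in G Z ->
  G [set w | `|Z w| < r].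
Proof.
move=> sG mZ; have [r0|r0] := leP r 0.
  rewrite (_ : [set w | _] = set0); first by case: sG.
  by apply/seteqP; split => // w /=; rewrite ltNge (le_trans r0).
rewrite (_ : [set w | _] = (fun w => `|Z w| ^+ 2) @^-1` `]-oo, (r ^+ 2)[%classic).
  by apply: meas_in_set; [exact: sG|exact: weak_norm_sqr|].
apply/seteqP; split => w /=; rewrite in_itv/=.
  by rewrite ltr_pXn2r ?nnegrE ?(ltW r0).
by rewrite ltr_pXn2r ?nnegrE ?(ltW r0).
Qed.

Lemma sigma_setC G A : sigma_algebra setT G -> G A -> G (~` A).
Proof. by move=> [_ h _] /h; rewrite setTD. Qed.

Lemma weak_norm_gt G Z (r : R) : sigma_algebra setT G -> weak_meas_in G Z ->
  G [set w | r < `|Z w|].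
Proof.
move=> sG mZ; rewrite (_ : [set w | _] = \bigcup_n ~` [set w | `|Z w| < r + n.+1%:R^-1]).
  by case: (sG) => _ _; apply => n; apply: sigma_setC => //; exact: weak_norm_lt.
apply/seteqP; split => w /=.
  rewrite -subr_gt0 => h; have [n _ hn] := near_infty_natSinv_lt (PosNum h).
  exists n => //=; apply/negP; rewrite -leNgt -lerBrDl.
  by have /= := hn n (leqnn n); exact: ltW.
move=> [n _ /= /negP]; rewrite -leNgt; apply: lt_le_trans.
by rewrite ltrDl invr_gt0 ltr0n.
Qed.

(** An open set is the union of the balls of radius 1/(k+1) around points of a dense sequence that
    it contains; this union is countable. *)
Lemma weak_borel G Z : sigma_algebra setT G -> weak_meas_in G Z -> borel_measurable open G Z.
Proof.
move=> sG mZ B sB; have [f fd] := separable_seq sH.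
suff : measurable_fun setT (Z : g_sigma_algebraType G -> g_sigma_algebraType (@open H)).
  by move=> /(_ measurableT B sB); rewrite setTI; exact: in_measurable.
have openE : @measurable _ (g_sigma_algebraType (@open H)) = <<s @open H >> by [].
apply: (measurability _ openE).
move=> _ [W oW <-]; rewrite setTI.
pose E n k := if `[< ball (f n) (k.+1%:R^-1 : R) `<=` W >] then
  [set w | `|Z w - f n| < k.+1%:R^-1] else set0.
rewrite (_ : Z @^-1` W = \bigcup_n \bigcup_k E n k).
  apply: bigcup_measurable => n _; apply: bigcup_measurable => k _.
  rewrite /E; case: ifPn => // _; apply: measurable_in.
  apply: (weak_norm_lt _ sG); apply: weak_measB => //; exact: weak_meas_cst.
apply/seteqP; split => w /=.
  move=> Ww; have /nbhs_ballP[e /= e0 eW] := open_nbhs_nbhs (conj oW Ww).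
  have e2 : 0 < e / 2 by rewrite divr_gt0.
  have [k _ hk] := near_infty_natSinv_lt (PosNum e2).
  have /= {}hk := hk k (leqnn k).
  have k0 : 0 < k.+1%:R^-1 :> R by rewrite invr_gt0 ltr0n.
  have [n hn] := fd (Z w) _ k0; exists n => //; exists k => //; rewrite /E.
  rewrite asboolT//= => y; rewrite -ball_normE /= => ny; apply: eW.
  rewrite -ball_normE/= -(subrK (f n) (Z w)) -addrA (le_lt_trans (ler_normD _ _))//.
  by rewrite (splitr e) ltrD ?(lt_trans hn)// (lt_trans ny).
move=> [n _ [k _]]; rewrite /E; case: ifPn => // /asboolP h /= hw; apply: h.
by rewrite -ball_normE/= distrC.
Qed.

End weak_measurability.

(** Coefficients at padding zeros can only enlarge the right side. *)
Lemma onseq_sqr_le (R : realType) (V : hilbertType R) (h : nat -> V) (a : nat -> R) (m n : nat) :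
  onseq h -> `|\sum_(m <= k < n) a k *: h k| ^+ 2 <= \sum_(m <= k < n) a k ^+ 2.
Proof.
move=> oh; pose b k := if h k == 0 then 0 else a k.
have -> : \sum_(m <= k < n) a k *: h k = \sum_(m <= k < n) b k *: h k.
  by apply: eq_bigr => k _; rewrite /b; case: eqP => // ->; rewrite !scaler0.
rewrite onseq_sqr//; last by move=> k hk; rewrite /b hk eqxx.
by apply: ler_sum => k _; rewrite /b; case: ifP => // _; rewrite expr0n sqr_ge0.
Qed.

(** Since 1 - f is nonnegative with integral zero. It turns a limit of expectations into an almost
    sure identity. *)
Lemma Ex_ge1_ae (R : realType) (d : measure_display) (Omega : measurableType d)
    (P : probability Omega R) (f : Omega -> R) :
  bounded_measurable f -> (forall w, f w <= 1) -> 1 <= Ex P f -> {ae P, forall w, f w = 1}.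
Proof.
move=> bf f1 E1; have mf : measurable_fun setT (fun w => (1 - f w)%:E).
  by apply/measurable_EFinP; apply: measurable_funB => //; exact: bf.1.
have [+ _] := ae_eq_integral_abs P measurableT mf.
have -> : (\int[P]_w `|(1 - f w)%:E| = (1 - Ex P f)%:E)%E.
  transitivity (\int[P]_w (1 - f w)%:E)%E.
    by apply: eq_integral => w _; rewrite gee0_abs// lee_fin subr_ge0.
  by rewrite (ExE P (bmB (bm_cst 1) bf)) (ExB P (bm_cst 1) bf) Ex_cst.
have -> : 1 - Ex P f = 0.
  apply/eqP; rewrite subr_eq0 eq_le E1/= -[leRHS](Ex_cst P 1).
  by apply: Ex_le => //; exact: bm_cst.
by move=> /(_ erefl); apply: filterS => w /(_ I) [] h; lra.
Qed.

Lemma borel_cantelli_dyadic (R : realType) (d : measure_display) (Omega : measurableType d)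
    (P : probability Omega R) (E : nat -> set Omega) :
  (forall j, measurable (E j)) -> (forall j, (P (E j) <= ((2 ^ j.+1)%:R^-1)%:E)%E) ->
  P (lim_sup_set E) = 0%E.
Proof.
move=> mE PE; apply: lim_sup_set_cvg0 => //.
apply: (@le_lt_trans _ _ (\sum_(0 <= j <oo) (1 / (2 ^ j.+1)%:R)%:E)%E).
  apply: lee_nneseries => [//|j _].
  by apply: le_trans (PE j) _; rewrite lee_fin div1r.
by rewrite (le_lt_trans (@epsilon_trick0 R 1 xpredT ler01))// ltry.
Qed.

Lemma not_lim_sup_set (T : Type) (E : nat -> set T) (w : T) :
  ~ lim_sup_set E w -> exists m, forall j, (m <= j)%N -> ~ E j w.
Proof.
move=> h; apply: contrapT => h2; apply: h => m _.
apply: contrapT => h3; apply: h2; exists m => j mj Ew; apply: h3; by exists j.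
Qed.

Lemma powR_seq_cvg0 (R : realType) (y : nat -> R) (p : R) : 0 < p -> (forall n, 0 <= y n) ->
  y n @[n --> \oo] --> (0 : R) -> y n `^ p @[n --> \oo] --> (0 : R).
Proof.
move=> p0 y0 yc; apply/cvgrPdist_le => e e0.
have ep : 0 < e `^ p^-1 by rewrite powR_gt0.
have /cvgrPdist_le/(_ _ ep) := yc; apply: filterS => n.
rewrite !sub0r !normrN !ger0_norm ?powR_ge0// => h.
rewrite -[leRHS](powRr1 (ltW e0)) -(mulVf (lt0r_neq0 p0)) powRrM.
by rewrite ge0_ler_powR ?nnegrE ?powR_ge0// ltW.
Qed.

Section increment_existence.
Context {R : realType} {d : measure_display} {Omega : measurableType d} {U H : hilbertType R}.
Variables (P : probability Omega R) (F : R -> set (set Omega)) (L : R -> U -> Omega -> R).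
Variable alpha : R.
Hypotheses (alpha_gt0 : 0 < alpha) (alpha_lt2 : alpha < 2).
Hypotheses (sU : separable U) (sH : separable H).
Hypotheses (Ff : filtration F) (Ls : canonical_stable P F alpha L).
Implicit Types (s t lam : R) (psi : U -> H).

Local Notation incr := (incr L).

(** [gauss_prod_lower] with lam = 1/e and trivial [z], combined with Markov's inequality for 1 - exp
    (- X/e), which is at least 1 - exp (-1) where X > e. *)
Lemma incr_sqr_sum_tail s t (v : nat -> U) (r : seq nat) (e : R) :
  0 <= s -> s <= t -> 0 < e ->
  fine (P [set w | e < \sum_(k <- r) incr s t (v k) w ^+ 2]) * (1 - expR (-1)) <=
  (t - s) * (2 * e^-1 * \sum_(k <- r) `|v k| ^+ 2) `^ (alpha / 2).
Proof.
move=> s0 st e0; have t0 := le_trans s0 st; pose X w := \sum_(k <- r) incr s t (v k) w ^+ 2.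
have mi u := measurable_incr Ff Ls u s0 st.
have mX : measurable_fun setT X.
  apply: (meas_in_filt Ff t0); apply: meas_in_sum => k.
  under eq_fun do rewrite expr2.
  by apply: meas_inM; exact: (adapted_incr Ff Ls).
pose A := [set w | e < X w]; rewrite -/A.
have mA : measurable A.
  rewrite (_ : A = X @^-1` `]e, +oo[%classic); last first.
    by apply/seteqP; split => w /=; rewrite in_itv/= andbT.
  by rewrite -[X in measurable X]setTI; exact: mX.
have X0 w : 0 <= X w by apply: sumr_ge0 => k _; exact: sqr_ge0.
have := gauss_prod_lower alpha_gt0 alpha_lt2 Ff Ls v r s0 st (ltW (_ : 0 < e^-1)) _
   (fun k => @meas_in_cst _ _ _ (F s) 0) (A := setT).
rewrite invr_gt0 => /(_ e0 _)h.
have FT : F s setT.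
  by rewrite -setC0; apply: sigma_setC; [exact: filt_sigma|case: (filt_sigma Ff s0)].
have {}h := h FT.
have bE (Z : Omega -> R) : measurable_fun setT Z -> (forall w, 0 <= Z w) ->
    bounded_measurable (fun w => expR (- (e^-1 * Z w))).
  move=> mZ Z0; split.
    apply: measurable_fun_continuous; first exact: continuous_expR.
    by apply: measurable_funN; exact: measurable_funM.
  exists 1 => w; rewrite ger0_norm ?expR_ge0// -[leRHS]expR0 ler_expR oppr_le0.
  by rewrite mulr_ge0 ?invr_ge0 ?(ltW e0).
have E1 : Ex P (fun w => \1_setT w * \prod_(k <- r) expR (- (e^-1 * 0 ^+ 2))) = 1.
  rewrite -[RHS](Ex_cst P 1); congr Ex; apply/funext => w.
  by rewrite indicT mul1r big1// => k _; rewrite expr0n mulr0 oppr0 expR0.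
have E2 : Ex P (fun w => \1_setT w * \prod_(k <- r) expR (- (e^-1 * (0 + incr s t (v k) w) ^+ 2))) =
    Ex P (fun w => expR (- (e^-1 * X w))).
  congr Ex; apply/funext => w; rewrite indicT mul1r /X; elim: r {mX A mA X0 h E1 X} => [|k r IH].
    by rewrite !big_nil mulr0 oppr0 expR0.
  by rewrite !big_cons IH -expRD add0r mulrDr opprD.
move: h; rewrite E1 E2 /= probability_setT/= mul1r => h.
have bX := bE _ mX X0; have bA : bounded_measurable (\1_A : Omega -> R) by exact: bm_indic.
have : Ex P (fun w => (1 - expR (-1)) * \1_A w) <= Ex P (fun w => 1 - expR (- (e^-1 * X w))).
  apply: Ex_le; [exact: bmZ|by apply: bmB => //; exact: bm_cst|] => w.
  rewrite indicE; case: (boolP (w \in A)) => [/set_mem Aw|_]; last first.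
    rewrite mulr0 subr_ge0 -[leRHS]expR0 ler_expR oppr_le0.
    by rewrite mulr_ge0 ?invr_ge0 ?(ltW e0).
  rewrite mulr1 lerD2l lerN2 ler_expR lerN2 -(mulVf (lt0r_neq0 e0)).
  by rewrite ler_wpM2l ?invr_ge0 ?ltW.
rewrite ExZ// Ex_indic// (ExB P (bm_cst 1) bX) Ex_cst mulrC.
by move=> /le_trans; apply; lra.
Qed.


Lemma adjoint_sum_small psi (g : nat -> H) (e : R) : onseq g -> hilbert_schmidt psi -> 0 < e ->
  exists N, forall n m, (N <= n)%N -> \sum_(n <= k < m) `|adjoint psi (g k)| ^+ 2 <= e.
Proof.
move=> og hp e0; pose S n := \sum_(0 <= k < n) `|adjoint psi (g k)| ^+ 2.
have ndS : nondecreasing_seq S.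
  by apply/nondecreasing_seqP => n; rewrite /S big_nat_recr//= lerDl sqr_ge0.
have cS : cvgn S.
  apply: nondecreasing_is_cvgn => //; exists (hs_norm psi ^+ 2) => _ [n _ <-].
  exact: adjoint_sqr_sum.
have Sl n : S n <= limn S by exact: nondecreasing_cvgn_le.
have /cvgrPdist_lt/(_ _ e0)[N _ hN] := cS.
exists N => n m Nn; have [mn|nm] := leqP m n; first by rewrite big_geq// ltW.
have -> : \sum_(n <= k < m) `|adjoint psi (g k)| ^+ 2 = S m - S n.
  by rewrite /S [X in _ = X - _](big_cat_nat (n := n)) ?(ltnW nm)//= addrAC subrr add0r.
have := hN n Nn; rewrite /= ger0_norm ?subr_ge0// => h.
by rewrite (le_trans _ (ltW h))// lerD2r.
Qed.

Lemma incr_sum_linear s t (v : nat -> U) (c : nat -> R) (n : nat) : 0 <= s -> s <= t ->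
  {ae P, forall w, incr s t (\sum_(0 <= k < n) c k *: v k) w =
    \sum_(0 <= k < n) c k * incr s t (v k) w}.
Proof.
move=> s0 st; elim: n => [|n IH].
  have := incr_linear Ls 1 0 0 s0 st; apply: filterS => w.
  rewrite scaler0 addr0 mul1r !big_nil => h0; lra.
apply: filterS2 IH (incr_linear Ls (c n) (v n) (\sum_(0 <= k < n) c k *: v k) s0 st) => w IH h.
by rewrite !big_nat_recr//= addrC h IH addrC.
Qed.

Lemma gauss_incr_lower s t (u : U) : 0 <= s -> s <= t ->
  1 - (t - s) * (2 * `|u| ^+ 2) `^ (alpha / 2) <= Ex P (fun w => expR (- (incr s t u w ^+ 2))).
Proof.
move=> s0 st; have FT : F s setT.
  by rewrite -setC0; apply: sigma_setC; [exact: filt_sigma|case: (filt_sigma Ff s0)].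
have := gauss_prod_lower alpha_gt0 alpha_lt2 Ff Ls (fun=> u) [:: 0%N] s0 st ler01 FT
   (fun k => @meas_in_cst _ _ _ (F s) 0).
rewrite (_ : Ex P (fun w => \1_setT w * \prod_(k <- [:: 0%N]) expR (- (1 * 0 ^+ 2))) = 1); last first.
  rewrite -[RHS](Ex_cst P 1); congr Ex; apply/funext => w.
  by rewrite indicT mul1r big_seq1 mul1r expr0n oppr0 expR0.
rewrite /= probability_setT/= mul1r big_seq1 mulr1.
move=> /le_trans; apply; rewrite le_eqVlt; apply/orP; left; apply/eqP; congr Ex.
by apply/funext => w; rewrite indicT mul1r big_seq1 add0r mul1r.
Qed.

(** The candidate is the sum of the vectors [incr s t (adjoint psi (g k)) w *: g k]. Without second
    moments it is summed along blocks so late that the j-th one exceeds 2^-j with probability at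
    most 2^-(j+1); Borel-Cantelli gives convergence off a null set. *)
Lemma increment_exists s t psi : 0 <= s -> s <= t -> hilbert_schmidt psi ->
  exists Y : Omega -> H, borel_measurable open (F t) Y /\
    forall h, {ae P, forall w, hdot (Y w) h = incr s t (adjoint psi h) w}.
Proof.
move=> s0 st hp; have t0 := le_trans s0 st; have sF := filt_sigma Ff t0.
have [g [og _]] := onb_seq sH.
pose v k := adjoint psi (g k).
pose e j : R := 2^-1 ^+ j.
have e0 j : 0 < e j by rewrite exprn_gt0// invr_gt0.
pose q : R := 1 - expR (-1).
have q0 : 0 < q by rewrite subr_gt0 -[ltRHS]expR0 ltr_expR ltrN10.
(* The [+ 1] keeps [C] positive when [s = t]. *)
pose C := (t - s + 1) / q.
have C0 : 0 < C by rewrite divr_gt0// ltr_wpDl// subr_ge0.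
(* [eta j] is the mass of a block for which the tail bound at level [e j ^+ 2] equals 2^-(j+1). *)
pose eta j := e j ^+ 2 / 2 * (((2 ^ j.+1)%:R)^-1 / C) `^ (2 / alpha).
have eta0 j : 0 < eta j.
  by rewrite mulr_gt0 ?divr_gt0 ?exprn_gt0// powR_gt0// divr_gt0// invr_gt0 ltr0n expn_gt0.
have etaE j : C * (2 * (e j ^+ 2)^-1 * eta j) `^ (alpha / 2) = (2 ^ j.+1)%:R^-1.
  have -> : 2 * (e j ^+ 2)^-1 * eta j = (((2 ^ j.+1)%:R)^-1 / C) `^ (2 / alpha).
    by rewrite /eta; field; rewrite gt_eqF.
  rewrite -powRrM (_ : 2 / alpha * (alpha / 2) = 1); last by field; rewrite gt_eqF.
  rewrite powRr1; first by field; rewrite !gt_eqF// ltr0n expn_gt0.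
  by rewrite divr_ge0 ?(ltW C0)// invr_ge0.
have [N0 hN0] := choice (fun j => adjoint_sum_small og hp (eta0 j)).
(* Summing the successors makes the block ends strictly increasing while [N j] stays above
   [N0 j]. *)
pose N j := (\sum_(i < j.+1) (N0 i).+1)%N.
have NS j : N j.+1 = (N j + (N0 j.+1).+1)%N by rewrite /N big_ord_recr.
have N0N j : (N0 j <= N j)%N.
  by rewrite /N big_ord_recr/= (leq_trans (leqnSn _))// leq_addl.
have NNS j : (N j <= N j.+1)%N by rewrite NS leq_addr.
have jN j : (j < N j)%N.
  by elim: j => [|j IH]; [rewrite /N big_ord1|rewrite NS -addn1 leq_add].
pose X j w : H := \sum_(0 <= k < N j) incr s t (v k) w *: g k.
pose E j := [set w | e j ^+ 2 < \sum_(N j <= k < N j.+1) incr s t (v k) w ^+ 2].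
have mi k : meas_in (F t) (incr s t (v k)) by exact: (adapted_incr Ff Ls).
have FE j : F t (E j).
  have -> : E j = (fun w => \sum_(N j <= k < N j.+1) incr s t (v k) w ^+ 2) @^-1` `]e j ^+ 2, +oo[%classic.
    by apply/seteqP; split => w; rewrite /E /= in_itv/= andbT.
  apply: meas_in_set => //; apply: meas_in_sum => k.
  under eq_fun do rewrite expr2; exact: meas_inM.
have PE j : (P (E j) <= ((2 ^ j.+1)%:R^-1)%:E)%E.
  have mE : measurable (E j) by exact: (filt_meas Ff t0).
  rewrite -[leLHS]fineK ?fin_num_measure// lee_fin -etaE.
  have := incr_sqr_sum_tail v (index_iota (N j) (N j.+1)) s0 st (exprn_gt0 2 (e0 j)).
  rewrite -/q -ler_pdivlMr// => /le_trans; apply.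
  rewrite mulrAC ler_pM ?divr_ge0 ?subr_ge0 ?powR_ge0 ?(ltW q0)//.
    by rewrite ler_pM2r ?invr_gt0// lerDl.
  rewrite ge0_ler_powR ?nnegrE ?divr_ge0 ?(ltW alpha_gt0)//.
  - by rewrite mulr_ge0 ?mulr_ge0 ?invr_ge0 ?sqr_ge0// sumr_ge0// => k _; rewrite sqr_ge0.
  - by rewrite mulr_ge0 ?(ltW (eta0 j))// divr_ge0 ?sqr_ge0.
  - by rewrite ler_wpM2l ?divr_ge0 ?sqr_ge0//; apply: hN0; exact: N0N.
pose B := lim_sup_set E.
have FB : F t B.
  apply: in_measurable => //; apply: bigcap_measurable => // n _.
  by apply: bigcup_measurable => j _; exact: measurable_in.
have PB : P B = 0%E.
  by apply: borel_cantelli_dyadic => // j; exact: (filt_meas Ff t0).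
have cX w : ~ B w -> cvgn (X ^~ w).
  move=> Bw; have [m hm] := not_lim_sup_set Bw.
  pose u j := X (j + m).+1 w - X (j + m)%N w.
  have cu : cvgn (series u).
    apply: normed_cvg; apply: (@series_le_cvg _ _ (geometric 1 2^-1)) => //.
    - by move=> n /=.
    - by move=> n; rewrite /geometric/= mul1r exprn_ge0// invr_ge0.
    - move=> n; rewrite /u /geometric/= mul1r.
      have := hm (n + m)%N (leq_addl _ _) => /negP; rewrite -leNgt => h.
      rewrite /X (big_cat_nat (n := N (n + m)%N)) ?NNS//= addrAC subrr add0r.
      apply: (@le_trans _ _ (e (n + m)%N)).
        rewrite -(@ler_pXn2r _ 2) ?nnegrE ?(ltW (e0 _))//.
        by rewrite (le_trans (onseq_sqr_le _ _ _ og)).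
      by rewrite /e ler_wiXn2l ?invr_ge0 ?invf_le1 ?ler1n// leq_addr.
    - apply: is_cvg_geometric_series; rewrite ger0_norm ?invr_ge0//.
      by rewrite invf_lt1// ltr1n.
  have XE n : X (n + m)%N w = X m w + series u n.
    elim: n => [|n IH]; first by rewrite add0n /series/= big_geq// addr0.
    rewrite /series/= big_nat_recr//= addrA -/(series u n) -IH /u addSn.
    by rewrite addrC subrK.
  move/cvg_ex: cu => [l cl]; apply/cvg_ex; exists (X m w + l).
  rewrite -(cvg_shiftn m) /=; under eq_fun do rewrite XE.
  by apply: cvgD => //; exact: cvg_cst.
(* The exceptional set belongs to [F t]; setting the sums to 0 on it makes the limit exist
   everywhere and be measurable with respect to [F t] itself. *)
pose X' j w := \1_(~` B) w *: X j w : H.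
pose Y w := limn (X' ^~ w).
have cX' w : X' n w @[n --> \oo] --> Y w.
  rewrite /Y /X' indicE; case: (boolP (w \in ~` B)) => [/set_mem/cX c|_].
    by under eq_fun do rewrite scale1r; exact: c.
  rewrite (_ : (fun n => false%:R *: X n w) = fun=> 0).
    by rewrite lim_cst//; exact: cvg_cst.
  by apply/funext => n; rewrite scale0r.
have mX' j : weak_meas_in (F t) (X' j).
  apply: weak_measZ; first by apply: meas_in_indic; exact: sigma_setC.
  by apply: weak_meas_sum => k; apply: weak_measZ => //; exact: weak_meas_cst.
have mY : weak_meas_in (F t) Y.
  move=> h; apply: (@meas_in_cvg _ _ _ _ (fun n w => hdot (X' n w) h)) => [n|w]; first exact: mX'.
  by apply: (@continuous_cvg _ _ _ _ _ _ (hdot ^~ h)); [exact: continuous_hdotl|exact: cX'].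
exists Y; split; first exact: weak_borel.
move=> h; set u := adjoint psi h.
have mu := measurable_incr Ff Ls u s0 st.
have mYM := meas_in_filt Ff t0 (mY h).
(* The difference of the two sides is shown to vanish through the expectation of exp (-
   difference^2), which passes to limits. *)
suff : {ae P, forall w, expR (- ((hdot (Y w) h - incr s t u w) ^+ 2)) = 1}.
  apply: filterS => w; rewrite -[RHS]expR0 => /expR_inj /eqP.
  by rewrite oppr_eq0 sqrf_eq0 subr_eq0 => /eqP.
have bE (Z : Omega -> R) : measurable_fun setT Z -> bounded_measurable (fun w => expR (- (Z w ^+ 2))).
  move=> mZ; split.
    apply: measurable_fun_continuous; first exact: continuous_expR.
    by apply: measurable_funN; exact: measurable_funX.
  exists 1 => w; rewrite ger0_norm ?expR_ge0// -[leRHS]expR0 ler_expR oppr_le0.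
  by rewrite sqr_ge0.
apply: Ex_ge1_ae; first by apply: bE; exact: measurable_funB.
  by move=> w; rewrite -[leRHS]expR0 ler_expR oppr_le0 sqr_ge0.
have c1 : Ex P (fun w => expR (- ((hdot (X' n w) h - incr s t u w) ^+ 2))) @[n --> \oo] -->
    Ex P (fun w => expR (- ((hdot (Y w) h - incr s t u w) ^+ 2))).
  apply: (@Ex_cvg _ _ _ _ _ _ 1).
  - move=> n; apply: (proj1 (bE _ _)); apply: measurable_funB => //.
    exact: (meas_in_filt Ff t0 (mX' n h)).
  - move=> n w; rewrite ger0_norm ?expR_ge0// -[leRHS]expR0 ler_expR oppr_le0.
    by rewrite sqr_ge0.
  - move=> w; apply: (@continuous_cvg _ _ _ _ _ _ expR); first exact: continuous_expR.
    apply: cvgN; rewrite expr2; under eq_fun do rewrite expr2.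
    have c : hdot (X' n w) h - incr s t u w @[n --> \oo] --> hdot (Y w) h - incr s t u w.
      apply: cvgB; last exact: cvg_cst.
      by apply: (@continuous_cvg _ _ _ _ _ _ (hdot ^~ h)); [exact: continuous_hdotl|exact: cX'].
    exact: cvgM.
(* The projection of [h] on the first [N n] vectors. Off [B], the product of [X' n] with [h] is
   almost surely the increment of [L] at [adjoint psi (ph n)], a vector that tends to [u]. *)
pose ph n := \sum_(0 <= k < N n) hdot h (g k) *: g k.
have cph : adjoint psi (ph n) - u @[n --> \oo] --> (0 : U).
  rewrite -(subrr u); apply: cvgB; last exact: cvg_cst.
  apply: (@continuous_cvg _ _ _ _ _ _ (adjoint psi)); first exact: continuous_adjoint.
  have := onseq_expansion h og; apply: cvg_comp.
  apply/cvgnyPge => A; exists A => // n /= An; apply: ltnW.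
  by rewrite (leq_ltn_trans An)// jN.
have c2 : 1 - (t - s) * (2 * `|adjoint psi (ph n) - u| ^+ 2) `^ (alpha / 2) @[n --> \oo] --> (1 : R).
  rewrite -[X in _ --> X]subr0 -(mulr0 (t - s)); apply: cvgB; first exact: cvg_cst.
  apply: cvgMr; apply: powR_seq_cvg0; first by rewrite divr_gt0.
    by move=> n; rewrite mulr_ge0 ?sqr_ge0.
  rewrite -(mulr0 2); apply: cvgMr; rewrite -[X in _ --> X](mulr0 0) -(normr0 U).
  by under eq_fun do rewrite expr2; apply: cvgM; exact: cvg_norm.
apply: cvgn_ler c2 c1 _ => n.
apply: le_trans (gauss_incr_lower _ s0 st) _.
rewrite le_eqVlt; apply/orP; left; apply/eqP; apply: Ex_ae_eq.
- by apply: bE; exact: (measurable_incr Ff Ls).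
- apply: bE; apply: measurable_funB => //.
  exact: (meas_in_filt Ff t0 (mX' n h)).
have notB : {ae P, forall w, ~ B w}.
  by exists B; split => //; [exact: (filt_meas Ff t0)|move=> w /= /contrapT].
have l1 := incr_linear Ls (-1) u (adjoint psi (ph n)) s0 st.
have l2 := incr_sum_linear v (fun k => hdot h (g k)) (N n) s0 st.
apply: filterS3 notB l1 l2 => w nBw.
have -> : \sum_(0 <= k < N n) hdot h (g k) *: v k = adjoint psi (ph n).
  rewrite /ph; elim: (N n) => [|k IH].
    by rewrite !big_nil linear_map0//; exact: adjoint_linear.
  by rewrite !big_nat_recr//= IH [in RHS]addrC adjoint_linear// addrC.
rewrite scaleN1r addrC mulN1r => -> ->.
rewrite [- incr s t u w + _]addrC; suff -> : hdot (X' n w) h =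
  \sum_(0 <= k < N n) hdot h (g k) * incr s t (v k) w by [].
rewrite /X' indicE mem_set//= scale1r /X hdot_suml; apply: eq_bigr => k _.
by rewrite hdotZl mulrC (hdotC h).
Qed.

End increment_existence.

(** * Maximal inequality for simple integrands *)

Section discrete_maximal.
Context {R : realType} {d : measure_display} {Omega : measurableType d} {H : hilbertType R}.
Variable P : probability Omega R.
Hypothesis sH : separable H.
Variables (G : nat -> set (set Omega)) (X : nat -> Omega -> H) (q : nat -> Omega -> R).
Variables (lam B : R) (m : nat).
Hypotheses (sG : forall k, sigma_algebra setT (G k)) (GM : forall k, G k `<=` measurable).
Hypothesis GS : forall k, G k `<=` G k.+1.
Hypothesis mX : forall k, weak_meas_in (G k.+1) (X k).
Hypotheses (mq : forall k, meas_in (G k) (q k)) (bq : forall k, bounded_measurable (q k)).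
Hypotheses (q_ge0 : forall k w, 0 <= q k w) (lam_ge0 : 0 <= lam) (B_ge0 : 0 <= B).
Hypothesis step : forall k Z A, (k < m)%N -> weak_meas_in (G k) Z -> G k A ->
  Ex P (fun w => \1_A w * gauss lam (Z w)) - B * Ex P (fun w => \1_A w * q k w) <=
  Ex P (fun w => \1_A w * gauss lam (Z w + X k w)).

Let M k w := \sum_(0 <= i < k) X i w.
Let a k w := \sum_(0 <= i < k) q i w.

Lemma gauss_bm (Z : Omega -> H) : (forall h, measurable_fun setT (fun w => hdot (Z w) h)) ->
  bounded_measurable (fun w => gauss lam (Z w)).
Proof.
move=> mZ; have [g [og _]] := onb_seq sH.
split; last first.
  exists 1 => w; rewrite /gauss ger0_norm ?expR_ge0// -[leRHS]expR0 ler_expR oppr_le0.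
  by rewrite mulr_ge0 ?sqr_ge0.
apply: measurable_fun_continuous; first exact: continuous_expR.
apply: measurable_funN; apply: measurable_funM => //.
apply: (measurable_fun_cvg (h := fun n w => \sum_(0 <= k < n) hdot (Z w) (g k) ^+ 2)).
  by move=> n; apply: measurable_sum => k; exact: measurable_funX.
by move=> w _; exact: parseval.
Qed.

Lemma gauss_le1 (x : H) : gauss lam x <= 1.
Proof. by rewrite /gauss -[leRHS]expR0 ler_expR oppr_le0 mulr_ge0 ?sqr_ge0. Qed.

Variables (r K : R).
Hypotheses (r_ge0 : 0 <= r) (K_ge0 : 0 <= K).

(* Stopping before the predictable quantity a exceeds K leaves min (a m) K in
   the final estimate, which passes to almost sure limits of a m. *)
Fixpoint stopped k w : H :=
  if k is k'.+1 then
    stopped k' w + \1_[set w | `|stopped k' w| <= r /\ a k'.+1 w <= K] w *: X k' w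
  else 0.

Let A k := [set w | `|stopped k w| <= r /\ a k.+1 w <= K].

Let stoppedS k w : stopped k.+1 w = stopped k w + \1_(A k) w *: X k w.
Proof. by []. Qed.

Let GmonoS (Z : Omega -> H) k : weak_meas_in (G k) Z -> weak_meas_in (G k.+1) Z.
Proof. by move=> mZ h; apply: meas_in_sub (mZ h); [exact: sG|exact: GS]. Qed.

Let Gmono j k (f : Omega -> R) : (j <= k)%N -> meas_in (G j) f -> meas_in (G k) f.
Proof.
move=> jk mf; rewrite -(subnK jk); elim: (k - j)%N => //= n IH.
by rewrite addSn; apply: meas_in_sub IH; [exact: sG|exact: GS].
Qed.

Let ma k : meas_in (G k) (a k.+1).
Proof.
have mqi (i : 'I_k.+1) : meas_in (G k) (q i).
  by apply: (@Gmono i k (q i)); [exact: leq_ord|exact: mq].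
have := meas_in_sum (index_enum _) mqi.
by congr (meas_in _ _); apply/funext => w; rewrite /a big_mkord.
Qed.

Let GA_of k : weak_meas_in (G k) (stopped k) -> G k (A k).
Proof.
move=> mN; have -> : A k = ~` [set w | r < `|stopped k w|] `&` (a k.+1 @^-1` `]-oo, K]%classic).
  by apply/seteqP; split => w /=; rewrite in_itv/= => -[h1 h2]; split => //;
    [apply/negP; rewrite -leNgt|rewrite leNgt; apply/negP].
apply: in_measurable => //; apply: measurableI; apply: measurable_in.
  by apply: sigma_setC => //; exact: weak_norm_gt.
by apply: meas_in_set.
Qed.

Let mstopped k : weak_meas_in (G k) (stopped k).
Proof.
elim: k => [|k IH]; first exact: weak_meas_cst.
apply: weak_measD; first exact: GmonoS.
apply: weak_measZ; last exact: mX.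
by apply: meas_in_indic; apply: GS; exact: GA_of.
Qed.

Let GA k : G k (A k). Proof. exact: GA_of. Qed.
Let mA k : measurable (A k). Proof. by apply: GM; exact: GA. Qed.

Let mM k (f : Omega -> R) : meas_in (G k) f -> measurable_fun setT f.
Proof. by apply: meas_in_measurable; [exact: sG|exact: GM]. Qed.

Let b k w := \sum_(0 <= i < k) \1_(A i) w * q i w.

(** Outside [A k] the stopped sum does not move; on [A k] the hypothesis [step] bounds the loss by B
    times the expectation of q k there. The losses add up to B times that of [b]. *)
Let gauss_stopped k : (k <= m)%N -> 1 - B * Ex P (b k) <= Ex P (fun w => gauss lam (stopped k w)).
Proof.
have bN j : bounded_measurable (fun w => gauss lam (stopped j w)).
  by apply: gauss_bm => h; apply: (@mM j); exact: mstopped.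
have bAq i : bounded_measurable (fun w => \1_(A i) w * q i w) by apply: bmM => //; exact: bm_indic.
have bA i : bounded_measurable (\1_(A i) : Omega -> R) by exact: bm_indic.
elim: k => [_|k IH km].
  rewrite (_ : b 0 = fun=> 0); last by apply/funext => w; rewrite /b big_geq.
  rewrite Ex_cst mulr0 subr0 (_ : (fun w => _) = fun=> 1) ?Ex_cst//.
  by apply/funext => w; rewrite /gauss/= normr0 expr0n mulr0 oppr0 expR0.
have bNX : bounded_measurable (fun w => gauss lam (stopped k w + X k w)).
  apply: gauss_bm => h; apply: (@mM k.+1).
  by apply: weak_measD => //; exact: GmonoS.
have -> : Ex P (fun w => gauss lam (stopped k.+1 w)) =
   Ex P (fun w => \1_(A k) w * gauss lam (stopped k w + X k w)) +
   (Ex P (fun w => gauss lam (stopped k w)) - Ex P (fun w => \1_(A k) w * gauss lam (stopped k w))).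
  rewrite -ExB//; last exact: bmM.
  rewrite -ExD; [|exact: bmM|by apply: bmB => //; exact: bmM].
  congr Ex; apply/funext => w; rewrite stoppedS indicE.
  by case: (w \in A k); rewrite ?scale1r ?mul1r ?subrr ?addr0// scale0r !mul0r subr0 add0r addr0.
have := @step k (stopped k) (A k) km (@mstopped k) (GA k).
have -> : Ex P (b k.+1) = Ex P (b k) + Ex P (fun w => \1_(A k) w * q k w).
  rewrite -ExD//; last exact: bm_sum.
  by congr Ex; apply/funext => w; rewrite /b big_nat_recr.
by have := IH (ltnW km); rewrite mulrDr; lra.
Qed.

(** A term is added only while [a k.+1 <= K], and at that moment the whole sum is below [a k.+1]. *)
Let b_le k w : b k w <= Num.min (a k w) K.
Proof.
have ba j : b j w <= a j w.
  by apply: ler_sum => i _; rewrite ler_piMl// indicE; case: (_ \in _).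
rewrite le_min ba/=; elim: k => [|k IH]; first by rewrite /b big_geq.
rewrite /b big_nat_recr//= -/(b k w) indicE; case: (boolP (w \in A k)) => [/set_mem[_ aK]|_].
  rewrite mul1r; apply: le_trans aK; rewrite /a big_nat_recr//= lerD2r; exact: ba.
by rewrite mul0r addr0.
Qed.

(** Once outside the ball the stopped sum fails its own norm test and is frozen there; before that
    it coincides with [M]. *)
Let stopped_path w k : (k <= m)%N -> a m w <= K ->
  r < `|stopped k w| \/ (stopped k w = M k w /\ forall j, (j <= k)%N -> `|M j w| <= r).
Proof.
move=> km aK; elim: k km => [_|k IH km].
  by right; split => [|j]; [rewrite /M big_geq|rewrite leqn0 => /eqP ->; rewrite /M big_geq// normr0].
have ak : a k.+1 w <= K.
  apply: le_trans aK; rewrite /a [leRHS](big_cat_nat (n := k.+1))//= lerDl sumr_ge0//.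
have [h|[hN hM]] := IH (ltnW km).
  left; rewrite stoppedS indicE memNset ?scale0r ?addr0//= => -[].
  by rewrite leNgt h.
have hA : A k w by split => //; rewrite hN hM.
have NS : stopped k.+1 w = M k.+1 w.
  by rewrite stoppedS indicE mem_set// scale1r hN /M big_nat_recr.
rewrite NS; have [h|h] := ltP r `|M k.+1 w|; [by left|right; split => // j].
by rewrite leq_eqVlt => /predU1P[->//|]; rewrite ltnS; exact: hM.
Qed.

Let mMw k : weak_meas_in (G k) (M k).
Proof.
elim: k => [|k IH].
  by rewrite (_ : M 0 = fun=> 0); [exact: weak_meas_cst|apply/funext => w; rewrite /M big_geq].
rewrite (_ : M k.+1 = fun w => M k w + X k w).
  by apply: weak_measD; [exact: GmonoS|exact: mX].
by apply/funext => w; rewrite /M big_nat_recr.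
Qed.

Let bmin : bounded_measurable (fun w => Num.min (a m w) K).
Proof.
have [ma' [C aC]] : bounded_measurable (a m) by exact: bm_sum.
split; first by apply: measurable_minr => //; exact: measurable_cst.
exists (Num.max C `|K|) => w; rewrite /Num.min; case: ifP => _; rewrite le_max ?aC//.
by rewrite lexx orbT.
Qed.

Lemma measurable_exceed : measurable [set w | exists2 k, (k <= m)%N & r < `|M k w|].
Proof.
rewrite (_ : [set w | _] = \bigcup_(k in [set k | (k <= m)%N]) [set w | r < `|M k w|]).
  by apply: bigcup_measurable => k _; apply: (@GM k); apply: weak_norm_gt.
by apply/seteqP; split => w [k h1 h2]; exists k.
Qed.

(** If [M] leaves the ball while [a m <= K], the stopped sum ends outside the ball, where 1 - gauss
    is at least 1 - exp (- lam r^2). The expectation of 1 - gauss is controlled by [gauss_stopped]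
    and [b_le]. *)
Lemma discrete_maximal :
  (1 - expR (- (lam * r ^+ 2))) * fine (P [set w | exists2 k, (k <= m)%N & r < `|M k w|]) <=
  (1 - expR (- (lam * r ^+ 2))) * fine (P [set w | K < a m w]) +
    B * Ex P (fun w => Num.min (a m w) K).
Proof.
set c := 1 - _; set W := [set w | _]; set W' := [set w | K < _].
have mW : measurable W := measurable_exceed.
have mW' : measurable W'.
  rewrite (_ : W' = a m @^-1` `]K, +oo[%classic).
    rewrite -[X in measurable X]setTI.
    have [ma' _] : bounded_measurable (a m) by exact: bm_sum.
    exact: ma'.
  by apply/seteqP; split => w; rewrite /W' /= in_itv/= andbT.
have c0 : 0 <= c.
  by rewrite subr_ge0 -[leRHS]expR0 ler_expR oppr_le0 mulr_ge0 ?sqr_ge0.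
have bN : bounded_measurable (fun w => gauss lam (stopped m w)).
  by apply: gauss_bm => h; apply: (@mM m); exact: mstopped.
have bW := bm_indic mW; have bW' := bm_indic mW'.
have h1 : Ex P (fun w => c * \1_W w) <= Ex P (fun w => c * \1_W' w + (1 - gauss lam (stopped m w))).
  apply: Ex_le; [exact: bmZ|by apply: bmD; [exact: bmZ|apply: bmB => //; exact: bm_cst]|] => w.
  rewrite !indicE; case: (boolP (w \in W)) => [/set_mem[k km Mk]|_]; last first.
    by rewrite mulr0 addr_ge0 ?subr_ge0 ?gauss_le1// mulr_ge0.
  case: (boolP (w \in W')) => [_|/negP nW'].
    by rewrite lerDl subr_ge0 gauss_le1.
  rewrite mulr0 add0r mulr1 lerD2l lerN2 ler_expR lerN2 ler_wpM2l//.
  have aK : a m w <= K by rewrite leNgt; apply/negP => h; apply: nW'; exact/mem_set.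
  have [h|[_ /(_ _ km)]] := stopped_path (leqnn m) aK; last by rewrite leNgt Mk.
  by rewrite lerXn2r ?nnegrE// ltW.
move: h1; rewrite ExD; [|exact: bmZ|by apply: bmB => //; exact: bm_cst].
rewrite !ExZ// !Ex_indic// (ExB P (bm_cst 1) bN) Ex_cst => h1.
have h2 := gauss_stopped (leqnn m).
have h3 : Ex P (b m) <= Ex P (fun w => Num.min (a m w) K).
  apply: Ex_le => //; apply: bm_sum => i; apply: bmM => //; exact: bm_indic.
have := ler_wpM2l B_ge0 h3; lra.
Qed.

End discrete_maximal.

(** * Steps of a simple integral along a grid *)

Section simple_integrals.
Context {R : realType} {d : measure_display} {Omega : measurableType d} {U H : hilbertType R}.
Variables (P : probability Omega R) (F : R -> set (set Omega)) (L : R -> U -> Omega -> R).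
Variables (alpha T : R).
Hypotheses (alpha_gt0 : 0 < alpha) (alpha_lt2 : alpha < 2) (T_gt0 : 0 < T).
Hypotheses (sU : separable U) (sH : separable H).
Hypotheses (Ff : filtration F) (Ls : canonical_stable P F alpha L).
Implicit Types (s t lam : R) (psi : U -> H).

Local Notation incr := (incr L).
Local Notation hsi := (hs_increment P F L).

(** Existence of an increment gives the [get] in [hs_increment] its meaning. *)
Lemma hs_incrementP s t psi : 0 <= s -> s <= t -> hilbert_schmidt psi ->
  borel_measurable open (F t) (hsi psi s t) /\
  forall h, {ae P, forall w, hdot (hsi psi s t w) h = incr s t (adjoint psi h) w}.
Proof.
move=> s0 st hpsi.
exact: (getPex (increment_exists alpha_gt0 alpha_lt2 sU sH Ff Ls s0 st hpsi)).
Qed.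

Lemma hs_increment_weak s t psi : 0 <= s -> s <= t -> hilbert_schmidt psi ->
  weak_meas_in (F t) (hsi psi s t).
Proof. by move=> s0 st /(hs_incrementP s0 st)[/borel_weak]. Qed.

Variable S : @simple_integrand R d Omega U H.
Hypothesis hS : simple_on F T S.

Local Notation N := (nknots S).
Local Notation tk := (knot S).

Lemma nknots_gt1 : (1 < N)%N.
Proof.
case: hS => k0 k1 kN _ _; case: N kN => [|[|//]] => kT.
  by move: T_gt0; rewrite -kT k0 ltxx.
by move: T_gt0; rewrite -kT k1 ltxx.
Qed.

Lemma knot_le i j : (0 < i)%N -> (i <= j <= N)%N -> tk i <= tk j.
Proof.
case: hS => _ _ _ tS _ i0 /andP[ij]; rewrite -(subnK ij); elim: (j - i)%N => //= n IH.
rewrite addSn => h; apply: le_trans (IH (ltnW h)) (ltW (tS _ _)).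
by rewrite h (leq_trans i0)// leq_addl.
Qed.

Lemma knot_bounds i : (i <= N)%N -> 0 <= tk i <= T.
Proof.
case: hS => k0 k1 kN _ _; case: i => [_|i iN]; first by rewrite k0 lexx ltW.
by rewrite -{1}k1 -kN !knot_le// leqnn (leq_trans _ iN).
Qed.

Lemma piece_cover i w : (i < N)%N -> exists2 j, (j < npieces S i)%N & piece S i j w.
Proof.
case: hS => _ _ _ _ hp iN; have [_ _ cp _] := hp _ iN.
by have : setT w by []; rewrite -cp => -[j /= jn pw]; exists j.
Qed.

Lemma piece_sum (V : lmodType R) i j w (f : nat -> V) :
  (i < N)%N -> (j < npieces S i)%N -> piece S i j w ->
  \sum_(0 <= k < npieces S i) (\1_(piece S i k) w : R) *: f k = f j.
Proof.
case: hS => _ _ _ _ hp iN jn pw; have [_ tp _ _] := hp _ iN.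
rewrite big_mkord (bigD1 (Ordinal jn))//= indicE mem_set// scale1r big1 ?addr0// => k kj.
rewrite indicE memNset ?scale0r// => kw.
have kE : nat_of_ord k = j by apply: (tp k j) => //; [exact: ltn_ord|exists w].
by move/eqP: kj; apply; exact/val_inj.
Qed.

Lemma piece_filt i j : (i < N)%N -> (j < npieces S i)%N -> F (tk i) (piece S i j).
Proof. by case: hS => _ _ _ _ hp iN; have [h _ _ _] := hp _ iN; exact: h. Qed.

Lemma coef_hs i j : (i < N)%N -> (j < npieces S i)%N -> hilbert_schmidt (coef S i j).
Proof. by case: hS => _ _ _ _ hp iN; have [_ _ _ h] := hp _ iN; exact: h. Qed.

Lemma simple_step_coef i j w : (i < N)%N -> (j < npieces S i)%N -> piece S i j w ->
  simple_step S i w = coef S i j.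
Proof. by move=> iN jn pw; exact: (@piece_sum (U -> H)). Qed.

Lemma simple_step_hs i w : (i < N)%N -> hilbert_schmidt (simple_step S i w).
Proof. by move=> iN; have [j jn pw] := piece_cover w iN; rewrite (simple_step_coef iN jn pw); exact: coef_hs. Qed.

Lemma simple_process_step i t w : (0 < i < N)%N -> tk i < t <= tk i.+1 ->
  simple_process S t w = simple_step S i w.
Proof.
move=> /andP[i0 iN] /andP[it ti].
have t0 : 0 < t by apply: le_lt_trans it; have /andP[] := knot_bounds (ltnW iN).
rewrite /simple_process indicE memNset ?scale0r ?add0r; last first.
  by move=> /= t0'; rewrite t0' ltxx in t0.
rewrite (bigD1_seq i) ?mem_index_iota ?iota_uniq ?i0//= indicE mem_set ?scale1r; last first.
  by rewrite /= in_itv/= it ti.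
rewrite big_seq_cond big1 ?addr0// => l; rewrite mem_index_iota => /andP[/andP[l0 lN] li].
rewrite indicE memNset ?scale0r//= in_itv/= => /andP[h1 h2].
have [lti|ilt|e] := ltngtP l i; last by rewrite e eqxx in li.
  have h3 : tk l.+1 <= tk i by apply: knot_le; rewrite // lti ltnW.
  by have := lt_le_trans it (le_trans h2 h3); rewrite ltxx.
have h3 : tk i.+1 <= tk l by apply: knot_le; rewrite // ilt ltnW.
by have := lt_le_trans h1 (le_trans ti h3); rewrite ltxx.
Qed.

Lemma simple_process0 w : simple_process S 0 w = simple_step S 0 w.
Proof.
rewrite /simple_process indicE mem_set// scale1r big_seq big1 ?addr0// => i.
rewrite mem_index_iota => /andP[i0 iN].
rewrite indicE memNset ?scale0r//= in_itv/= => /andP[h _].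
by have /andP[] := knot_bounds (ltnW iN); rewrite leNgt h.
Qed.

Lemma knot_interval t : 0 <= t < T -> exists2 i, (0 < i < N)%N & tk i <= t < tk i.+1.
Proof.
case: hS => _ k1 kN _ _ /andP[t0 tT].
have ex : exists n, (0 < n)%N && (t < tk n) by exists N; rewrite kN tT (ltn_trans _ nknots_gt1).
case: (ex_minnP ex) => -[//|[|n]] /andP[_ tn] nmin.
  by move: tn; rewrite k1 ltNge t0.
exists n.+1; last first.
  rewrite tn andbT leNgt; apply/negP => h.
  by have := nmin n.+1; rewrite h ltnn => /(_ isT).
have := nmin N; rewrite kN tT (ltn_trans _ nknots_gt1)// => /(_ isT) h.
by rewrite /= (leq_trans _ h).
Qed.

Lemma simple_process_hs t w : 0 <= t <= T -> hilbert_schmidt (simple_process S t w).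
Proof.
move=> /andP[]; rewrite le_eqVlt => /predU1P[<- _|t0 tT].
  by rewrite simple_process0; apply: simple_step_hs; exact: ltn_trans nknots_gt1.
have ex : exists n, (0 < n <= N)%N && (t <= tk n).
  by exists N; case: hS => _ _ -> _ _; rewrite tT leqnn (ltn_trans _ nknots_gt1).
case: hS => _ k1 _ _ _.
case: (ex_minnP ex) => -[//|[|n]] /andP[/andP[_ nN] tn] nmin.
  by move: tn; rewrite k1 leNgt t0.
rewrite (@simple_process_step n.+1)//; first exact: simple_step_hs.
rewrite tn andbT ltNge; apply/negP => h.
by have := nmin n.+1; rewrite h (ltnW nN) ltnn => /(_ isT).
Qed.

Local Notation SI := (simple_integral P F L S).

Lemma simple_integral_weak t : 0 <= t -> weak_meas_in (F t) (SI t).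
Proof.
move=> t0; rewrite /simple_integral.
have -> : (fun w => \sum_(1 <= i < N | tk i < t)
    \sum_(0 <= j < npieces S i)
      (\1_(piece S i j) w : R) *: hsi (coef S i j) (tk i) (Num.min (tk i.+1) t) w) =
  (* The range conditions move into the summands because [weak_meas_sum] asks for measurability at
     every index. *)
  (fun w => \sum_(i <- index_iota 1 N)
    (if (1 <= i < N)%N && (tk i < t) then 
    \sum_(j <- index_iota 0 (npieces S i)) if (0 <= j < npieces S i)%N then 
      (\1_(piece S i j) w : R) *: hsi (coef S i j) (tk i) (Num.min (tk i.+1) t) w else 0 else 0)).
  apply/funext => w; rewrite big_nat_cond big_mkcond; apply: eq_bigr => i _.
  by case: ifP => // _; rewrite big_nat big_mkcond.
apply: weak_meas_sum => i.
have [/andP[/andP[i1 iN] it]|_] := boolP ((0 < i < N)%N && (tk i < t)); last exact: weak_meas_cst.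
apply: weak_meas_sum => j; have [jn|_] := ltnP j (npieces S i); last exact: weak_meas_cst.
have /andP[ti0 _] := knot_bounds (ltnW iN).
have m0 : tk i <= Num.min (tk i.+1) t by rewrite le_min (ltW it) knot_le// leqnSn.
apply: weak_measZ.
  apply: meas_in_indic; apply: (filt_mono Ff ti0 (ltW it)); exact: piece_filt.
move=> h; apply: (meas_in_le Ff (le_trans ti0 m0)); first by rewrite ge_min lexx orbT.
by apply: hs_increment_weak => //; exact: coef_hs.
Qed.

Lemma simple_integral0 w : SI 0 w = 0.
Proof.
rewrite /simple_integral big_nat_cond big_pred0// => i; apply/negbTE/negP.
move=> /andP[/andP[_ iN]]; have /andP[h _] := knot_bounds (ltnW iN).
by rewrite ltNge h.
Qed.

(* On an interval without interior knots the integral moves by one increment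
   of L, whose integrand is known at the left end point. *)
Lemma simple_integral_increment i a b : (0 < i < N)%N -> tk i <= a -> a < b -> b <= tk i.+1 ->
  exists Y : nat -> Omega -> H, [/\
    forall j, (j < npieces S i)%N -> weak_meas_in (F b) (Y j),
    forall j, (j < npieces S i)%N -> forall h,
      {ae P, forall w, hdot (Y j w) h = incr a b (adjoint (coef S i j) h) w}
  & forall w, SI b w - SI a w = \sum_(0 <= j < npieces S i) (\1_(piece S i j) w : R) *: Y j w].
Proof.
move=> /andP[i0 iN] ia ab bi.
have /andP[ti0 _] := knot_bounds (ltnW iN).
have ib := le_lt_trans ia ab.
have a0 := le_trans ti0 ia; have b0 := le_trans a0 (ltW ab).
(* The condition [knot S i < t] in the integral is strict: at [a = tk i] the i-th term is absent,
   hence the case distinction. *)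
exists (fun j w => hsi (coef S i j) (tk i) b w -
  (if tk i < a then hsi (coef S i j) (tk i) a w else 0)); split.
- move=> j jn; apply: weak_measB.
    by apply: hs_increment_weak => //; [exact: ltW|exact: coef_hs].
  have [_|_] := ltP (tk i) a; last exact: weak_meas_cst.
  move=> h; apply: (meas_in_le Ff a0 (ltW ab)).
  by apply: hs_increment_weak => //; exact: coef_hs.
- move=> j jn h; have [_ hb] := hs_incrementP ti0 (ltW ib) (coef_hs iN jn).
  have [_ ha] := hs_incrementP ti0 ia (coef_hs iN jn).
  have [_|ai] := ltP (tk i) a; last first.
    have -> : a = tk i by apply/eqP; rewrite eq_le ai.
    by apply: filterS (hb h) => w; rewrite subr0.
  apply: filterS2 (hb h) (ha h) => w h1 h2; rewrite hdotBl h1 h2 /incr; ring.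
- move=> w; rewrite /simple_integral.
  have cut (c : R) (G : nat -> H) : tk i <= c -> c <= tk i.+1 ->
      \sum_(1 <= l < N | tk l < c) G l =
      \sum_(1 <= l < i) G l + (if tk i < c then G i else 0).
    move=> ic ci; rewrite (big_cat_nat (n := i))//=; last exact: ltnW.
    congr (_ + _).
      rewrite big_nat_cond [RHS]big_nat_cond; apply: eq_bigl => l.
      rewrite andbT; case: (boolP (1 <= l < i)%N) => //= /andP[l0 li].
      case: hS => _ _ _ tS _.
      rewrite (lt_le_trans _ (le_trans (@knot_le l.+1 i isT _) ic))//; last by rewrite li ltnW.
      by apply: tS; rewrite l0 (ltn_trans li).
    rewrite big_ltn_cond// [X in if _ then _ + X else X]big_nat_cond big_pred0 => [|l].
      by case: ifP; rewrite ?addr0.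
    apply/negbTE/negP => /andP[/andP[il lN]]; rewrite ltNge (le_trans ci)//.
    by apply: knot_le; rewrite // il ltnW.
  have ai := le_trans (ltW ab) bi.
  rewrite (cut b) ?(ltW ib)// (cut a)// ib.
  set A1 := \sum_(1 <= l < i) _; set A2 := \sum_(1 <= l < i) _.
  have -> : A1 = A2.
    rewrite /A1 /A2 big_nat [RHS]big_nat; apply: eq_bigr => l /andP[l0 li].
    have h : tk l.+1 <= tk i by apply: knot_le; rewrite // li ltnW.
    by rewrite !min_l ?(le_trans h)// ltW.
  rewrite opprD addrACA subrr add0r (min_r bi) (min_r ai).
  have [_|_] := ltP (tk i) a; rewrite ?subr0; last by under [RHS]eq_bigr do rewrite subr0.
  by rewrite -sumrB; apply: eq_bigr => j _; rewrite scalerBr.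
Qed.

Variable tau : nat -> R.
Hypotheses (tau0 : tau 0%N = 0) (tauS : forall k, tau k <= tau k.+1).
Hypothesis tau_grid : forall k, tau k < tau k.+1 ->
  exists2 i, (0 < i < N)%N & tk i <= tau k /\ tau k.+1 <= tk i.+1.

(** The integrand is constant on []tau k, tau k.+1]] and left continuous, so its value is read at
    the right end point; it is nevertheless known at time [tau k]. *)
Let q k w := (tau k.+1 - tau k) * hs_norm (simple_process S (tau k.+1) w) `^ alpha.

Lemma tau_ge0 k : 0 <= tau k.
Proof. by elim: k => [|k IH]; [rewrite tau0|exact: le_trans IH (tauS k)]. Qed.

Lemma grid_weight i k w : (0 < i < N)%N -> tk i <= tau k -> tau k < tau k.+1 ->
  tau k.+1 <= tk i.+1 ->
  q k w = \sum_(0 <= j < npieces S i) \1_(piece S i j) w *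
    ((tau k.+1 - tau k) * hs_norm (coef S i j) `^ alpha).
Proof.
move=> /andP[i0 iN] h1 h2 h3; rewrite /q (@simple_process_step i) ?i0//; last first.
  by rewrite h3 (le_lt_trans h1).
have [j jn pw] := piece_cover w iN; rewrite (simple_step_coef iN jn pw).
by rewrite (@piece_sum R^o i j w).
Qed.

Lemma grid_weight_measurable k : meas_in (F (tau k)) (q k) /\ bounded_measurable (q k).
Proof.
have := tauS k; rewrite le_eqVlt => /predU1P[e|h2].
  have -> : q k = fun=> 0 by apply/funext => w; rewrite /q e subrr mul0r.
  by split; [exact: meas_in_cst|exact: bm_cst].
have [i iN [h1 h3]] := tau_grid h2.
have iN' : (i < N)%N by case/andP: iN.
have -> : q k = fun w => \sum_(j <- index_iota 0 (npieces S i))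
   \1_(if (j < npieces S i)%N then piece S i j else set0) w *
    ((tau k.+1 - tau k) * hs_norm (coef S i j) `^ alpha).
  apply/funext => w; rewrite (grid_weight w iN h1 h2 h3) big_nat [RHS]big_nat.
  by apply: eq_bigr => j /andP[_ ->].
have /andP[ti0 _] := knot_bounds (ltnW iN').
have FA j : F (tau k) (if (j < npieces S i)%N then piece S i j else set0).
  case: ifPn => [jn|_]; last by case: (filt_sigma Ff (tau_ge0 k)).
  by apply: (filt_mono Ff ti0 h1); exact: piece_filt.
split.
  apply: meas_in_sum => j; apply: meas_inM; last exact: meas_in_cst.
  exact: meas_in_indic.
apply: bm_sum => j; apply: bmM; last exact: bm_cst.
by apply: bm_indic; apply: (filt_meas Ff (tau_ge0 k)).
Qed.

(** The hypothesis [step] of the discrete inequality. Intersecting [A] with the pieces makes the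
    coefficient a fixed operator, to which [gauss_step] applies; the losses on the pieces sum to the
    integral of [q k] over [A]. *)
Lemma grid_step lam k Z (A : set Omega) : 0 <= lam -> weak_meas_in (F (tau k)) Z -> F (tau k) A ->
  Ex P (fun w => \1_A w * gauss lam (Z w)) - (2 * lam) `^ (alpha / 2) * Ex P (fun w => \1_A w * q k w) <=
  Ex P (fun w => \1_A w * gauss lam (Z w + (SI (tau k.+1) w - SI (tau k) w))).
Proof.
move=> lam0 mZ FA; have t0 := tau_ge0 k.
have mA : measurable A by apply: (filt_meas Ff t0).
have [mq bq] := grid_weight_measurable k.
have bA : bounded_measurable (\1_A : Omega -> R) by exact: bm_indic.
have bg (Y : Omega -> H) : weak_meas_in (F (tau k.+1)) Y -> bounded_measurable (fun w => gauss lam (Y w)).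
  by move=> mY; apply: gauss_bm => // h; apply: (meas_in_filt Ff (tau_ge0 k.+1)); exact: mY.
have mZ' : weak_meas_in (F (tau k.+1)) Z.
  by move=> h; apply: (meas_in_le Ff t0 (tauS k)); exact: mZ.
have := tauS k; rewrite le_eqVlt => /predU1P[e|h2].
  under [X in _ <= Ex P X]eq_fun do rewrite -e subrr addr0.
  rewrite gerDl oppr_le0 mulr_ge0 ?powR_ge0// Ex_ge0// => w.
  by rewrite /q e subrr mul0r mulr0.
have [i iN [h1 h3]] := tau_grid h2.
have iN' : (i < N)%N by case/andP: iN.
have /andP[ti0 _] := knot_bounds (ltnW iN').
have [Y [mY Yi SIY]] := simple_integral_increment iN h1 h2 h3.
pose n := npieces S i; pose B (j : 'I_n) := A `&` piece S i j.
have FB j : F (tau k) (B j).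
  apply: (in_measurable (filt_sigma Ff t0)).
  apply: measurableI; apply: measurable_in => //.
  by apply: (filt_mono Ff ti0 h1); exact: piece_filt.
have mB j : measurable (B j) by apply: (filt_meas Ff t0).
have split w (f : 'I_n -> R) (g : R) : (forall j : 'I_n, piece S i j w -> f j = g) ->
    \sum_j \1_(B j) w * f j = \1_A w * g.
  move=> fg; have [j jn pw] := piece_cover w iN'.
  rewrite -(@piece_sum R^o i j w (fun=> \1_A w * g) iN' jn pw) big_mkord; apply: eq_bigr => l _.
  rewrite /B indicI /= [RHS]mulrCA -mulrA; congr (_ * _); rewrite [in LHS]indicE [in RHS]indicE.
  by case: (boolP (w \in _)) => [/set_mem/fg ->//|_]; rewrite !mul0r.
have E1 : Ex P (fun w => \1_A w * gauss lam (Z w)) =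
    \sum_(j < n) Ex P (fun w => \1_(B j) w * gauss lam (Z w)).
  rewrite -Ex_sum => [|j]; last by apply: bmM; [exact: bm_indic|exact: bg].
  by congr Ex; apply/funext => w; rewrite (split w _ (gauss lam (Z w))).
have E2 : Ex P (fun w => \1_A w * q k w) =
    \sum_(j < n) fine (P (B j)) * ((tau k.+1 - tau k) * hs_norm (coef S i j) `^ alpha).
  pose e (j : 'I_n) := (tau k.+1 - tau k) * hs_norm (coef S i j) `^ alpha.
  transitivity (\sum_(j < n) Ex P (fun w => e j * \1_(B j) w)); last first.
    by apply: eq_bigr => j _; rewrite ExZ ?Ex_indic// 1?mulrC//; exact: bm_indic.
  rewrite -Ex_sum => [|j]; last by apply: bmZ; exact: bm_indic.
  congr Ex; apply/funext => w; under eq_bigr do rewrite mulrC.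
  symmetry; apply: (split w e (q k w)) => j pw; rewrite /e.
  have ik : tk i < tau k.+1 <= tk i.+1 by rewrite (le_lt_trans h1 h2) h3.
  by rewrite /q (simple_process_step w iN ik) (simple_step_coef iN' (ltn_ord j) pw).
have E3 : Ex P (fun w => \1_A w * gauss lam (Z w + (SI (tau k.+1) w - SI (tau k) w))) =
    \sum_(j < n) Ex P (fun w => \1_(B j) w * gauss lam (Z w + Y j w)).
  rewrite -Ex_sum => [|j]; last first.
    by apply: bmM; [exact: bm_indic|apply: (bg (fun w => Z w + Y j w)); apply: weak_measD => //; exact: mY].
  congr Ex; apply/funext => w.
  symmetry; apply: (split w (fun j => gauss lam (Z w + Y j w))) => j pw.
  by rewrite SIY (@piece_sum H i j w).
rewrite E1 E2 E3 mulr_sumr -sumrB; apply: ler_sum => j _.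
have hc := coef_hs iN' (ltn_ord j).
have := gauss_step alpha_gt0 alpha_lt2 sU sH Ff Ls t0 (ltW h2) lam0 (FB j) hc mZ
  (mY _ (ltn_ord j)) (Yi _ (ltn_ord j)).
congr (_ - _ <= _); rewrite powRM ?sqr_ge0 ?mulr_ge0//.
rewrite -powR_mulrn ?hs_norm_ge0// -powRrM (_ : 2%:R * (alpha / 2) = alpha); last by field.
ring.
Qed.

End simple_integrals.

Lemma integral_step (R : realType) (f : R -> R) (tau : nat -> R) (m : nat) :
(forall k, tau k <= tau k.+1) -> (forall t, 0 <= f t) ->
(forall k t, tau k < t <= tau k.+1 -> f t = f (tau k.+1)) ->
measurable_fun `]tau 0%N, tau m]%classic f /\
  (\int[lebesgue_measure]_(t in `[tau 0%N, tau m]) (f t)%:E =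
  (\sum_(0 <= k < m) (tau k.+1 - tau k) * f (tau k.+1))%:E)%E.
Proof.
move=> tauS f0 fc; suff [mf IH] : measurable_fun `]tau 0%N, tau m]%classic f /\
  (\int[lebesgue_measure]_(t in `]tau 0%N, tau m]) (f t)%:E =
  (\sum_(0 <= k < m) (tau k.+1 - tau k) * f (tau k.+1))%:E)%E.
  by rewrite -(@integral_itv_obnd_cbnd _ _ _ (EFin \o f))//; exact/measurable_EFinP.
elim: m => [|m [mf IH]].
  by rewrite set_itvoc0 big_geq// integral_set0; split => //; exact: measurable_fun_set0.
have -> : `]tau 0%N, tau m.+1]%classic = `]tau 0%N, tau m] `|` `]tau m, tau m.+1].
  by rewrite -itv_bndbnd_setU// bnd_simp// -(subnK (leq0n m)) subn0; elim: m {mf IH} => //= m /le_trans; apply.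
have mc : measurable_fun `]tau m, tau m.+1]%classic f.
  apply: (@eq_measurable_fun _ _ _ _ _ (cst (f (tau m.+1)))); last exact: measurable_cst.
  by move=> t /set_mem; rewrite /= in_itv/= => /fc.
have mU : measurable_fun (`]tau 0%N, tau m] `|` `]tau m, tau m.+1]) f by exact/measurable_funU.
split => //; rewrite ge0_integral_setU//=; last 3 first.
- exact/measurable_EFinP.
- by move=> t _; rewrite lee_fin.
- apply/disj_setPS => t /= []; rewrite !in_itv/= => /andP[_ h] /andP[h' _].
  by move: h'; rewrite ltNge h.
rewrite IH big_nat_recr//= EFinD; congr (_ + _)%E.
rewrite (eq_integral (cst (f (tau m.+1))%:E)); last first.
  by move=> t /set_mem; rewrite /= in_itv/= => /fc ->.
rewrite integral_cst//= lebesgue_measure_itv/= lte_fin.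
case: ltP => h; first by rewrite -EFinB -EFinM mulrC.
by rewrite (_ : tau m.+1 = tau m) ?subrr ?mul0r ?mule0//; apply/eqP; rewrite eq_le h tauS.
Qed.

Section simple_maximal.
Context {R : realType} {d : measure_display} {Omega : measurableType d} {U H : hilbertType R}.
Variables (P : probability Omega R) (F : R -> set (set Omega)) (L : R -> U -> Omega -> R).
Variables (alpha T : R).
Hypotheses (alpha_gt0 : 0 < alpha) (alpha_lt2 : alpha < 2) (T_gt0 : 0 < T).
Hypotheses (sU : separable U) (sH : separable H).
Hypotheses (Ff : filtration F) (Ls : canonical_stable P F alpha L).
Variable S : @simple_integrand R d Omega U H.
Hypothesis hS : simple_on F T S.

(** Sorting the knots together with the times of [D] makes the integral at these times a partial sum
    over the grid. Repeated points give empty steps. *)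
Lemma knot_grid (D : seq R) : {in D, forall t, 0 <= t <= T} ->
  exists tau : nat -> R, exists m, [/\ tau 0%N = 0, tau m = T, forall k, tau k <= tau k.+1,
    forall k, tau k < tau k.+1 -> exists2 i, (0 < i < nknots S)%N &
      knot S i <= tau k /\ tau k.+1 <= knot S i.+1
  & {in D, forall t, exists2 k, (k <= m)%N & tau k = t}].
Proof.
move=> DT; have T0 := ltW T_gt0.
pose s := sort <=%R ([:: 0; T] ++ [seq knot S i | i <- index_iota 0 (nknots S).+1] ++ D).
have ss : sorted <=%R s by exact: sort_le_sorted.
have memE x : (x \in s) = (x \in [:: 0; T] ++ [seq knot S i | i <- index_iota 0 (nknots S).+1] ++ D).
  by rewrite mem_sort.
have s0 : 0 \in s by rewrite memE mem_cat inE eqxx.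
have sk i : (i <= nknots S)%N -> knot S i \in s.
  move=> iN; rewrite memE !mem_cat; apply/orP; right; apply/orP; left.
  by apply: map_f; rewrite mem_index_iota.
have sD t : t \in D -> t \in s by move=> tD; rewrite memE !mem_cat tD !orbT.
have sT t : t \in s -> 0 <= t <= T.
  rewrite memE !mem_cat => /orP[|/orP[|]]; last exact: DT.
    by rewrite !inE => /orP[]/eqP->; rewrite ?T0 lexx.
  by case/mapP => i; rewrite mem_index_iota => /andP[_ iN] ->; exact: (knot_bounds T_gt0 hS).
(* Beyond the list [nth] returns its default [T], so the grid stays at [T]. *)
pose tau k := nth T s k.
have tauT k : 0 <= tau k <= T.
  have [h|h] := ltnP k (size s); first by apply: sT; rewrite mem_nth.
  by rewrite /tau nth_default// T0 lexx.
have mono j k : (j <= k)%N -> tau j <= tau k.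
  move=> jk; have [h|h] := ltnP k (size s).
    by apply: (sorted_leq_nth le_trans le_refl T ss) => //; rewrite inE// (leq_ltn_trans jk).
  by rewrite [leRHS]/tau nth_default//; case/andP: (tauT j).
have pos t : t \in s -> exists2 k, (k <= size s)%N & tau k = t.
  by move=> ts; exists (index t s); [exact: index_size|exact: nth_index].
exists tau, (size s); split.
- have [k _ k0] := pos 0 s0; apply/eqP; rewrite eq_le -{1}k0 mono//.
  by case/andP: (tauT 0%N).
- by rewrite /tau nth_default.
- by move=> k; apply: mono.
- move=> k kk; have [|i iN /andP[h1 h2]] := @knot_interval _ _ _ _ _ _ _ T_gt0 _ hS (tau k).
    case/andP: (tauT k) => -> _; apply: lt_le_trans kk _.
    by case/andP: (tauT k.+1).
  exists i => //; split => //.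
  have [|j _ jE] := pos (knot S i.+1); first by apply: sk; case/andP: iN.
  rewrite -jE; have [h|h] := leqP k.+1 j; first exact: mono.
  by have := mono j k h; rewrite jE leNgt h2.
- by move=> t /sD/pos.
Qed.

Definition alpha_mass (Psi : R -> Omega -> U -> H) (w : Omega) : R :=
  \int[lebesgue_measure]_(t in `[0, T]) (hs_norm (Psi t w) `^ alpha).

Local Notation SI := (simple_integral P F L S).
Local Notation mass := (alpha_mass (simple_process S)).

Lemma simple_process_grid (tau : nat -> R) k t w :
  (forall k, tau k < tau k.+1 -> exists2 i, (0 < i < nknots S)%N &
      knot S i <= tau k /\ tau k.+1 <= knot S i.+1) ->
  tau k < t <= tau k.+1 -> simple_process S t w = simple_process S (tau k.+1) w.
Proof.
move=> tg /andP[h1 h2]; have h3 := lt_le_trans h1 h2; have [i iN [ia ib]] := tg k h3.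
have e1 : knot S i < t <= knot S i.+1 by rewrite (le_lt_trans ia h1) (le_trans h2 ib).
have e2 : knot S i < tau k.+1 <= knot S i.+1 by rewrite (le_lt_trans ia h3) ib.
by rewrite (simple_process_step T_gt0 hS w iN e1) (simple_process_step T_gt0 hS w iN e2).
Qed.

Lemma simple_mass_grid (tau : nat -> R) m w : tau 0%N = 0 -> tau m = T ->
  (forall k, tau k <= tau k.+1) ->
  (forall k, tau k < tau k.+1 -> exists2 i, (0 < i < nknots S)%N &
      knot S i <= tau k /\ tau k.+1 <= knot S i.+1) ->
  mass w = \sum_(0 <= k < m) (tau k.+1 - tau k) * hs_norm (simple_process S (tau k.+1) w) `^ alpha.
Proof.
move=> t0 tT tS tg; rewrite /alpha_mass /Rintegral.
have [|||_] := @integral_step _ (fun t => hs_norm (simple_process S t w) `^ alpha) tau m.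
- exact: tS.
- by move=> t; exact: powR_ge0.
- by move=> k t h; rewrite (simple_process_grid w tg h).
by rewrite t0 tT => ->.
Qed.

Lemma measurable_simple_path w :
  measurable_fun `[0, T]%classic (fun t => hs_norm (simple_process S t w)).
Proof.
have [tau [m [t0 tT tS tg _]]] := @knot_grid [::] (fun _ h => False_ind _ (notF h)).
have -> : `[0, T]%classic = [set 0] `|` `]0, T]%classic :> set R.
  by rewrite setU1itv ?bnd_simp// ltW.
apply/measurable_funU => //; split; first exact: measurable_fun_set1.
have [|||+ _] := @integral_step _ (fun t => hs_norm (simple_process S t w)) tau m.
- exact: tS.
- by move=> t; rewrite hs_norm_ge0.
- by move=> k t h; rewrite (simple_process_grid w tg h).
by rewrite t0 tT.
Qed.

Lemma simple_mass_bm : bounded_measurable mass.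
Proof.
have [tau [m [t0 tT tS tg _]]] := @knot_grid [::] (fun _ h => False_ind _ (notF h)).
have -> : mass = fun w => \sum_(0 <= k < m) (tau k.+1 - tau k) * hs_norm (simple_process S (tau k.+1) w) `^ alpha.
  by apply/funext => w; exact: simple_mass_grid.
by apply: bm_sum => k; have [] := grid_weight_measurable alpha T_gt0 Ff hS t0 tS tg k.
Qed.

Lemma alpha_mass_ge0 Psi w : 0 <= alpha_mass Psi w.
Proof. by apply: Rintegral_ge0 => t _; exact: powR_ge0. Qed.

Lemma simple_exceed_measurable (D : seq R) r : {in D, forall t, 0 <= t <= T} ->
  measurable [set w | exists2 t, t \in D & r < `|SI t w|].
Proof.
move=> DT; rewrite (_ : [set w | _] = \bigcup_(t in [set` D]) [set w | r < `|SI t w|]).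
  apply: fin_bigcup_measurable => // t /= /DT/andP[t0 _].
  apply: (filt_meas Ff t0); apply: weak_norm_gt => //; first exact: (filt_sigma Ff t0).
  by apply: (simple_integral_weak alpha_gt0 alpha_lt2 T_gt0 sU sH Ff Ls hS).
by apply/seteqP; split => w [t h1 h2]; exists t.
Qed.

Lemma simple_maximal (D : seq R) lam r K : {in D, forall t, 0 <= t <= T} ->
  0 <= lam -> 0 <= r -> 0 <= K ->
  (1 - expR (- (lam * r ^+ 2))) * fine (P [set w | exists2 t, t \in D & r < `|SI t w|]) <=
  (1 - expR (- (lam * r ^+ 2))) * fine (P [set w | K < mass w]) +
    (2 * lam) `^ (alpha / 2) * Ex P (fun w => Num.min (mass w) K).
Proof.
move=> DT lam0 r0 K0; have [tau [m [t0 tT tS tg tD]]] := knot_grid DT.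
have tau0 := tau_ge0 t0 tS.
pose X k w := SI (tau k.+1) w - SI (tau k) w.
pose q k w := (tau k.+1 - tau k) * hs_norm (simple_process S (tau k.+1) w) `^ alpha.
have ME k w : \sum_(0 <= i < k) X i w = SI (tau k) w.
  by rewrite telescope_sumr// t0 (simple_integral0 P L T_gt0 hS) subr0.
have -> : mass = fun w => \sum_(0 <= i < m) q i w.
  by apply/funext => w; exact: simple_mass_grid.
have weakSI k : weak_meas_in (F (tau k)) (SI (tau k)).
  by apply: (simple_integral_weak alpha_gt0 alpha_lt2 T_gt0 sU sH Ff Ls hS).
have sG k : sigma_algebra setT (F (tau k)) by exact: (filt_sigma Ff (tau0 k)).
have GM k : F (tau k) `<=` measurable by exact: (filt_meas Ff (tau0 k)).
have GS k : F (tau k) `<=` F (tau k.+1) by exact: (filt_mono Ff (tau0 k) (tS k)).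
have mX k : weak_meas_in (F (tau k.+1)) (X k).
  apply: weak_measB => // h.
  by apply: (meas_in_le Ff (tau0 k) (tS k)); exact: weakSI.
have mq k : meas_in (F (tau k)) (q k).
  by have [] := grid_weight_measurable alpha T_gt0 Ff hS t0 tS tg k.
have bq k : bounded_measurable (q k).
  by have [] := grid_weight_measurable alpha T_gt0 Ff hS t0 tS tg k.
have q0 k w : 0 <= q k w by rewrite mulr_ge0 ?powR_ge0// subr_ge0.
have B0 : 0 <= (2 * lam) `^ (alpha / 2) by exact: powR_ge0.
have := discrete_maximal (P := P) (m := m) sH sG GM GS mX mq bq q0 lam0 B0 _ r0 K0.
move=> h; apply: le_trans (h _) => [|k Z A _ mZ FA]; last first.
  exact: (grid_step alpha_gt0 alpha_lt2 T_gt0 sU sH Ff Ls hS t0 tS tg lam0 mZ FA).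
rewrite ler_wpM2l//.
  by rewrite subr_ge0 -[leRHS]expR0 ler_expR oppr_le0 mulr_ge0 ?sqr_ge0.
have mW := simple_exceed_measurable r DT.
have mE := measurable_exceed sH m sG GM GS mX r.
apply: fine_le; rewrite ?fin_num_measure//.
apply: le_measure; rewrite ?inE//.
by move=> w /= [t /tD[k km <-] rt]; exists k => //; rewrite ME.
Qed.

End simple_maximal.

(** * Measurability of the Skorokhod distance *)

Section piecewise_linear.
Context {R : realType}.
Implicit Types (s t : nat -> R) (x : R) (n : nat).

Definition clamp x : R := Num.max 0 (Num.min 1 x).

(** The interpolation that sends [s i] to [t i], as a sum of clamped ramps. Indices start at 1 like
    the knots of a simple integrand, whose knots 0 and 1 are both 0. *)
Definition piecewise_linear s t n x : R :=
  t 1%N + \sum_(1 <= i < n) (t i.+1 - t i) * clamp ((x - s i) / (s i.+1 - s i)).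

Lemma clamp_homo : {homo clamp : x y / x <= y}.
Proof.
move=> x y xy; rewrite /clamp ge_max !le_max lexx/=.
by apply/orP; right; rewrite le_min !ge_min lexx xy orbT.
Qed.

Lemma clamp_id x : 0 <= x <= 1 -> clamp x = x.
Proof. by move=> /andP[x0 x1]; rewrite /clamp min_r// max_r. Qed.

Lemma clamp0 x : x <= 0 -> clamp x = 0.
Proof. by move=> x0; rewrite /clamp max_l// ge_min x0 orbT. Qed.

Lemma clamp1 x : 1 <= x -> clamp x = 1.
Proof. by move=> x1; rewrite /clamp min_l// max_r. Qed.

Lemma knots_le s n i j : (forall i, (0 < i < n)%N -> s i < s i.+1) ->
  (0 < i)%N -> (i <= j <= n)%N -> s i <= s j.
Proof.
move=> sS i0 /andP[ij]; rewrite -(subnK ij); elim: (j - i)%N => //= k IH.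
rewrite addSn => h; apply: le_trans (IH (ltnW h)) (ltW (sS _ _)).
by rewrite h (leq_trans i0)// leq_addl.
Qed.

Lemma find_interval s n x : (1 < n)%N -> s 1%N < x <= s n ->
  exists2 i, (0 < i < n)%N & s i < x <= s i.+1.
Proof.
elim: n => // -[//|[|n]] IH _ /andP[h1 h2]; first by exists 1%N => //; rewrite h1.
have [h|h] := leP x (s n.+2).
  by have [|i /andP[i0 i1] i2] := IH isT; [rewrite h1|exists i => //; rewrite i0 ltnS ltnW].
by exists n.+2; rewrite ?ltnSn// h.
Qed.

(** The ramps before the i-th are saturated at 1 and telescope; those after it still vanish. *)
Lemma piecewise_linearE s t n i x : (forall i, (0 < i < n)%N -> s i < s i.+1) ->
  (0 < i < n)%N -> s i <= x <= s i.+1 ->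
  piecewise_linear s t n x = t i + (t i.+1 - t i) * ((x - s i) / (s i.+1 - s i)).
Proof.
move=> sS /andP[i0 iN] /andP[x1 x2].
have d0 j : (0 < j < n)%N -> 0 < s j.+1 - s j by rewrite subr_gt0; exact: sS.
have di : 0 < s i.+1 - s i by apply: d0; rewrite i0.
rewrite /piecewise_linear (big_cat_nat (n := i))//=; last exact: ltnW.
rewrite (big_ltn iN) clamp_id; last first.
  by rewrite divr_ge0 ?subr_ge0 ?(ltW di)//= ?ler_pdivrMr// ?mul1r ?lerD2r// (le_trans x1).
rewrite [X in _ + (_ + (_ + X))]big_nat [X in _ + (_ + (_ + X))]big1 ?addr0; last first.
  move=> j /andP[ij jN]; rewrite clamp0 ?mulr0// mulr_le0_ge0//; last first.
    by rewrite invr_ge0 ltW// d0// jN (leq_trans _ ij).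
  by rewrite subr_le0 (le_trans x2)// (@knots_le s n i.+1 j)// ij ltnW.
rewrite addrA; congr (_ + _).
rewrite (@eq_big_nat _ _ _ _ _ _ (fun j => t j.+1 - t j)) ?telescope_sumr//; first by ring.
move=> j /andP[j0 ji]; have jn : (0 < j < n)%N by rewrite j0 (ltn_trans ji).
rewrite clamp1 ?mulr1// ler_pdivlMr ?d0// mul1r lerD2r (le_trans _ x1)//.
by apply: (@knots_le s n j.+1 i) => //; rewrite ji ltnW.
Qed.

Variables (s t : nat -> R) (n : nat).
Hypotheses (n1 : (1 < n)%N) (s1 : s 1%N = t 1%N) (sn : s n = t n).
Hypothesis sS : forall i, (0 < i < n)%N -> s i < s i.+1.
Hypothesis tS : forall i, (0 < i < n)%N -> t i < t i.+1.

Lemma find_interval_closed x : s 1%N <= x <= s n ->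
  exists2 i, (0 < i < n)%N & s i <= x <= s i.+1.
Proof.
move=> /andP[]; rewrite le_eqVlt => /predU1P[<- _|h1 h2].
  by exists 1%N; rewrite ?n1// lexx ltW// sS.
have [|i iN /andP[/ltW h3 h4]] := @find_interval s n x n1; first by rewrite h1.
by exists i; rewrite ?h3.
Qed.

Lemma piecewise_linear_itv i x : (0 < i < n)%N -> s i <= x <= s i.+1 ->
  t i <= piecewise_linear s t n x <= t i.+1.
Proof.
move=> iN xi; have /andP[x1 x2] := xi; rewrite (piecewise_linearE t sS iN xi).
have d1 : 0 < s i.+1 - s i by rewrite subr_gt0 sS.
have d2 : 0 < t i.+1 - t i by rewrite subr_gt0 tS.
have h0 : 0 <= (x - s i) / (s i.+1 - s i) by rewrite divr_ge0 ?subr_ge0// ltW// sS.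
have h1 : (x - s i) / (s i.+1 - s i) <= 1 by rewrite ler_pdivrMr// mul1r lerD2r.
by apply/andP; split; nra.
Qed.

Lemma piecewise_linear_gt i x : (0 < i < n)%N -> s i < x <= s i.+1 ->
  t i < piecewise_linear s t n x.
Proof.
move=> iN /andP[x1 x2]; rewrite (@piecewise_linearE _ _ _ i)// ?x2 ?(ltW x1)//.
by rewrite ltrDl mulr_gt0 ?divr_gt0 ?subr_gt0 ?sS ?tS.
Qed.

Lemma piecewise_linear_dist i x e : (0 < i < n)%N -> s i <= x <= s i.+1 ->
  `|s i - t i| <= e -> `|s i.+1 - t i.+1| <= e -> `|piecewise_linear s t n x - x| <= e.
Proof.
move=> iN xi; have /andP[x1 x2] := xi; rewrite (piecewise_linearE t sS iN xi).
have d1 : 0 < s i.+1 - s i by rewrite subr_gt0 sS.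
set h := (x - s i) / _.
have h0 : 0 <= h by rewrite divr_ge0 ?subr_ge0// ltW// sS.
have h1 : h <= 1 by rewrite ler_pdivrMr// mul1r lerD2r.
have xE : x = s i + (s i.+1 - s i) * h by rewrite /h; field; rewrite gt_eqF.
rewrite xE !ler_norml => /andP[a1 a2] /andP[b1 b2].
have -> : t i + (t i.+1 - t i) * h - (s i + (s i.+1 - s i) * h) =
  (1 - h) * (t i - s i) + h * (t i.+1 - s i.+1) by ring.
by apply/andP; split; nra.
Qed.

End piecewise_linear.

Section piecewise_linear_bij.
Context {R : realType}.
Variables (s t : nat -> R) (n : nat).
Hypotheses (n1 : (1 < n)%N) (s1 : s 1%N = t 1%N) (sn : s n = t n).
Hypothesis sS : forall i, (0 < i < n)%N -> s i < s i.+1.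
Hypothesis tS : forall i, (0 < i < n)%N -> t i < t i.+1.

Lemma piecewise_linearK x : s 1%N <= x <= s n ->
  piecewise_linear t s n (piecewise_linear s t n x) = x.
Proof.
move=> /(find_interval_closed n1 sS)[i iN xi].
rewrite (@piecewise_linearE _ t s n i)// ?piecewise_linear_itv//.
rewrite (@piecewise_linearE _ s t n i)//.
by field; rewrite ?subr_eq0 !gt_eqF ?sS ?tS.
Qed.

Lemma piecewise_linear_range x : s 1%N <= x <= s n ->
  t 1%N <= piecewise_linear s t n x <= t n.
Proof.
move=> /(find_interval_closed n1 sS)[i iN xi]; have /andP[i0 iN'] := iN.
have /andP[h1 h2] := piecewise_linear_itv sS tS iN xi.
apply/andP; split.
  by apply: le_trans h1; apply: (knots_le tS) => //; rewrite i0 ltnW.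
by apply: le_trans h2 _; apply: (knots_le tS); rewrite // iN' leqnn.
Qed.

End piecewise_linear_bij.

Lemma piecewise_linear_time_change (R : realType) (T : R) (s t : nat -> R) (n : nat) :
  (1 < n)%N -> s 1%N = 0 -> t 1%N = 0 -> s n = T -> t n = T ->
  (forall i, (0 < i < n)%N -> s i < s i.+1) -> (forall i, (0 < i < n)%N -> t i < t i.+1) ->
  time_change T (piecewise_linear s t n).
Proof.
move=> n1 s1 t1 sn tn sS tS.
have inj : {in `[0, T]%classic &, injective (piecewise_linear s t n)}.
  move=> x y /set_mem/=; rewrite in_itv/= => xT /set_mem/=; rewrite in_itv/= => yT e.
  rewrite -(@piecewise_linearK _ s t n n1 sS tS x) ?s1 ?sn//.
  by rewrite e (piecewise_linearK n1 sS tS)// s1 sn.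
split; first split.
- move=> x /=; rewrite !in_itv/= -t1 -tn => xT.
  by apply: piecewise_linear_range => //; rewrite s1 -t1 sn -tn.
- exact: inj.
- move=> y /=; rewrite in_itv/= => yT; exists (piecewise_linear t s n y).
    rewrite /= in_itv/= -s1 -sn; apply: piecewise_linear_range => //.
    by rewrite t1 tn.
  by apply: piecewise_linearK => //; rewrite t1 tn.
- move=> x y xT yT xy; rewrite lt_neqAle; apply/andP; split.
    apply/eqP => /inj; rewrite !inE/= => /(_ xT yT) e.
    by move: xy; rewrite e ltxx.
  rewrite lerD2l !big_nat; apply: ler_sum => i iN; rewrite ler_wpM2l ?subr_ge0 ?(ltW (tS _ _))//.
  by apply: clamp_homo; rewrite ler_wpM2r ?invr_ge0 ?subr_ge0 ?(ltW (sS _ _))// lerD2r ltW.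
Qed.

Lemma seq_cluster (R : realType) (T : R) (N : nat) (s : nat -> nat -> R) :
  (forall n i, (i <= N)%N -> 0 <= s n i <= T) ->
  exists l : nat -> R, forall n0 (e : R), 0 < e ->
    exists2 n, (n0 <= n)%N & forall i, (i <= N)%N -> `|s n i - l i| < e.
Proof.
move=> sT; pose v n : 'rV[R]_N.+1 := \row_i s n i.
have cA := @rV_compact R N.+1 (fun=> `[0, T]%classic) (fun=> @segment_compact R 0 T).
have [|l [_ cl]] := cA (v @ \oo) _.
  by exists 0%N => // n _ i /=; rewrite mxE in_itv/=; apply: sT; rewrite -ltnS.
exists (fun i => l ord0 (inord i)) => n0 e e0.
have [|_ [[n /= n0n <-] ln]] := cl [set v n | n in [set n | (n0 <= n)%N]] (ball l e) _ (nbhsx_ballx l e e0).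
  by exists n0 => // n /= h; exists n.
exists n => // i iN; case: ln => _ /(_ ord0 (inord i)).
by rewrite /ball/= mxE inordK// distrC.
Qed.

Lemma near_left_ex (R : realType) (t : R) (Q : set R) : (\forall u \near t^'-, Q u) ->
  exists2 e : R, 0 < e & forall u, t - e < u < t -> Q u.
Proof.
move=> h; have /nbhs_ballP[e /= e0 he] : nbhs t (fun u => u < t -> Q u) := h.
exists e => // u /andP[h1 h2]; apply: he => //.
by rewrite /ball/= ger0_norm ?subr_ge0 ?(ltW h2)//; lra.
Qed.

Lemma near_right_ex (R : realType) (t : R) (Q : set R) : (\forall u \near t^'+, Q u) ->
  exists2 e : R, 0 < e & forall u, t < u < t + e -> Q u.
Proof.
move=> h; have /nbhs_ballP[e /= e0 he] : nbhs t (fun u => t < u -> Q u) := h.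
exists e => // u /andP[h1 h2]; apply: he => //.
by rewrite /ball/= ler0_norm ?subr_le0 ?(ltW h1)//; lra.
Qed.

(** * Level sets of the Skorokhod distance to a simple process *)

Section skorokhod_measurability.
Context {R : realType} {d : measure_display} {Omega : measurableType d} {U H : hilbertType R}.
Variables (F : R -> set (set Omega)) (T : R).
Hypotheses (T_gt0 : 0 < T) (sU : separable U).
Hypothesis Ff : filtration F.
Variable Psi : R -> Omega -> U -> H.
Hypothesis aPsi : admissible F T Psi.
Implicit Types (delta rho : R) (phi : U -> H).

Lemma Psi_hs t w : 0 <= t <= T -> hilbert_schmidt (Psi t w).
Proof. by case: aPsi => h _ _; exact: h. Qed.

Lemma hs_dist_open phi delta : hilbert_schmidt phi ->
  hs_open [set psi : U -> H | delta < hs_norm (phi - psi)].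
Proof.
move=> hphi psi hpsi /= h; exists (hs_norm (phi - psi) - delta); first by rewrite subr_gt0.
move=> chi hchi h'; have := hs_norm_triangle sU hphi hpsi hchi.
by move: h h'; lra.
Qed.

Lemma measurable_hs_dist t phi delta : 0 <= t <= T -> hilbert_schmidt phi ->
  F t [set w | hs_norm (phi - Psi t w) <= delta].
Proof.
move=> tT hphi; have t0 : 0 <= t by case/andP: tT.
have -> : [set w | hs_norm (phi - Psi t w) <= delta] =
    ~` (Psi t @^-1` [set psi | delta < hs_norm (phi - psi)]).
  by apply/seteqP; split => w /=; [move=> h; apply/negP|move/negP]; rewrite -leNgt.
apply: sigma_setC; first exact: (filt_sigma Ff t0).
case: aPsi => _ h _; apply: h => //.
by apply: sub_sigma_algebra; exact: hs_dist_open.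
Qed.

Variable S : @simple_integrand R d Omega U H.
Hypothesis hS : simple_on F T S.

Local Notation N := (nknots S).
Local Notation tk := (knot S).

Lemma measurable_step_dist i t delta : (i < N)%N -> 0 <= t <= T ->
  measurable [set w | hs_norm (simple_step S i w - Psi t w) <= delta].
Proof.
move=> iN tT; have t0 : 0 <= t by case/andP: tT.
have /andP[ti0 _] := knot_bounds T_gt0 hS (ltnW iN).
have -> : [set w | hs_norm (simple_step S i w - Psi t w) <= delta] =
    \bigcup_(j in `I_(npieces S i)) (piece S i j `&`
      [set w | hs_norm (coef S i j - Psi t w) <= delta]).
  apply/seteqP; split => w /=; last first.
    by move=> [j /= jn [pw]]; rewrite (simple_step_coef hS iN jn pw).
  have [j jn pw] := piece_cover hS w iN.
  by rewrite (simple_step_coef hS iN jn pw) => h; exists j.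
apply: bigcup_measurable => j jn; apply: measurableI.
  by apply: (filt_meas Ff ti0); exact: (piece_filt hS).
by apply: (filt_meas Ff t0); apply: measurable_hs_dist => //; exact: (coef_hs hS).
Qed.

(** [s] lists the preimages of the knots under a time change. The gap [rho] replaces strict
    monotonicity so that all the constraints are closed. *)
Definition knot_shift delta rho (s : nat -> R) :=
  [/\ s 1%N = 0, s N = T, forall i, (i <= N)%N -> 0 <= s i <= T,
      forall i, (0 < i < N)%N -> s i + rho <= s i.+1
    & forall i, (0 < i <= N)%N -> `|s i - tk i| <= delta].

(** On the i-th interval of [s] the time-changed simple process is its i-th step. Left continuity of
    [Psi] makes rational times sufficient. *)
Definition step_match delta rho (w : Omega) := exists2 s, knot_shift delta rho s &
  forall i (q : rat), (0 < i < N)%N -> s i < ratr q < s i.+1 ->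
    hs_norm (simple_step S i w - Psi (ratr q) w) <= delta.

(* Compactness of the set of shifted knots reduces step_match to finitely many
   rational times, and then only countably many sets of constraints matter. *)
Lemma step_match_finite delta rho w : step_match delta rho w <->
  forall n, exists2 s, knot_shift delta rho s &
    forall i (q : rat), (pickle q <= n)%N -> (0 < i < N)%N -> s i < ratr q < s i.+1 ->
      hs_norm (simple_step S i w - Psi (ratr q) w) <= delta.
Proof.
split=> [[s hs sm] n|h]; first by exists s => // i q _; exact: sm.
have [s hs] := choice (fun n => let: ex_intro2 s a b := h n in ex_intro _ s (conj a b)).
have sT n i : (i <= N)%N -> 0 <= s n i <= T by have [[_ _ + _ _] _] := hs n; exact.
have [l cl] := seq_cluster sT.
have N1 := nknots_gt1 T_gt0 hS.
have closeness i (x y : R) : (i <= N)%N -> (forall n, x <= s n i <= y) -> x <= l i <= y.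
  move=> iN hxy; apply/andP; split; apply/ler_addgt0Pr => e e0.
    have [n _ /(_ i iN)] := cl 0%N e e0; have /andP[] := hxy n.
    by rewrite ltr_norml => + _ /andP[]; lra.
  have [n _ /(_ i iN)] := cl 0%N e e0; have /andP[] := hxy n.
  by rewrite ltr_norml => _ + /andP[]; lra.
exists l.
- split.
  + apply/eqP; rewrite eq_le andbC; apply: closeness => [|n]; first exact: ltnW.
    by have [[-> _ _ _ _] _] := hs n; rewrite lexx.
  + apply/eqP; rewrite eq_le andbC; apply: closeness => [|n]; first exact: leqnn.
    by have [[_ -> _ _ _] _] := hs n; rewrite lexx.
  + by move=> i iN; apply: closeness => // n; exact: sT.
  + move=> i /andP[i0 iN]; apply/ler_addgt0Pr => e e0.
    have e2 : 0 < e / 2 by rewrite divr_gt0.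
    have [n _ hn] := cl 0%N _ e2; have := hn i (ltnW iN); have := hn i.+1 iN.
    have [[_ _ _ /(_ i) + _] _] := hs n; rewrite i0 iN => /(_ isT).
    rewrite !ltr_norml => h1 /andP[h2 h3] /andP[h4 h5].
    by move: h1 h2 h3 h4 h5; lra.
  + move=> i /andP[i0 iN]; rewrite ler_norml lerBrDr lerBlDr; apply: closeness => // n.
    have [[_ _ _ _ /(_ i) +] _] := hs n; rewrite i0 iN => /(_ isT).
    by rewrite ler_norml lerBrDr lerBlDr.
- move=> i q /andP[i0 iN] /andP[h1 h2].
  (* The strict inequalities around [ratr q] persist for shifts close enough to [l], and one of
     these has index above [pickle q]. *)
  have e0 : 0 < Num.min (ratr q - l i) (l i.+1 - ratr q) by rewrite lt_min !subr_gt0 h1 h2.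
  have [n qn hn] := cl (pickle q) _ e0.
  have [_ /(_ i q qn) +] := hs n; apply; first by rewrite i0.
  have := hn i (ltnW iN); have := hn i.+1 iN; rewrite !lt_min !ltr_norml.
  by move=> /andP[/andP[a1 a2] /andP[a3 a4]] /andP[/andP[a5 a6] /andP[a7 a8]]; apply/andP; split; lra.
Qed.

Lemma measurable_step_match delta rho : measurable [set w | step_match delta rho w].
Proof.
(* [b] contains every pair (interval, rational) that some admissible shift tests among the rationals
   of code at most [n]; it does not depend on [w]. *)
pose ok n (b : seq (nat * rat)) :=
  (forall p, p \in b -> (p.1 < N)%N /\ 0 <= (ratr p.2 : R) <= T) /\
  exists2 s, knot_shift delta rho s & forall i (q : rat), (pickle q <= n)%N ->
    (0 < i < N)%N -> s i < ratr q < s i.+1 -> (i, q) \in b.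
pose good (b : seq (nat * rat)) := [set w | forall p, p \in b ->
  hs_norm (simple_step S p.1 w - Psi (ratr p.2) w) <= delta].
pose X n k := if unpickle k is Some b then if `[< ok n b >] then good b else set0 else set0.
have -> : [set w | step_match delta rho w] = \bigcap_n \bigcup_k X n k.
  apply/seteqP; split => w.
    move=> /step_match_finite h n _; have [s hs sm] := h n.
    pose b := [seq p <- [seq (i, odflt 0 (unpickle k)) | i <- iota 0 N, k <- iota 0 n.+1] |
      [&& (0 < p.1 < N)%N, s p.1 < ratr p.2 & (ratr p.2 < s p.1.+1)]
      && (pickle p.2 <= n)%N].
    exists (pickle b) => //; rewrite /X pickleK; case: asboolP => [_|[]].
      move=> [i q]; rewrite mem_filter /= => /andP[/andP[/and3P[iN h1 h2] qn] _].
      by apply: sm => //; rewrite h1 h2.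
    split=> [[i q]|].
      rewrite mem_filter /= => /andP[/andP[/and3P[/andP[i0 iN] h1 h2] qn] _].
      case: hs => _ _ sT _ _; split => //.
      have /andP[a1 a2] := sT i (ltnW iN); have /andP[a3 a4] := sT i.+1 iN.
      by rewrite (le_trans a1 (ltW h1)) (le_trans (ltW h2) a4).
    exists s => // i q qn iN /andP[h1 h2]; rewrite mem_filter; apply/andP; split.
      by rewrite /= iN h1 h2 qn.
    apply/allpairsP; exists (i, pickle q); rewrite pickleK; split => //.
      by rewrite mem_iota add0n; case/andP: iN.
    by rewrite mem_iota.
  move=> h; apply/step_match_finite => n; have [k _] := h n I.
  rewrite /X; case: unpickle => // b; case: asboolP => // -[_ [s hs sb]] gb.
  by exists s => // i q qn iN sq; exact: (gb (i, q) (sb i q qn iN sq)).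
apply: bigcapT_measurable => n; apply: bigcupT_measurable => k; rewrite /X.
case: unpickle => // b; case: asboolP => // -[bN _].
have -> : good b = \bigcap_(p in [set` b])
    [set w | hs_norm (simple_step S p.1 w - Psi (ratr p.2) w) <= delta].
  by apply/seteqP; split => w.
apply: fin_bigcap_measurable => // p /= /bN[h1 h2]; exact: measurable_step_dist.
Qed.

(** A time change fixes 0 and T, so the preimages of the knots form an admissible shift; its
    finitely many positive gaps have a common lower bound 1/(m+1). *)
Lemma time_change_step_match delta (lam : R -> R) w : time_change T lam ->
  (forall t, 0 <= t <= T ->
    `|lam t - t| <= delta /\ hs_norm (simple_process S (lam t) w - Psi t w) <= delta) ->
  hs_norm (simple_step S 0 w - Psi 0 w) <= delta /\ exists m, step_match delta m.+1%:R^-1 w.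
Proof.
move=> [[lamT linj lsurj] lmono] hlam.
have T0 := ltW T_gt0.
have [k0 k1 kN tS _] := hS; have N1 := nknots_gt1 T_gt0 hS.
have in0 : `[0, T]%classic (0 : R) by rewrite /= in_itv/= lexx.
have inT : `[0, T]%classic T by rewrite /= in_itv/= lexx T0.
have mono x y : 0 <= x <= T -> 0 <= y <= T -> x < y -> lam x < lam y.
  by move=> hx hy; apply: lmono; rewrite in_itv.
have lam0 : lam 0 = 0.
  have [x /= + xE] := lsurj 0 in0; rewrite in_itv/= => xT.
  have h2 : 0 <= lam 0 by have := lamT 0 in0; rewrite /= in_itv/= => /andP[].
  have [x0|x0] := eqVneq x 0; first by rewrite -[in LHS]x0.
  have := mono 0 x; rewrite lexx T0 xE lt_def x0 => /(_ isT xT).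
  by case/andP: xT => -> _ /(_ isT) h1; have := lt_le_trans h1 h2; rewrite ltxx.
have lamTT : lam T = T.
  have [x /= + xE] := lsurj T inT; rewrite in_itv/= => xT.
  have h2 : lam T <= T by have := lamT T inT; rewrite /= in_itv/= => /andP[].
  have [x0|x0] := eqVneq x T; first by rewrite -[in LHS]x0.
  have := mono x T; rewrite lexx T0 xE lt_neqAle x0 => /(_ xT isT).
  by case/andP: xT => _ -> /(_ isT) h1; have := lt_le_trans h1 h2; rewrite ltxx.
split; first by have := hlam 0; rewrite lam0 lexx T0 (simple_process0 T_gt0 hS) => /(_ isT)[].
have inv i : exists x : R, (i <= N)%N -> 0 <= x <= T /\ lam x = tk i.
  case: (leqP i N) => iN; last by exists 0.
  have [|x /= + xE] := lsurj (tk i); first by rewrite /= in_itv/= (knot_bounds T_gt0 hS).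
  by rewrite in_itv/= => xT; exists x.
have [s sP] := choice inv.
have sS i : (0 < i < N)%N -> s i < s i.+1.
  move=> iN; have [i0 iN'] := andP iN; have [a1 a2] := sP i (ltnW iN'); have [b1 b2] := sP i.+1 iN'.
  have h2 := tS i iN; rewrite -a2 -b2 in h2; rewrite ltNge le_eqVlt; apply/negP => /predU1P[h|h].
    by rewrite h ltxx in h2.
  by have := lt_trans (mono _ _ b1 a1 h) h2; rewrite ltxx.
have injE x y : 0 <= x <= T -> 0 <= y <= T -> lam x = lam y -> x = y.
  by move=> hx hy; apply: linj; rewrite inE/= in_itv.
have [m gap] : exists m, forall i, (0 < i < N)%N -> s i + m.+1%:R^-1 <= s i.+1.
  suff : forall n, exists m, forall i, (0 < i < N)%N -> (i < n)%N -> s i + m.+1%:R^-1 <= s i.+1.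
    by move=> /(_ N)[m hm]; exists m => i iN; apply: hm => //; case/andP: iN.
  elim=> [|n [m hm]]; first by exists 0%N.
  have [h|h] := ltP (s n) (s n.+1); last first.
    exists m => i iN; rewrite ltnS leq_eqVlt => /predU1P[iE|]; last exact: hm.
    by have := sS i iN; rewrite iE ltNge h.
  have [m' hm'] := ltr_add_invr h; exists (maxn m m') => i iN.
  have le a b : (a <= b)%N -> b.+1%:R^-1 <= a.+1%:R^-1 :> R by rewrite lef_pV2 ?posrE// ler_nat.
  rewrite ltnS leq_eqVlt => /predU1P[->|lin].
    by apply: le_trans (ltW hm'); rewrite lerD2l le// leq_maxr.
  by apply: le_trans (hm i iN lin); rewrite lerD2l le// leq_maxl.
exists m, s; first split=> //.
- by have [a1 a2] := sP 1%N (ltnW N1); apply: injE; rewrite ?lexx ?T0// a2 lam0 k1.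
- by have [a1 a2] := sP N (leqnn _); apply: injE; rewrite ?lexx ?T0// a2 lamTT kN.
- by move=> i /sP[].
- by move=> i /andP[_ /sP[a1 <-]]; rewrite distrC; have [] := hlam _ a1.
move=> i q iN /andP[h1 h2]; have [i0 iN'] := andP iN.
have [a1 a2] := sP i (ltnW iN'); have [b1 b2] := sP i.+1 iN'.
have qT : 0 <= (ratr q : R) <= T.
  by case/andP: a1 => a _; case/andP: b1 => _ b; rewrite (le_trans a (ltW h1)) (le_trans (ltW h2)).
have [_] := hlam _ qT; rewrite (simple_process_step T_gt0 hS w iN)//.
by rewrite -a2 -b2 mono//= ltW// mono.
Qed.

(** The interpolation from the shift to the knots is a time change. A bound at rationals just to the
    left of t passes to t by left continuity, up to an arbitrary e. *)
Lemma step_match_time_change delta rho w : 0 < rho ->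
  hs_norm (simple_step S 0 w - Psi 0 w) <= delta -> step_match delta rho w ->
  exists2 lam, time_change T lam & forall t, 0 <= t <= T ->
    `|lam t - t| <= delta /\ hs_norm (simple_process S (lam t) w - Psi t w) <= delta.
Proof.
move=> rho0 h0 [s [s1 sN sT sg sd] sm].
have T0 := ltW T_gt0.
have [k0 k1 kN tS _] := hS; have N1 := nknots_gt1 T_gt0 hS.
have sS i : (0 < i < N)%N -> s i < s i.+1.
  by move=> iN; apply: lt_le_trans (sg i iN); rewrite ltrDl.
exists (piecewise_linear s tk N); first exact: piecewise_linear_time_change.
move=> t /andP[t0 tT].
have [|j /andP[j0 jN] tj] := find_interval_closed N1 sS (x := t); first by rewrite s1 t0 sN.
split.
  by apply: (piecewise_linear_dist sS _ tj); [rewrite j0|apply: sd; rewrite j0 ltnW|apply: sd].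
(* At time 0 the process has its own value, step 0, and no left limit helps. *)
move: t0; rewrite le_eqVlt => /predU1P[<-|t0].
  have s10 : s 1%N <= 0 <= s 2 by rewrite s1 lexx -{1}s1 ltW// sS.
  have -> : piecewise_linear s tk N 0 = 0.
    by rewrite (piecewise_linearE tk sS _ s10)// k1 s1 subrr mul0r mulr0 addr0.
  by rewrite (simple_process0 T_gt0 hS).
have [|i iN ti] := @find_interval _ s N t N1; first by rewrite s1 t0 sN.
have [i0 iN'] := andP iN; have [ti1 ti2] := andP ti.
rewrite (simple_process_step T_gt0 hS w iN); last first.
  rewrite (piecewise_linear_gt sS tS iN ti)/=.
  by have /andP[] := piecewise_linear_itv sS tS iN (introT andP (conj (ltW ti1) ti2)).
have tT' : 0 < t <= T by rewrite t0.
case: aPsi => _ _ /(_ w)[/(_ t tT') lc _].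
apply/ler_addgt0Pr => e e0.
have hs1 := simple_step_hs hS w iN'.
have hP : hilbert_schmidt (Psi t w) by apply: Psi_hs; rewrite (ltW t0).
have /cvgrPdist_lt/(_ e e0) lc' := lc.
have [r r0 hr] := near_left_ex lc'.
have [|q] := @rat_in_itvoo _ (Num.max (s i) (t - r)) t; first by rewrite gt_max ti1 gtrBl.
rewrite in_itv/= gt_max => /andP[/andP[u1 q1] q2].
have qT : 0 <= (ratr q : R) <= T.
  have /andP[a _] := sT i (ltnW iN').
  by rewrite (le_trans a (ltW u1)) (le_trans (ltW q2)).
have := hs_norm_triangle sU hs1 hP (Psi_hs w qT).
have := hr (ratr q); rewrite q1 q2 => /(_ isT); rewrite sub0r normrN ger0_norm ?hs_norm_ge0//.
have := sm i q iN; rewrite u1 (lt_le_trans q2 ti2) => /(_ isT).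
lra.
Qed.

(** The infimum over time changes need not be attained, hence the slack 1/(k+1). The right side
    involves countably many conditions on [w]. *)
Lemma skorokhod_dist_le eps w :
  (skorokhod_dist T (simple_process S ^~ w) (Psi ^~ w) <= eps%:E)%E <->
  forall k, hs_norm (simple_step S 0 w - Psi 0 w) <= eps + k.+1%:R^-1 /\
    exists m, step_match (eps + k.+1%:R^-1) m.+1%:R^-1 w.
Proof.
split=> [h k|h].
  have : (skorokhod_dist T (simple_process S ^~ w) (Psi ^~ w) < (eps + k.+1%:R^-1)%:E)%E.
    by apply: le_lt_trans h _; rewrite lte_fin ltrDl.
  move=> /ereal_inf_lt[_ [lam tc <-] /ltW hl]; apply: (time_change_step_match tc) => t tT.
  have : (Num.max `|lam t - t| (hs_norm (simple_process S (lam t) w - Psi t w)) <= eps + k.+1%:R^-1).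
    rewrite -lee_fin; apply: le_trans hl; apply: ereal_sup_ubound; exists t => //.
  by rewrite ge_max => /andP[].
apply/lee_addgt0Pr => e e0; have [k ke] := ltr_add_invr e0; rewrite add0r in ke.
have [h0 [m sm]] := h k; have m0 : 0 < m.+1%:R^-1 :> R by rewrite invr_gt0.
have [lam tc hl] := step_match_time_change m0 h0 sm.
apply: ge_ereal_inf; exists (ereal_sup [set
   (Num.max `|lam t - t| (hs_norm (simple_process S (lam t) w - Psi t w)))%:E | t in `[0, T]]).
  by exists lam.
apply: ge_ereal_sup => _ [t /= + <-]; rewrite in_itv/= => /hl[h1 h2].
rewrite -EFinD lee_fin ge_max; apply/andP; split.
  by apply: le_trans h1 _; rewrite lerD2l ltW.
by apply: le_trans h2 _; rewrite lerD2l ltW.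
Qed.

Lemma measurable_skorokhod_dist eps : measurable [set w |
  (eps%:E < skorokhod_dist T (simple_process S ^~ w) (Psi ^~ w))%E].
Proof.
have -> : [set w | (eps%:E < skorokhod_dist T (simple_process S ^~ w) (Psi ^~ w))%E] =
  ~` \bigcap_k ([set w | hs_norm (simple_step S 0 w - Psi 0 w) <= eps + k.+1%:R^-1] `&`
    \bigcup_m [set w | step_match (eps + k.+1%:R^-1) m.+1%:R^-1 w]).
  rewrite -[LHS]setCK; congr (~` _); apply/seteqP; split => w.
    move=> /negP; rewrite -leNgt => /skorokhod_dist_le h k _; have [h1 [m h2]] := h k.
    by split => //; exists m.
  move=> h; apply/negP; rewrite -leNgt; apply/skorokhod_dist_le => k.
  by have [h1 [m _ h2]] := h k I; split => //; exists m.
apply: measurableC; apply: bigcapT_measurable => k; apply: measurableI.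
  apply: measurable_step_dist; last by rewrite lexx ltW.
  exact: ltn_trans (nknots_gt1 T_gt0 hS).
by apply: bigcupT_measurable => m; exact: measurable_step_match.
Qed.

End skorokhod_measurability.

(** * Paths of the integrand *)

Lemma powR_cvg (R : realType) (y : nat -> R) (a p : R) : 0 < p -> (forall n, 0 <= y n) ->
  y n @[n --> \oo] --> a -> y n `^ p @[n --> \oo] --> a `^ p.
Proof.
move=> p0 y0 ya; have a0 : 0 <= a by exact: (cvgn_ge ya).
move: a0; rewrite le_eqVlt => /predU1P[a0|a0].
  by rewrite -a0 powR0 ?gt_eqF//; apply: powR_seq_cvg0 => //; rewrite a0.
have : expR (p * ln (y n)) @[n --> \oo] --> expR (p * ln a).
  apply: continuous_cvg; first exact: continuous_expR.
  by apply: cvgMr; apply: continuous_cvg => //; exact: continuous_ln.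
rewrite {2}/powR gt_eqF//; apply: cvg_trans; apply: near_eq_cvg.
have /cvgrPdist_lt/(_ _ a0) := ya; apply: filterS => n h.
rewrite /powR gt_eqF// lt_neqAle y0 andbT; apply/eqP => yn.
by move: h; rewrite -yn subr0 ger0_norm ?ltxx ?ltW.
Qed.

(** * Real functions with left continuity and right limits *)

Section caglad_real.
Context {R : realType}.
Variables (T alpha : R) (g : R -> R).
Hypotheses (T_gt0 : 0 < T) (alpha_gt0 : 0 < alpha).
Hypothesis g_ge0 : forall t, 0 <= g t.
Hypothesis gL : forall t e, 0 < t <= T -> 0 < e ->
  exists2 r, 0 < r & forall u, 0 <= u <= T -> t - r < u < t -> `|g u - g t| < e.
Hypothesis gR : forall t, 0 <= t < T -> exists l, forall e, 0 < e ->
  exists2 r, 0 < r & forall u, 0 <= u <= T -> t < u < t + r -> `|g u - l| < e.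

(** Around each time there is an interval on either half of which [g] stays within e/2 of a
    constant. A finite subcover of [0, T] bounds [g], and its centres form [Z]. *)
Lemma caglad_oscillation e : 0 < e -> exists Z : set R, [/\ finite_set Z,
  exists M, forall u, 0 <= u <= T -> g u <= M
  & forall u, 0 <= u <= T -> ~ Z u ->
      exists2 r, 0 < r & forall v, 0 <= v <= T -> `|v - u| < r -> `|g v - g u| < e].
Proof.
move=> e0; have e2 : 0 < e / 2 by rewrite divr_gt0.
(* The triple holds a radius, the value approached on the left and the limit on the right; the
   condition on [t] sits inside so that [choice] applies. *)
have loc t : exists p : R * R * R, 0 <= t <= T -> 0 < p.1.1 /\ forall u, 0 <= u <= T ->
    (t - p.1.1 < u < t -> `|g u - p.1.2| < e / 2) /\
    (t < u < t + p.1.1 -> `|g u - p.2| < e / 2).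
  have [r1 [a [r10 h1]]] : exists r1 a, 0 < r1 /\ (0 <= t <= T -> forall u, 0 <= u <= T ->
      t - r1 < u < t -> `|g u - a| < e / 2).
    have [t0|t0] := ltP 0 t; last first.
      exists 1, 0; split => // _ u /andP[u0 _] /andP[_ ut].
      by have := le_lt_trans u0 (lt_le_trans ut t0); rewrite ltxx.
    have [tT|tT] := leP t T; last first.
      by exists 1, 0; split => //; rewrite andbF.
    by have [|r r0 h] := @gL t _ _ e2; [rewrite t0 tT|exists r, (g t)].
  have [r2 [b [r20 h2]]] : exists r2 b, 0 < r2 /\ (0 <= t <= T -> forall u, 0 <= u <= T ->
      t < u < t + r2 -> `|g u - b| < e / 2).
    have [tT|tT] := ltP t T; last first.
      exists 1, 0; split => // _ u /andP[_ uT] /andP[tu _].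
      by have := le_lt_trans tT (lt_le_trans tu uT); rewrite ltxx.
    have [t0|t0] := leP 0 t; last first.
      by exists 1, 0.
    by have [|l /(_ _ e2)[r r0 h]] := @gR t; [rewrite t0 tT|exists r, l].
  exists (Num.min r1 r2, a, b) => tT /=; split; first by rewrite lt_min r10.
  move=> u uT; split=> /andP[u1 u2].
    apply: h1 => //; rewrite u2 andbT; apply: le_lt_trans u1.
    by rewrite lerB// ge_min lexx.
  apply: h2 => //; rewrite u1; apply: lt_le_trans u2 _.
  by rewrite lerD2l ge_min lexx orbT.
have [p hp] := choice loc.
have cT : compact `[0, T]%classic by exact: segment_compact.
rewrite compact_cover in cT.
have [|t tT|D' D'T cov] := cT R `[0, T]%classic (fun t => ball t (p t).1.1).
- by move=> t tT; apply: ball_open; have [] := hp t; rewrite ?in_itv//; move: tT; rewrite /= in_itv.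
- exists t => //; apply: ballxx; have [] := hp t => //; move: tT; rewrite /= in_itv.
have /finite_seqP[s sE] := finite_fset D'; rewrite sE in cov.
have D'T' t : t \in s -> 0 <= t <= T.
  move=> ts; have : [set` s] t by [].
  by rewrite -sE => /D'T; rewrite inE/= in_itv.
have loc2 u : 0 <= u <= T -> exists2 t, t \in s & (t = u \/
   (t - (p t).1.1 < u < t \/ t < u < t + (p t).1.1)).
  move=> uT; have [|t tD] := cov u; first by rewrite /= in_itv.
  rewrite /ball/= ltr_norml => /andP[h1 h2]; exists t => //.
  have [h|h|] := ltgtP t u; last by left.
    by right; right; rewrite /=; lra.
  by right; left; rewrite andbT; lra.
exists [set` s]; split; first exact: finite_seq.
  exists (\sum_(t <- s) (`|(p t).1.2| + `|(p t).2| + `|g t|) + e) => u uT.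
  have [t tD h] := loc2 u uT; have tT := D'T' t tD; have [_ /(_ u uT)[ha hb]] := hp t tT.
  have hle : `|(p t).1.2| + `|(p t).2| + `|g t| <=
      \sum_(t <- s) (`|(p t).1.2| + `|(p t).2| + `|g t|).
    by rewrite (big_rem t)//= lerDl sumr_ge0// => i _; rewrite !addr_ge0.
  have b1 := ler_norm (p t).1.2; have b2 := ler_norm (p t).2; have b3 := ler_norm (g t).
  have c1 := normr_ge0 (p t).1.2; have c2 := normr_ge0 (p t).2; have c3 := normr_ge0 (g t).
  case: h => [<-|[/ha|/hb]]; first lra.
    by rewrite ltr_norml => /andP[_]; lra.
  by rewrite ltr_norml => /andP[_]; lra.
move=> u uT uZ; have [t tD h] := loc2 u uT; have tT := D'T' t tD; have [r0 hp'] := hp t tT.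
case: h => [tu|[/andP[h1 h2]|/andP[h1 h2]]].
- by exfalso; apply: uZ; rewrite -tu.
- exists (Num.min (u - (t - (p t).1.1)) (t - u)); first by rewrite lt_min !subr_gt0 h1 h2.
  move=> v vT; rewrite lt_min !ltr_norml => /andP[/andP[v1 v2] /andP[v3 v4]].
  have [/(_ _)  + _] := hp' u uT; rewrite h1 h2 => /(_ isT); have [+ _] := hp' v vT.
  have -> : t - (p t).1.1 < v < t by apply/andP; split; lra.
  by move=> /(_ isT); rewrite !ltr_norml => /andP[? ?] /andP[? ?]; apply/andP; split; lra.
- exists (Num.min (t + (p t).1.1 - u) (u - t)); first by rewrite lt_min !subr_gt0 h1 h2.
  move=> v vT; rewrite lt_min !ltr_norml => /andP[/andP[v1 v2] /andP[v3 v4]].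
  have [_ /(_ _) +] := hp' u uT; rewrite h1 h2 => /(_ isT); have [_ +] := hp' v vT.
  have -> : t < v < t + (p t).1.1 by apply/andP; split; lra.
  by move=> /(_ isT); rewrite !ltr_norml => /andP[? ?] /andP[? ?]; apply/andP; split; lra.
Qed.

Lemma caglad_bounded : exists M, forall u, 0 <= u <= T -> g u <= M.
Proof. by have [Z []] := caglad_oscillation ltr01. Qed.

(** Every discontinuity lies in the finite set belonging to some oscillation 1/(k+1), so the union
    of these sets is countable. *)
Lemma caglad_ae_continuous : {ae lebesgue_measure, forall u, `[0, T]%classic u ->
  forall e, 0 < e -> exists2 r, 0 < r &
    forall v, 0 <= v <= T -> `|v - u| < r -> `|g v - g u| < e}.
Proof.
have e0 k : 0 < k.+1%:R^-1 :> R by rewrite invr_gt0.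
have [Z hZ] := choice (fun k => caglad_oscillation (e0 k)).
have cZ : countable (\bigcup_k Z k).
  by apply: bigcup_countable => // k _; apply: finite_set_countable; have [] := hZ k.
exists (\bigcup_k Z k); split.
- by apply: countable_measurable.
- exact: countable_lebesgue_measure0.
move=> u /= /not_implyP[]; rewrite in_itv/= => uT h; apply: contrapT => nZ; apply: h => e eg0.
have [k ke] := ltr_add_invr eg0; rewrite add0r in ke.
have [_ _ /(_ u uT)[|r r0 hr]] := hZ k; first by move=> Zu; apply: nZ; exists k.
by exists r => // v vT vu; apply: lt_trans ke; exact: hr.
Qed.

Let delta m k : R := T * (k%:R / m.+1%:R).

(** Left end points are sampled because of left continuity. The limit shows that [g] is measurable
    in time, and its integral, a limit of finite sums of values of [g], measurable in [w]. *)
Definition left_sample (m : nat) (t : R) : R :=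
  \sum_(0 <= k < m.+1) \1_(`]delta m k, delta m k.+1]%classic) t * g (delta m k).

Let delta_lt m j k : (j < k)%N -> delta m j < delta m k.
Proof. by move=> jk; rewrite ltr_pM2l// ltr_pM2r ?invr_gt0// ltr_nat. Qed.

Let deltaT m : delta m m.+1 = T.
Proof. by rewrite /delta divff ?mulr1// pnatr_eq0. Qed.

Let delta0 m : delta m 0 = 0.
Proof. by rewrite /delta mul0r mulr0. Qed.

Let deltaS m k : delta m k.+1 - delta m k = T / m.+1%:R.
Proof. by rewrite /delta -mulrBr -mulrBl -natrB// subSnn mul1r. Qed.

Let delta_in m k : (k <= m.+1)%N -> 0 <= delta m k <= T.
Proof.
move=> km; apply/andP; split; first by rewrite mulr_ge0 ?divr_ge0 ?(ltW T_gt0).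
rewrite -[leRHS](deltaT m); move: km; rewrite leq_eqVlt => /predU1P[->//|h].
exact/ltW/delta_lt.
Qed.

Lemma left_sampleE m k t : (k < m.+1)%N -> delta m k < t <= delta m k.+1 ->
  left_sample m t = g (delta m k).
Proof.
move=> km /andP[t1 t2]; rewrite /left_sample (bigD1_seq k) ?mem_index_iota ?iota_uniq//=.
rewrite indicE mem_set ?mul1r; last by rewrite /= in_itv/= t1.
rewrite big1 ?addr0// => j jk; rewrite indicE memNset ?mul0r//= in_itv/= => /andP[h1 h2].
have le a b : (a <= b)%N -> delta m a <= delta m b.
  by rewrite leq_eqVlt => /predU1P[->//|/(delta_lt m)/ltW].
have [lt|lt|e] := ltngtP j k; last by rewrite e eqxx in jk.
  by have := lt_le_trans t1 (le_trans h2 (le _ _ lt)); rewrite ltxx.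
by have := lt_le_trans h1 (le_trans t2 (le _ _ lt)); rewrite ltxx.
Qed.

Let find_delta m t : 0 < t <= T -> exists2 k, (k < m.+1)%N & delta m k < t <= delta m k.+1.
Proof.
(* [find_interval] counts from 1, the points [delta m] from 0. *)
move=> tT; have [|[|i] iN ti] // := @find_interval _ (fun i => delta m i.-1) m.+2 t isT.
  by rewrite /= delta0 deltaT.
by exists i.
Qed.

Lemma left_sample_cvg t : 0 < t <= T -> left_sample m t @[m --> \oo] --> g t.
Proof.
move=> tT; apply/cvgrPdist_lt => e e0; have [r r0 hr] := gL tT e0.
have /cvgrPdist_lt/(_ _ r0) : T / m.+1%:R @[m --> \oo] --> (0 : R).
  by rewrite -[X in _ --> X](mulr0 T); apply: cvgMr; exact: cvg_harmonic.
apply: filterS => m; rewrite sub0r normrN ger0_norm ?divr_ge0 ?(ltW T_gt0)// => mr.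
have [k km tk] := find_delta m tT; rewrite (left_sampleE km tk) distrC; apply: hr.
  exact/delta_in/ltnW.
by move: tk mr; rewrite -(deltaS m k) => /andP[t1 t2] h; apply/andP; split; lra.
Qed.

Lemma measurable_left_sample m : measurable_fun setT (left_sample m).
Proof.
apply: measurable_sum => k; apply: measurable_funM; last exact: measurable_cst.
exact: measurable_indic.
Qed.

Lemma measurable_caglad : measurable_fun `[0, T]%classic g.
Proof.
have -> : `[0, T]%classic = [set 0] `|` `]0, T]%classic :> set R by rewrite setU1itv ?bnd_simp// ltW.
apply/measurable_funU => //; split; first exact: measurable_fun_set1.
apply: (measurable_fun_cvg (h := left_sample)).
  by move=> m; apply: measurable_funS (measurable_left_sample m).
by move=> t; rewrite /= in_itv/=; exact: left_sample_cvg.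
Qed.

Lemma caglad_mass_integrable : lebesgue_measure.-integrable `[0, T]%classic
  (EFin \o (fun u => g u `^ alpha)).
Proof.
have [M gM] := caglad_bounded.
apply: measurable_bounded_integrable => //.
- by rewrite /= lebesgue_measure_itv/= lte_fin T_gt0 ltry.
- by apply: (@measurableT_comp _ _ _ _ _ _ (@powR R ^~ alpha)); [exact: measurable_powR|exact: measurable_caglad].
exists (M `^ alpha); split; first exact: num_real.
move=> x Mx u /=; rewrite in_itv/= => uT; rewrite ger0_norm ?powR_ge0//.
apply: le_trans (ltW Mx); rewrite ge0_ler_powR ?(ltW alpha_gt0) ?nnegrE ?gM//.
exact: le_trans (gM u uT).
Qed.

(* Dominated convergence: a caglad function is continuous almost everywhere. *)
Lemma caglad_mass_cvg (G : nat -> R -> R) (e : nat -> R) (C : R) :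
  (forall n, measurable_fun `[0, T]%classic (G n)) -> (forall n u, 0 <= G n u) ->
  (forall n, e n <= C) -> e n @[n --> \oo] --> (0 : R) ->
  (forall n u, 0 < u <= T -> exists2 v, 0 <= v <= T & `|v - u| <= e n /\ `|G n u - g v| <= e n) ->
  \int[lebesgue_measure]_(u in `[0, T]) (G n u `^ alpha) @[n --> \oo] -->
  \int[lebesgue_measure]_(u in `[0, T]) (g u `^ alpha).
Proof.
move=> mG G0 e1 ec hG; have [M gM] := caglad_bounded.
have M0 : 0 <= M by apply: (le_trans (g_ge0 0)); apply: gM; rewrite lexx ltW.
have mp (f : R -> R) : measurable_fun `[0, T]%classic f ->
    measurable_fun `[0, T]%classic (EFin \o (fun u => f u `^ alpha)).
  move=> mf; apply/measurable_EFinP.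
  by apply: (@measurableT_comp _ _ _ _ _ _ (@powR R ^~ alpha)); [exact: measurable_powR|].
(* The approximation hypothesis says nothing at time 0, where [left_sample] vanishes. *)
have ne0 : {ae lebesgue_measure, forall u : R, u != 0}.
  exists [set 0]; split => //; first exact: lebesgue_measure_set1.
  by move=> u /= /negP; rewrite negbK => /eqP.
have [] := @dominated_convergence _ _ R lebesgue_measure `[0, T]%classic _
  (fun n => EFin \o (fun u => G n u `^ alpha)) (EFin \o (fun u => g u `^ alpha))
  (fun=> ((M + C) `^ alpha)%:E).
- by [].
- by move=> n; apply: mp.
- apply: mp; exact: measurable_caglad.
- have aeF := ae_filter_ringOfSetsType (@lebesgue_measure R).
  apply: filterS2 ne0 caglad_ae_continuous => u u0 h uT; have hu := h uT.
  move: uT; rewrite /= in_itv/= => uT.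
  have uT' : 0 < u <= T by rewrite lt_def u0.
  apply: cvg_EFin; first exact: nearW.
  apply: powR_cvg => //; apply/cvgrPdist_lt => eps eps0.
  have eps2 : 0 < eps / 2 by rewrite divr_gt0.
  have [r r0 hr] := hu _ eps2.
  have m0 : 0 < Num.min r (eps / 2) by rewrite lt_min r0.
  have /cvgrPdist_lt/(_ _ m0) := ec; apply: filterS => n.
  rewrite sub0r normrN lt_min => /andP[h1 h2].
  have [v vT [v1 v2]] := hG n u uT'.
  have := hr v vT (le_lt_trans v1 (le_lt_trans (ler_norm _) h1)).
  have h3 := le_lt_trans v2 (le_lt_trans (ler_norm _) h2).
  move: h3; rewrite !ltr_norml => /andP[? ?] /andP[? ?]; apply/andP; split; lra.
- apply: (@measurable_bounded_integrable _ _ _ _ (cst ((M + C) `^ alpha))) => //.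
    by rewrite /= lebesgue_measure_itv/= lte_fin T_gt0 ltry.
  exists `|(M + C) `^ alpha|; split; first exact: num_real.
  by move=> x h u _; exact: ltW.
- have aeF := ae_filter_ringOfSetsType (@lebesgue_measure R).
  apply: filterS ne0 => u u0 n; rewrite /= in_itv/= => uT.
  have uT' : 0 < u <= T by rewrite lt_def u0.
  have [v vT [_ v2]] := hG n u uT'.
  have h : G n u <= M + C.
    by have := gM v vT; have := e1 n; move: v2; rewrite ler_norml => /andP[_]; lra.
  rewrite lee_fin ger0_norm ?powR_ge0// ge0_ler_powR ?nnegrE ?(ltW alpha_gt0)//.
  exact: le_trans h.
- move=> ig _ c; apply: fine_cvg; rewrite /Rintegral fineK; first exact: c.
  exact: integrable_fin_num.
Qed.

Lemma left_sample_mass_cvg :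
  \sum_(0 <= k < m.+1) T / m.+1%:R * g (T * (k%:R / m.+1%:R)) `^ alpha @[m --> \oo] -->
  \int[lebesgue_measure]_(u in `[0, T]) (g u `^ alpha).
Proof.
have ls0 m u : 0 <= left_sample m u.
  by apply: sumr_ge0 => k _; rewrite mulr_ge0// indicE.
have -> : (fun m => \sum_(0 <= k < m.+1) T / m.+1%:R * g (T * (k%:R / m.+1%:R)) `^ alpha) =
    (fun m => \int[lebesgue_measure]_(u in `[0, T]) (left_sample m u `^ alpha)).
  apply/funext => m; pose f t := left_sample m t `^ alpha.
  have fE k t : delta m k < t <= delta m k.+1 ->
      f t = if (k < m.+1)%N then g (delta m k) `^ alpha else 0.
    move=> tk; rewrite /f; case: ltnP => km; first by rewrite (left_sampleE km tk).
    rewrite /left_sample big_nat big1 ?powR0 ?gt_eqF// => j /andP[_ jm].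
    rewrite indicE memNset ?mul0r//= in_itv/= => /andP[_ h].
    have jk : delta m j.+1 <= delta m k.
      have := leq_trans jm km; rewrite leq_eqVlt => /predU1P[->//|/(delta_lt m)/ltW//].
    by case/andP: tk => /(le_lt_trans jk)/(le_lt_trans h); rewrite ltxx.
  have dS k : delta m k < delta m k.+1 by exact: delta_lt.
  have [|||_] := @integral_step _ f (delta m) m.+1.
  - by move=> k; exact: ltW.
  - by move=> t; exact: powR_ge0.
  - by move=> k t h; rewrite (fE k t h) (fE k) ?lexx ?dS.
  rewrite delta0 deltaT /Rintegral => ->; rewrite /= big_nat [RHS]big_nat.
  by apply: eq_bigr => k /andP[_ km]; rewrite deltaS (fE k) ?lexx ?dS// km.
apply: (@caglad_mass_cvg _ (fun m => T / m.+1%:R) T).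
- by move=> m; apply: measurable_funS (measurable_left_sample m).
- exact: ls0.
- by move=> m; rewrite ler_pdivrMr// ler_peMr ?(ltW T_gt0)// ler1n.
- by rewrite -[X in _ --> X](mulr0 T); apply: cvgMr; exact: cvg_harmonic.
move=> m u uT; have [k km tk] := find_delta m uT; exists (delta m k); first exact/delta_in/ltnW.
rewrite (left_sampleE km tk) subrr normr0 divr_ge0 ?(ltW T_gt0)//; split => //.
move: tk; rewrite -(deltaS m k) => /andP[t1 t2].
by rewrite ler0_norm ?subr_le0 ?(ltW t1)//; lra.
Qed.

End caglad_real.

Section alpha_mass.
Context {R : realType} {d : measure_display} {Omega : measurableType d} {U H : hilbertType R}.
Variables (F : R -> set (set Omega)) (alpha T : R).
Hypotheses (alpha_gt0 : 0 < alpha) (T_gt0 : 0 < T) (sU : separable U).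
Hypothesis Ff : filtration F.
Variable Psi : R -> Omega -> U -> H.
Hypothesis aPsi : admissible F T Psi.

Lemma measurable_hs_norm t : 0 <= t <= T -> measurable_fun setT (fun w => hs_norm (Psi t w)).
Proof.
move=> tT; have t0 : 0 <= t by case/andP: tT.
apply: (measurability _ (RGenOInfty.measurableE R)) => _ [_ [x ->] <-]; rewrite setTI.
have -> : (fun w => hs_norm (Psi t w)) @^-1` `]x, +oo[%classic =
    ~` [set w | hs_norm (0 - Psi t w) <= x].
  apply/seteqP; split => w /=; rewrite in_itv/= andbT sub0r hs_normN.
    by move=> h; apply/negP; rewrite -ltNge.
  by move/negP; rewrite -ltNge.
apply: measurableC; apply: (filt_meas Ff t0).
by apply: (measurable_hs_dist sU Ff aPsi) => //; exact: hs_zero.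
Qed.

Let gL w t e : 0 < t <= T -> 0 < e -> exists2 r, 0 < r & forall u, 0 <= u <= T ->
  t - r < u < t -> `|hs_norm (Psi u w) - hs_norm (Psi t w)| < e.
Proof.
move=> tT e0; case: (aPsi) => hPsi _ /(_ w)[/(_ t tT) lc _].
have /cvgrPdist_lt/(_ e e0)/near_left_ex[r r0 hr] := lc.
exists r => // u uT /hr; rewrite sub0r normrN ger0_norm ?hs_norm_ge0//.
apply: le_lt_trans; apply: hs_dist_norm => //; apply: hPsi => //.
by case/andP: tT => /ltW -> ->.
Qed.

Let gR w t : 0 <= t < T -> exists l, forall e, 0 < e -> exists2 r, 0 < r & forall u, 0 <= u <= T ->
  t < u < t + r -> `|hs_norm (Psi u w) - l| < e.
Proof.
move=> tT; case: (aPsi) => hPsi _ /(_ w)[_ /(_ t tT)[l hl lc]].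
exists (hs_norm l) => e e0.
have /cvgrPdist_lt/(_ e e0)/near_right_ex[r r0 hr] := lc.
exists r => // u uT /hr; rewrite sub0r normrN ger0_norm ?hs_norm_ge0//.
by apply: le_lt_trans; apply: hs_dist_norm => //; apply: hPsi.
Qed.

Let g0 w t : 0 <= hs_norm (Psi t w). Proof. exact: hs_norm_ge0. Qed.

Lemma measurable_alpha_mass : measurable_fun setT (alpha_mass alpha T Psi).
Proof.
apply: (measurable_fun_cvg (h := fun m w => \sum_(k <- index_iota 0 m.+1)
    T / m.+1%:R * hs_norm (Psi (T * (k%:R / m.+1%:R)) w) `^ alpha)); last first.
  by move=> w _; exact: (left_sample_mass_cvg T_gt0 alpha_gt0 (g0 w) (@gL w) (@gR w)).
move=> m; under eq_fun do rewrite big_seq big_mkcond.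
apply: measurable_sum => k; have [|_] := boolP (k \in _); last exact: measurable_cst.
rewrite mem_index_iota => /andP[_ km]; apply: measurable_funM; first exact: measurable_cst.
apply: (@measurableT_comp _ _ _ _ _ _ (@powR R ^~ alpha)); first exact: measurable_powR.
apply: measurable_hs_norm; rewrite mulr_ge0 ?divr_ge0 ?(ltW T_gt0)//=.
by rewrite ler_piMr ?(ltW T_gt0)// ler_pdivrMr// mul1r ler_nat ltnW.
Qed.

Lemma alpha_massE w : (\int[lebesgue_measure]_(s in `[0%R, T]) (hs_norm (Psi s w) `^ alpha)%:E =
  (alpha_mass alpha T Psi w)%:E)%E.
Proof.
rewrite /alpha_mass /Rintegral fineK//; apply: integrable_fin_num => //.
exact: (caglad_mass_integrable T_gt0 alpha_gt0 (g0 w) (@gL w) (@gR w)).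
Qed.

(** A time change within [e n] of optimal gives for every u a time v with [lam v = u], close to u,
    at which the norms differ by at most [e n]; this is the hypothesis of [caglad_mass_cvg]. *)
Lemma alpha_mass_cvg (S : nat -> @simple_integrand R d Omega U H) (e : nat -> R) w :
  (forall n, simple_on F T (S n)) -> (forall n, e n <= 1) -> e n @[n --> \oo] --> (0 : R) ->
  (forall n, (skorokhod_dist T (simple_process (S n) ^~ w) (Psi ^~ w) < (e n)%:E)%E) ->
  alpha_mass alpha T (simple_process (S n)) w @[n --> \oo] --> alpha_mass alpha T Psi w.
Proof.
move=> hS e1 ec hd.
apply: (@caglad_mass_cvg _ T alpha (fun t => hs_norm (Psi t w)) T_gt0 alpha_gt0 (g0 w) (@gL w) (@gR w)
  (fun n u => hs_norm (simple_process (S n) u w)) e 1) => //.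
- by move=> n; exact: (measurable_simple_path T_gt0 (hS n)).
- by move=> n u; exact: hs_norm_ge0.
move=> n u /andP[u0 uT]; have /ereal_inf_lt[_ [lam [[lamT _ lsurj] _] <-] /ltW hl] := hd n.
have [|v vT vu] := lsurj u; first by rewrite /= in_itv/= ltW.
move: (vT); rewrite /= in_itv/= => vT'; exists v => //.
have : (Num.max `|lam v - v| (hs_norm (simple_process (S n) (lam v) w - Psi v w)) <= e n).
  by rewrite -lee_fin; apply: le_trans hl; apply: ereal_sup_ubound; exists v.
rewrite ge_max vu => /andP[h1 h2]; split; first by rewrite distrC.
apply: le_trans h2; apply: hs_dist_norm => //; last by case: aPsi => h _ _; exact: h.
by apply: (simple_process_hs T_gt0 (hS n)); rewrite (ltW u0).
Qed.

End alpha_mass.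

(** * Passage to the limit *)

(** Multiplying by the indicator of the complement of [N] makes the convergence hold everywhere
    without changing the expectations. *)
Lemma Ex_cvg_ae (R : realType) (d : measure_display) (Omega : measurableType d)
    (P : probability Omega R) (N : set Omega) (F : nat -> Omega -> R) (f : Omega -> R) (M : R) :
  measurable N -> P N = 0%E -> measurable_fun setT f -> (forall w, `|f w| <= M) ->
  (forall n, measurable_fun setT (F n)) -> (forall n w, `|F n w| <= M) ->
  (forall w, ~ N w -> F n w @[n --> \oo] --> f w) ->
  Ex P (F n) @[n --> \oo] --> Ex P f.
Proof.
move=> mN PN mf fM mF FM Ff; pose c := \1_(~` N) : Omega -> R.
have mc : measurable_fun setT c by apply: measurable_indic; exact: measurableC.
have c1 w : `|c w| <= 1 by rewrite /c indicE; case: (_ \in _); rewrite ?normr1 ?normr0.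
have aec g : {ae P, forall w, g w = c w * g w}.
  exists N; split => // w /= h; apply: contrapT => Nw; apply: h.
  by rewrite /c indicE mem_set// mul1r.
have bc (g : Omega -> R) : measurable_fun setT g -> (forall w, `|g w| <= M) ->
    bounded_measurable g /\ bounded_measurable (fun w => c w * g w).
  move=> mg gM; have bg : bounded_measurable g by split => //; exists M.
  by split => //; apply: bmM => //; split => //; exists 1.
have [bf bcf] := bc f mf fM.
rewrite (Ex_ae_eq bf bcf (aec f)).
have -> : (fun n => Ex P (F n)) = (fun n => Ex P (fun w => c w * F n w)).
  by apply/funext => n; have [b1 b2] := bc _ (mF n) (FM n); exact: (Ex_ae_eq b1 b2 (aec (F n))).
apply: (@Ex_cvg _ _ _ _ _ _ M).
- by move=> n; exact: measurable_funM.
- move=> n w; rewrite normrM; apply: le_trans (FM n w).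
  by rewrite ler_piMl.
- move=> w; rewrite /c indicE; case: (boolP (w \in _)) => [/set_mem Nw|_].
    by rewrite mul1r; under eq_fun do rewrite mul1r; exact: Ff.
  by rewrite mul0r; under eq_fun do rewrite mul0r; exact: cvg_cst.
Qed.

Lemma sum_seq_cvg0 (R : realType) (I : eqType) (r : seq I) (u : I -> nat -> R) :
  (forall i, i \in r -> u i n @[n --> \oo] --> (0 : R)) ->
  \sum_(i <- r) u i n @[n --> \oo] --> (0 : R).
Proof.
elim: r => [_|i r IH h]; first by under eq_fun do rewrite big_nil; exact: cvg_cst.
have -> : (fun n => \sum_(j <- i :: r) u j n) = (fun n => u i n + \sum_(j <- r) u j n).
  by apply/funext => n; rewrite big_cons.
rewrite -[in X in _ --> X](addr0 (0 : R)); apply: cvgD.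
  by apply: h; rewrite mem_head.
by apply: IH => j jr; apply: h; rewrite inE jr orbT.
Qed.

Section tail_estimate.
Context {R : realType} {d : measure_display} {Omega : measurableType d} {U H : hilbertType R}.
Variables (P : probability Omega R) (F : R -> set (set Omega)) (L : R -> U -> Omega -> R).
Variables (alpha T : R).
Hypotheses (alpha_gt0 : 0 < alpha) (alpha_lt2 : alpha < 2) (T_gt0 : 0 < T).
Hypotheses (sU : separable U) (sH : separable H).
Hypotheses (Ff : filtration F) (Ls : canonical_stable P F alpha L).
Variables (Psi : R -> Omega -> U -> H) (I : R -> Omega -> H).
Hypotheses (aPsi : admissible F T Psi) (hI : stochastic_integral P F L T Psi I).

Local Notation SI := (simple_integral P F L).
Local Notation mass := (alpha_mass alpha T).

(** A subsequence along which the Skorokhod distance exceeds 1/(k+1) with probability at most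
    2^-(k+1). By Borel-Cantelli the distance tends to 0 off a null set, and the masses follow. *)
Lemma fast_approx : exists (S : nat -> simple_integrand) (N : set Omega),
  [/\ simple_approx P F T S Psi, measurable N, P N = 0%E
  & forall w, ~ N w -> mass (simple_process (S n)) w @[n --> \oo] --> mass Psi w].
Proof.
case: hI => _ _ [S [hS cS]] _.
pose E k n := [set w | ((k.+1%:R^-1)%:E <
  skorokhod_dist T (simple_process (S n) ^~ w) (Psi ^~ w))%E].
have mE k n : measurable (E k n) by exact: (measurable_skorokhod_dist T_gt0 sU Ff aPsi (hS n)).
have hn k : exists n, (k <= n)%N /\ (P (E k n) <= ((2 ^ k.+1)%:R^-1)%:E)%E.
  have k0 : 0 < k.+1%:R^-1 :> R by rewrite invr_gt0.
  have e0 : 0 < (2 ^ k.+1)%:R^-1 :> R by rewrite invr_gt0 ltr0n expn_gt0.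
  have := cS _ k0 => /fine_cvgP[_ /cvgrPdist_le/(_ _ e0)] h.
  have [n [kn hn]] : exists n, (k <= n)%N /\ `|0 - fine (P (E k n))| <= (2 ^ k.+1)%:R^-1.
    by case: h => m _ hm; exists (maxn k m); split; [exact: leq_maxl|apply: hm; exact: leq_maxr].
  exists n; split => //; move: hn; rewrite sub0r normrN ger0_norm ?fine_ge0//.
  by rewrite -lee_fin fineK// fin_num_measure.
have [n hn'] := choice hn.
have nk k : (k <= n k)%N by have [] := hn' k.
exists (S \o n), (lim_sup_set (fun k => E k (n k))); split.
- split=> [k|e e0]; first exact: hS.
  have noo : n k @[k --> \oo] --> \oo.
    by move=> A [m _ hA]; exists m => // k /= mk; apply: hA => /=; exact: leq_trans (nk k).
  exact: (cvg_comp _ _ noo (cS e e0)).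
- by apply: bigcapT_measurable => k; apply: bigcup_measurable.
- by apply: borel_cantelli_dyadic => // k; have [] := hn' k.
move=> w hw; have [m hm] := not_lim_sup_set hw.
(* The factor 2 below makes the bound on the distance strict, and shifting by [m.+1] instead of [m]
   keeps 2/(k+m+2) at most 1. *)
rewrite -(cvg_shiftn m.+1).
apply: (@alpha_mass_cvg _ _ _ _ _ F alpha T alpha_gt0 T_gt0 sU Psi aPsi
  (fun k => S (n (k + m.+1)%N)) (fun k => 2 / (k + m.+1).+1%:R)).
- by move=> k; exact: hS.
- by move=> k; rewrite ler_pdivrMr// mul1r ler_nat addnS.
- rewrite -[X in _ --> X](mulr0 2); apply: cvgMr.
  by rewrite (cvg_shiftn m.+1 (fun k => k.+1%:R^-1 : R)); exact: cvg_harmonic.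
move=> k; have /negP := hm (k + m.+1)%N (leq_trans (leqnSn m) (leq_addl _ _)).
rewrite -leNgt => /le_lt_trans; apply.
by rewrite lte_fin ltr_pMl ?ltr1n// invr_gt0.
Qed.

Let mP := sigma_algebra_measurable Omega.

Lemma integral_weak_meas t : 0 <= t <= T -> weak_meas_in measurable (I t).
Proof. by move=> tT; case: hI => h _ _ _; apply: borel_weak; exact: h. Qed.

Lemma measurable_max_gt (D : seq R) r : {in D, forall t, 0 <= t <= T} ->
  measurable [set w | exists2 t, t \in D & r < `|I t w|].
Proof.
move=> DT; rewrite (_ : [set w | _] = \bigcup_(t in [set` D]) [set w | r < `|I t w|]).
  apply: fin_bigcup_measurable => // t /= /DT tT.
  exact: (weak_norm_gt sH r mP (integral_weak_meas tT)).
by apply/seteqP; split => w [t h1 h2]; exists t.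
Qed.

(** The indicator of mass > K is not continuous in the mass; it is replaced by a ramp [phi] rising
    from K - 1 to K, whence the K - 1 on the right. The margin [eta] absorbs the convergence in
    probability at the finitely many times of [D]. *)
Lemma finite_max_tail (D : seq R) lam r eta K : {in D, forall t, 0 <= t <= T} ->
  0 <= lam -> 0 <= r -> 0 < eta -> 0 <= K ->
  (1 - expR (- (lam * r ^+ 2))) * fine (P [set w | exists2 t, t \in D & r + eta < `|I t w|]) <=
  (1 - expR (- (lam * r ^+ 2))) * fine (P [set w | K - 1 < mass Psi w]) +
    (2 * lam) `^ (alpha / 2) * Ex P (fun w => Num.min (mass Psi w) K).
Proof.
move=> DT lam0 r0 eta0 K0; have [S [N [aS mN PN massS]]] := fast_approx.
have hS n : simple_on F T (S n) by case: aS.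
have cI t : 0 <= t <= T -> P [set w | eta < `|SI (S n) t w - I t w|] @[n --> \oo] --> 0%E.
  by case: hI => _ _ _ h tT; exact: h.
set c := 1 - _; set B := _ `^ _.
have c0 : 0 <= c by rewrite subr_ge0 -[leRHS]expR0 ler_expR oppr_le0 mulr_ge0 ?sqr_ge0.
have mmass := measurable_alpha_mass alpha_gt0 T_gt0 sU Ff aPsi.
have bmS n := simple_mass_bm alpha T_gt0 Ff (hS n).
pose phi (x : R) : R := clamp (x - K + 1).
have phi_cont : continuous phi.
  move=> x; apply: (@continuous_comp _ _ _ (fun x => x - K + 1) clamp).
    by apply: continuousD; [apply: continuousB => //; exact: cvg_cst|exact: cvg_cst].
  rewrite /clamp; apply: continuous_max; first exact: cvg_cst.
  by apply: continuous_min => //; exact: cvg_cst.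
have phi01 x : 0 <= phi x <= 1.
  by rewrite /phi /clamp le_max lexx/= ge_max ler01 ge_min lexx.
have phiN x : `|phi x| <= 1 by have /andP[h1 h2] := phi01 x; rewrite ger0_norm.
pose mn (x : R) : R := Num.min x K.
have mn_cont : continuous mn by move=> x; apply: continuous_min => //; exact: cvg_cst.
have mn01 (Q : R -> Omega -> U -> H) w : 0 <= mn (mass Q w) <= K.
  by rewrite /mn le_min alpha_mass_ge0 K0 ge_min lexx orbT.
have mnN (Q : R -> Omega -> U -> H) w : `|mn (mass Q w)| <= K by have /andP[h1 h2] := mn01 Q w; rewrite ger0_norm.
have mphi (f : Omega -> R) : measurable_fun setT f -> measurable_fun setT (fun w => phi (f w)).
  by move=> mf; exact: (measurable_fun_continuous phi_cont mf).
have mmn (f : Omega -> R) : measurable_fun setT f -> measurable_fun setT (fun w => mn (f w)).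
  by move=> mf; exact: (measurable_fun_continuous mn_cont mf).
have c1 : Ex P (fun w => phi (mass (simple_process (S n)) w)) @[n --> \oo] -->
    Ex P (fun w => phi (mass Psi w)).
  apply: (Ex_cvg_ae mN PN (M := 1)) => //.
  - exact: (mphi _ mmass).
  - by move=> n; exact: (mphi _ (bmS n).1).
  - by move=> w Nw; apply: continuous_cvg; [exact: phi_cont|exact: massS].
have c2 : Ex P (fun w => mn (mass (simple_process (S n)) w)) @[n --> \oo] -->
    Ex P (fun w => mn (mass Psi w)).
  apply: (Ex_cvg_ae mN PN (M := K)) => //.
  - exact: (mmn _ mmass).
  - by move=> n; exact: (mmn _ (bmS n).1).
  - by move=> w Nw; apply: continuous_cvg; [exact: mn_cont|exact: massS].
have mdiff n t : 0 <= t <= T -> measurable [set w | eta < `|SI (S n) t w - I t w|].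
  move=> tT; have t0 : 0 <= t by case/andP: tT.
  apply: (@weak_norm_gt _ _ _ _ sH measurable (fun w => SI (S n) t w - I t w)) => //.
  apply: weak_measB; last exact: integral_weak_meas.
  move=> h; apply: (meas_in_sub (filt_sigma Ff t0) (filt_meas Ff t0)).
  by apply: (simple_integral_weak alpha_gt0 alpha_lt2 T_gt0 sU sH Ff Ls (hS n)).
have c3 : \sum_(t <- D) fine (P [set w | eta < `|SI (S n) t w - I t w|]) @[n --> \oo] --> (0 : R).
  apply: sum_seq_cvg0 => t tD.
  by have /fine_cvgP[] := cI t (DT t tD).
have mI := measurable_max_gt (r + eta) DT.
apply: (@le_trans _ _ (c * Ex P (fun w => phi (mass Psi w)) + B * Ex P (fun w => mn (mass Psi w)))).
  apply: (cvgn_ge (u := fun n => c * (Ex P (fun w => phi (mass (simple_process (S n)) w)) +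
   \sum_(t <- D) fine (P [set w | eta < `|SI (S n) t w - I t w|])) +
   B * Ex P (fun w => mn (mass (simple_process (S n)) w)))).
    apply: cvgD; last exact: cvgMr.
    by apply: cvgMr; rewrite -[X in _ --> X]addr0; exact: cvgD.
  move=> n; have mS := simple_exceed_measurable alpha_gt0 alpha_lt2 T_gt0 sU sH Ff Ls (hS n) r DT.
  have bphi : bounded_measurable (fun w => phi (mass (simple_process (S n)) w)).
    by split; [exact: (mphi _ (bmS n).1)|exists 1].
  have mK : measurable [set w | K < mass (simple_process (S n)) w].
    rewrite (_ : [set w | _] = mass (simple_process (S n)) @^-1` `]K, +oo[%classic).
      by rewrite -[X in measurable X]setTI; apply: (bmS n).1.
    by apply/seteqP; split => w; rewrite /= in_itv/= andbT.
  have h1 := simple_maximal alpha_gt0 alpha_lt2 T_gt0 sU sH Ff Ls (hS n) DT lam0 r0 K0.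
  have h2 : fine (P [set w | K < mass (simple_process (S n)) w]) <=
      Ex P (fun w => phi (mass (simple_process (S n)) w)).
    rewrite -Ex_indic//; apply: Ex_le => // [|w]; first exact: bm_indic.
    rewrite indicE; case: (boolP (w \in _)) => [/set_mem/= Kw|_]; last by have /andP[] := phi01 (mass (simple_process (S n)) w).
    by rewrite /phi clamp1//; lra.
  have h3 : fine (P [set w | exists2 t, t \in D & r + eta < `|I t w|]) <=
      fine (P [set w | exists2 t, t \in D & r < `|SI (S n) t w|]) +
      \sum_(t <- D) fine (P [set w | eta < `|SI (S n) t w - I t w|]).
    pose Y t := if t \in D then [set w | eta < `|SI (S n) t w - I t w|] else set0.
    have mY t : measurable (Y t) by rewrite /Y; case: ifP => // /DT; exact: mdiff.
    rewrite big_seq (eq_bigr (fun t => Ex P (\1_(Y t)))); last first.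
      by move=> t tD; rewrite Ex_indic// /Y tD.
    rewrite -big_seq -Ex_sum; last by move=> t; exact: bm_indic.
    have bY : bounded_measurable (fun w => \sum_(t <- D) \1_(Y t) w : R).
      by apply: bm_sum => t; exact: bm_indic.
    rewrite -!Ex_indic// -ExD//; last exact: bm_indic.
    apply: Ex_le; [exact: bm_indic|by apply: bmD => //; exact: bm_indic|move=> w].
    have Y0 : 0 <= \sum_(t <- D) \1_(Y t) w :> R by apply: sumr_ge0 => t _; rewrite indicE.
    rewrite [leLHS]indicE; case: (boolP (w \in _)) => [/set_mem/= [t tD tw]|_]; last first.
      by rewrite addr_ge0// indicE.
    have [hr|hr] := ltP r `|SI (S n) t w|.
      by rewrite indicE mem_set ?lerDl//=; exists t.
    apply: (@le_trans _ _ (\sum_(t <- D) \1_(Y t) w)); last by rewrite lerDr indicE.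
    have Yw : Y t w.
      rewrite /Y tD /=; have := ler_normB (SI (S n) t w) (SI (S n) t w - I t w).
      by rewrite subKr; lra.
    rewrite (big_rem t tD) /= indicE mem_set// lerDl sumr_ge0// => i _.
  apply: le_trans (ler_wpM2l c0 h3) _; rewrite mulrDr mulrDr.
  have := ler_wpM2l c0 h2; move: h1; rewrite -/c -/B; lra.
rewrite lerD2r ler_wpM2l//.
have mK : measurable [set w | K - 1 < mass Psi w].
  rewrite (_ : [set w | _] = mass Psi @^-1` `]K - 1, +oo[%classic).
    by rewrite -[X in measurable X]setTI; apply: mmass.
  by apply/seteqP; split => w; rewrite /= in_itv/= andbT.
rewrite -Ex_indic//; apply: Ex_le => [||w]; [|exact: bm_indic|].
  by split; [exact: (mphi _ mmass)|exists 1].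
rewrite indicE; case: (boolP (w \in _)) => [_|/negP h]; first by have /andP[] := phi01 (mass Psi w).
rewrite /phi clamp0// leNgt; apply/negP => h'; apply: h; apply/mem_set => /=; lra.
Qed.

(** Take K = n + 2 and let n grow: Markov's inequality for the truncated mass bounds the remaining
    tail by J/(n+1). *)
Lemma max_tail (D : seq R) lam r eta (J : R) : {in D, forall t, 0 <= t <= T} ->
  0 <= lam -> 0 <= r -> 0 < eta -> (\int[P]_w (mass Psi w)%:E = J%:E)%E ->
  (1 - expR (- (lam * r ^+ 2))) * fine (P [set w | exists2 t, t \in D & r + eta < `|I t w|]) <=
  (2 * lam) `^ (alpha / 2) * J.
Proof.
move=> DT lam0 r0 eta0 EJ; set c := 1 - _; set B := _ `^ _; set p := fine _.
have c0 : 0 <= c by rewrite subr_ge0 -[leRHS]expR0 ler_expR oppr_le0 mulr_ge0 ?sqr_ge0.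
have B0 : 0 <= B by exact: powR_ge0.
have mmass := measurable_alpha_mass alpha_gt0 T_gt0 sU Ff aPsi.
have bmin (K : R) : 0 <= K -> bounded_measurable (fun w => Num.min (mass Psi w) K).
  move=> K0; split; first by apply: measurable_minr => //; exact: measurable_cst.
  by exists K => w; rewrite ger0_norm ?le_min ?alpha_mass_ge0// ge_min lexx orbT.
have hmin (K : R) : 0 <= K -> Ex P (fun w => Num.min (mass Psi w) K) <= J.
  move=> K0; rewrite -lee_fin -EJ -(ExE P (bmin K K0)); apply: ge0_le_integral => //.
  - by move=> w _; rewrite lee_fin le_min alpha_mass_ge0.
  - by apply/measurable_EFinP; exact: (bmin K K0).1.
  - exact/measurable_EFinP.
  - by move=> w _; rewrite lee_fin ge_min lexx.
have J0 : 0 <= J by apply: le_trans (hmin 0 (lexx _)); apply: Ex_ge0 => w; rewrite le_min alpha_mass_ge0 lexx.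
have tailK (n : nat) : n.+1%:R * fine (P [set w | n.+2%:R - 1 < mass Psi w]) <= J.
  have mK : measurable [set w | n.+2%:R - 1 < mass Psi w].
    rewrite (_ : [set w | _] = mass Psi @^-1` `]n.+2%:R - 1, +oo[%classic).
      by rewrite -[X in measurable X]setTI; apply: mmass.
    by apply/seteqP; split => w; rewrite /= in_itv/= andbT.
  apply: le_trans (hmin n.+2%:R _) => //.
  rewrite -Ex_indic// -ExZ; last exact: bm_indic.
  apply: Ex_le; [by apply: bmZ; exact: bm_indic|exact: bmin|move=> w].
  rewrite indicE; case: (boolP (w \in _)) => [/set_mem/= h|_]; last by rewrite mulr0 le_min alpha_mass_ge0/=.
  have h1 : n.+2%:R = n.+1%:R + 1 :> R by rewrite -natr1.
  by rewrite mulr1 le_min; move: h; rewrite h1; lra.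
have key n : c * p <= c * (J / n.+1%:R) + B * J.
  have h := finite_max_tail DT lam0 r0 eta0 (ler0n R n.+2).
  apply: le_trans h _; apply: lerD; last by rewrite ler_wpM2l// hmin.
  by rewrite ler_wpM2l// ler_pdivlMr// mulrC.
apply: (cvgn_ge (u := fun n => c * (J / n.+1%:R) + B * J)) => //.
rewrite -[X in _ --> X]add0r; apply: cvgD; last exact: cvg_cst.
rewrite -(mulr0 c) -(mulr0 J); apply: cvgMr; apply: cvgMr; exact: cvg_harmonic.
Qed.

(** By right continuity a strict exceedance is already seen at a rational time or at [T]. The
    threshold r + 1/(n+1) provides the margin that [max_tail] requires and makes the events increase
    to the full one. *)
Lemma sup_tail lam r (J : R) : 0 <= lam -> 0 <= r -> (\int[P]_w (mass Psi w)%:E = J%:E)%E ->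
  ((1 - expR (- (lam * r ^+ 2)))%:E *
    P [set w | r%:E < ereal_sup [set `|I t w|%:E | t in `[0%R, T]]] <=
    ((2 * lam) `^ (alpha / 2) * J)%:E)%E.
Proof.
move=> lam0 r0 EJ; set E := [set w | _%E].
pose rat_of k : R := ratr (odflt 0 (unpickle k)).
(* [T] is listed separately, since there is no right continuity to use at [T]. *)
pose D n : seq R := T :: [seq t <- [seq rat_of k | k <- iota 0 n] | 0 <= t <= T].
have DT n : {in D n, forall t, 0 <= t <= T}.
  by move=> t; rewrite inE mem_filter => /predU1P[->|/andP[]//]; rewrite lexx ltW.
have Dmono n m : (n <= m)%N -> {subset D n <= D m}.
  move=> nm t; rewrite !inE !mem_filter => /predU1P[->|/andP[-> /mapP[k]]]; first by rewrite eqxx.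
  rewrite mem_iota add0n => /andP[_ kn] ->; apply/orP; right; rewrite /=.
  by apply: map_f; rewrite mem_iota/= add0n (leq_trans kn).
pose En n := [set w | exists2 t, t \in D n & r + n.+1%:R^-1 < `|I t w|].
have mE n : measurable (En n) by exact: measurable_max_gt (DT n).
have invle n m : (n <= m)%N -> m.+1%:R^-1 <= n.+1%:R^-1 :> R.
  by move=> nm; rewrite lef_pV2 ?posrE// ler_nat.
have Emono : nondecreasing_seq En.
  move=> n m nm; rewrite subsetEset => w [t tD tw]; exists t; first exact: (Dmono n m nm).
  by apply: le_lt_trans tw; rewrite lerD2l invle.
have EE : E = \bigcup_n En n.
  apply/seteqP; split => w; last first.
    move=> [n _ [t tD tw]]; rewrite /E /=.
    apply: (@lt_le_trans _ _ `|I t w|%:E).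
      by rewrite lte_fin; apply: le_lt_trans tw; rewrite lerDl.
    by apply: ereal_sup_ubound; exists t => //=; rewrite in_itv/=; exact: DT tD.
  move=> /ereal_sup_gt[_ [t /= + <-]]; rewrite in_itv/= lte_fin => /andP[t0 tT] rt.
  have [m hm] := ltr_add_invr rt.
  move: tT; rewrite le_eqVlt => /predU1P[tE|tT].
    by exists m => //; exists t => //; rewrite tE mem_head.
  have [_ /(_ w)[/(_ t) cR _] _ _] := hI.
  have : `|I s w| @[s --> t^'+] --> `|I t w| by apply: cvg_norm; apply: cR; rewrite t0.
  move=> /cvgrPdist_lt/(_ (`|I t w| - (r + m.+1%:R^-1))); rewrite subr_gt0 => /(_ hm).
  move=> /near_right_ex[e e0 he].
  have [|q] := @rat_in_itvoo _ t (Num.min T (t + e)); first by rewrite lt_min tT ltrDl.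
  rewrite in_itv/= lt_min => /and3P[tq qT qe].
  have := he (ratr q); rewrite tq qe => /(_ isT); rewrite ltr_norml => /andP[_ hq].
  exists (maxn m (pickle q).+1) => //; exists (ratr q).
    rewrite inE mem_filter (le_trans t0 (ltW tq)) (ltW qT); apply/orP; right; rewrite /=.
    have -> : ratr q = rat_of (pickle q) by rewrite /rat_of pickleK.
    by apply: map_f; rewrite mem_iota/= add0n leq_maxr.
  apply: (@le_lt_trans _ _ (r + m.+1%:R^-1)); first by rewrite lerD2l invle// leq_maxl.
  by move: hq; rewrite ltrD2l ltrN2.
have cE : P (En n) @[n --> \oo] --> P E.
  rewrite EE; apply: (nondecreasing_cvg_mu (mu := P)) => //.
  exact: bigcupT_measurable.
have mEE : measurable E by rewrite EE; exact: bigcupT_measurable.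
have /fine_cvgP[_ cE'] : P (En n) @[n --> \oo] --> (fine (P E))%:E.
  by rewrite fineK// fin_num_measure.
rewrite -(fineK (fin_num_measure P E mEE)) -EFinM lee_fin.
apply: (cvgn_le (u := fun n => (1 - expR (- (lam * r ^+ 2))) * fine (P (En n)))).
  exact: cvgMr cE'.
by move=> n; apply: (max_tail (DT n) lam0 r0 _ EJ); rewrite invr_gt0.
Qed.

End tail_estimate.

(** * The tail constant is at least 1 *)

Section characteristic_function.
Context {R : realType} {d : measure_display} {Omega : measurableType d}.
Variables (P : probability Omega R) (X Y : Omega -> R).
Hypotheses (mX : measurable_fun setT X) (mY : measurable_fun setT Y).
Hypothesis cosE : forall s, Ex P (fun w => cos (s * X w)) = Ex P (fun w => cos (s * Y w)).
Hypothesis sinE : forall s, Ex P (fun w => sin (s * X w)) = Ex P (fun w => sin (s * Y w)).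
Implicit Types (f g : R -> R) (Z : Omega -> R) (M s t a x y : R).

(* The class of these g is stable under multiplication by harmonics and under
   bounded pointwise limits; the limits produce Gaussians, then indicators of
   intervals (level sets of Gaussians), then of rays. *)
Let test (g : R -> R) := [/\ measurable_fun setT g, exists M : R, forall x, `|g x| <= M
  & forall s t, Ex P (fun w => g (X w) * cos (s * X w + t)) =
                Ex P (fun w => g (Y w) * cos (s * Y w + t))].

Let bmg g Z : measurable_fun setT Z -> measurable_fun setT g -> (exists M, forall x, `|g x| <= M) ->
  bounded_measurable (fun w : Omega => g (Z w)).
Proof.
move=> mZ mg [M gM]; split; last by exists M => w.
exact: (measurableT_comp mg mZ).
Qed.

Let mharm s t : measurable_fun setT (fun x : R => cos (s * x + t)).
Proof.
apply: measurable_fun_continuous; first exact: continuous_cos.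
by apply: measurable_funD; [apply: measurable_funM => //|]; exact: measurable_cst.
Qed.

Let harm1 (s t x : R) : `|cos (s * x + t)| <= 1.
Proof. by rewrite ler_norml cos_geN1 cos_le1. Qed.

Let bharm Z s t : measurable_fun setT Z -> bounded_measurable (fun w : Omega => cos (s * Z w + t)).
Proof. by move=> mZ; apply: (bmg mZ (mharm s t)); exists 1. Qed.

Let test1 : test (fun=> 1).
Proof.
split; [exact: measurable_cst|by exists 1 => x; rewrite normr1|move=> s t].
have expand Z : measurable_fun setT Z -> Ex P (fun w => 1 * cos (s * Z w + t)) =
    cos t * Ex P (fun w => cos (s * Z w)) - sin t * Ex P (fun w => sin (s * Z w)).
  move=> mZ; have ms : measurable_fun setT (fun w => s * Z w).
    by apply: measurable_funM => //; exact: measurable_cst.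
  have bc := bm_cos ms; have bs := bm_sin ms.
  rewrite -!ExZ// -ExB; [|exact: bmZ|exact: bmZ].
  by congr Ex; apply/funext => w; rewrite mul1r cosD mulrC (mulrC (sin _)).
by rewrite !expand// cosE sinE.
Qed.

Let testM_harm g s0 t0 : test g -> test (fun x => g x * cos (s0 * x + t0)).
Proof.
move=> [mg [M gM] hg]; split.
- exact: measurable_funM.
- exists (M * 1) => x; rewrite normrM; apply: ler_pM => //; exact: harm1.
move=> s t; have expand Z : measurable_fun setT Z ->
    Ex P (fun w => g (Z w) * cos (s0 * Z w + t0) * cos (s * Z w + t)) =
    2^-1 * Ex P (fun w => g (Z w) * cos ((s0 + s) * Z w + (t0 + t))) +
    2^-1 * Ex P (fun w => g (Z w) * cos ((s0 - s) * Z w + (t0 - t))).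
  move=> mZ; have bg := bmg mZ mg (ex_intro _ M gM).
  have b a b : bounded_measurable (fun w => g (Z w) * cos (a * Z w + b)).
    by apply: bmM => //; exact: bharm.
  rewrite -!ExZ// -ExD; [|exact: bmZ|exact: bmZ].
  congr Ex; apply/funext => w.
  have -> : (s0 + s) * Z w + (t0 + t) = (s0 * Z w + t0) + (s * Z w + t) by ring.
  have -> : (s0 - s) * Z w + (t0 - t) = (s0 * Z w + t0) - (s * Z w + t) by ring.
  by rewrite (cosD (s0 * Z w + t0)) (cosB (s0 * Z w + t0)); field.
by rewrite !expand// !hg.
Qed.

Let testB f g : test f -> test g -> test (fun x => f x - g x).
Proof.
move=> [mf [M fM] hf] [mg [M' gM] hg]; split.
- exact: measurable_funB.
- by exists (M + M') => x; apply: le_trans (ler_normB _ _) _; apply: lerD.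
move=> s t; have expand Z : measurable_fun setT Z ->
    Ex P (fun w => (f (Z w) - g (Z w)) * cos (s * Z w + t)) =
    Ex P (fun w => f (Z w) * cos (s * Z w + t)) - Ex P (fun w => g (Z w) * cos (s * Z w + t)).
  move=> mZ; have bc := bharm s t mZ.
  rewrite -ExB; first by congr Ex; apply/funext => w; rewrite mulrBl.
    by apply: bmM => //; apply: (bmg mZ mf); exists M.
  by apply: bmM => //; apply: (bmg mZ mg); exists M'.
by rewrite !expand// hf hg.
Qed.

Let test_lim (h : nat -> R -> R) g (M : R) : (forall n, test (h n)) ->
  (forall n x, `|h n x| <= M) -> (forall x, h n x @[n --> \oo] --> g x) -> test g.
Proof.
move=> th hM hg; split.
- by apply: (measurable_fun_cvg (h := h)) => // n; case: (th n).
- by exists M => x; apply: (cvgn_le (cvg_norm (hg x))).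
move=> s t; have lim Z : measurable_fun setT Z ->
    Ex P (fun w => h n (Z w) * cos (s * Z w + t)) @[n --> \oo] -->
    Ex P (fun w => g (Z w) * cos (s * Z w + t)).
  move=> mZ; have bc := bharm s t mZ; apply: (@Ex_cvg _ _ _ _ _ _ (M * 1)).
  - move=> n; apply: measurable_funM bc.1; case: (th n) => mh _ _.
    exact: (measurableT_comp mh mZ).
  - by move=> n w; rewrite normrM; apply: ler_pM => //; exact: harm1.
  - by move=> w; apply: cvgMl; exact: hg.
rewrite -(cvg_lim (@Rhausdorff R) (lim X mX)) -(cvg_lim (@Rhausdorff R) (lim Y mY)).
by congr (limn _); apply/funext => n; case: (th n).
Qed.

Let test_pow f g (k : nat) : (forall g, test g -> test (fun x => g x * f x)) ->
  test g -> test (fun x => g x * f x ^+ k).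
Proof.
move=> tf tg; elim: k => [|k IH]; first by under eq_fun do rewrite expr0 mulr1.
by under eq_fun do rewrite exprSr mulrA; exact: tf.
Qed.

Let gaussian lam a (x : R) := expR (- (lam * (x - a) ^+ 2)).

Let testM_gauss lam a g : 0 <= lam -> test g -> test (fun x => g x * gaussian lam a x).
Proof.
move=> lam0 tg; have [_ [M gM] _] := tg.
pose s n := Num.sqrt (2 * lam / n.+1%:R).
apply: (test_lim (h := fun n x => g x * cos (s n * x + - (s n * a)) ^+ n.+1) (M := M)).
- by move=> n; apply: (test_pow (f := fun x => cos (s n * x + - (s n * a)))) => // f; exact: testM_harm.
- move=> n x; rewrite normrM -[leRHS]mulr1; apply: ler_pM => //.
  by rewrite normrX exprn_ile1//; exact: harm1.
move=> x; apply: cvgMr; under eq_fun do rewrite -mulrBr.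
exact: cos_pow_cvg.
Qed.

Let gaussian01 lam a x : 0 <= lam -> 0 < gaussian lam a x <= 1.
Proof.
move=> lam0; rewrite expR_gt0/= -[leRHS]expR0 ler_expR oppr_le0.
by rewrite mulr_ge0 ?sqr_ge0.
Qed.

(* As n grows this polynomial in y tends to 1 for y < 1/2 and to 0 for y > 1/2. *)
Let cut n y := (1 - y ^+ n) ^+ (2 ^ n)%N.

Let cut01 n y : 0 <= y <= 1 -> 0 <= cut n y <= 1.
Proof.
move=> /andP[y0 y1]; have h : 0 <= 1 - y ^+ n <= 1.
  by rewrite subr_ge0 exprn_ile1//= lerBlDr lerDl exprn_ge0.
by case/andP: h => h0 h1; rewrite exprn_ge0//= exprn_ile1.
Qed.

Let bernoulli_upper k (z : R) : 0 <= z -> 1 + k%:R * z <= (1 + z) ^+ k.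
Proof.
move=> z0; elim: k => [|k IH]; first by rewrite mul0r addr0 expr0.
rewrite exprS; apply: le_trans (_ : (1 + z) * (1 + k%:R * z) <= _); last first.
  by rewrite ler_wpM2l// addr_ge0.
have := mulr_ge0 (ler0n R k) z0; rewrite -natr1; nra.
Qed.

Let bernoulli_lower k (z : R) : 0 <= z <= 1 -> 1 - k%:R * z <= (1 - z) ^+ k.
Proof.
move=> /andP[z0 z1]; elim: k => [|k IH]; first by rewrite mul0r subr0 expr0.
rewrite exprS; apply: le_trans (_ : (1 - z) * (1 - k%:R * z) <= _); last first.
  by rewrite ler_wpM2l// subr_ge0.
have := mulr_ge0 (ler0n R k) z0; rewrite -natr1; nra.
Qed.

Let cut_cvg0 y : 2^-1 < y -> y <= 1 -> cut n y @[n --> \oo] --> (0 : R).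
Proof.
move=> y2 y1; have y0 : 0 < y by lra.
have q : 0 <= (2 * y)^-1 < 1 by rewrite invr_ge0 invf_lt1; [|lra]; apply/andP; split; lra.
have : (2 * y)^-1 ^+ n @[n --> \oo] --> (0 : R).
  by apply: cvg_expr; case/andP: q => h0 h1; rewrite ger0_norm.
apply: (squeeze_cvgr _ (cvg_cst 0)); apply: nearW => n.
have /andP[-> _] /= : 0 <= cut n y <= 1 by apply: cut01; rewrite (ltW y0).
have z0 : 0 < y ^+ n by rewrite exprn_gt0.
have z1 : y ^+ n <= 1 by rewrite exprn_ile1// ltW.
rewrite exprVn exprMn -div1r ler_pdivlMr ?mulr_gt0 ?exprn_gt0//.
(* With N = 2^n and z = y^n, (1 - z)^N (1 + z)^N <= 1, and the second factor is at least (2 y)^n. *)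
have h : 2 ^+ n * y ^+ n <= (1 + y ^+ n) ^+ (2 ^ n)%N.
  by have := bernoulli_upper (2 ^ n)%N (ltW z0); rewrite natrX; lra.
apply: le_trans (ler_wpM2l _ h) _; first by rewrite exprn_ge0// subr_ge0.
by rewrite -exprMn exprn_ile1//; nra.
Qed.

Let cut_cvg1 y : 0 <= y -> y < 2^-1 -> cut n y @[n --> \oo] --> (1 : R).
Proof.
move=> y0 y2; have : 1 - (2 * y) ^+ n @[n --> \oo] --> (1 - 0 : R).
  apply: cvgB; first exact: cvg_cst.
  by apply: cvg_expr; rewrite ger0_norm ?mulr_ge0//; lra.
rewrite subr0 => h; have c1 : (cst (1 : R) : nat -> R) @ \oo --> (1 : R) by exact: cvg_cst.
apply: (squeeze_cvgr _ h c1); apply: nearW => n.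
have y1 : y <= 1 by lra.
have /andP[_ ->] : 0 <= cut n y <= 1 by apply: cut01; rewrite y0.
rewrite andbT exprMn -natrX; apply: bernoulli_lower.
by rewrite exprn_ge0//= exprn_ile1.
Qed.

(** At the level 1/2 itself the existence of a limit suffices; the sequence increases because 1 - z
    <= (1 - z/2)^2. *)
Let cut_cvg_half : cvgn (fun n => cut n 2^-1).
Proof.
have h01 : 0 <= (2^-1 : R) <= 1 by apply/andP; split; lra.
apply: nondecreasing_is_cvgn; last first.
  by exists 1 => _ [n _ <-]; have /andP[] := cut01 n h01.
apply/nondecreasing_seqP => n; rewrite /cut expnS exprM -/(2 ^ n)%N.
have z0 : 0 <= (2^-1 : R) ^+ n by rewrite exprn_ge0.
have z1 : (2^-1 : R) ^+ n <= 1 by rewrite exprn_ile1//; lra.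
rewrite lerXn2r ?nnegrE ?subr_ge0 ?exprn_ge0//; rewrite ?subr_ge0 ?exprS.
  by rewrite mulr_ile1//; lra.
nra.
Qed.

Let threshold y : R := if 2^-1 < y then 0 else if y < 2^-1 then 1 else limn (fun n => cut n 2^-1).

Let threshold_cvg y : 0 <= y <= 1 -> cut n y @[n --> \oo] --> threshold y.
Proof.
move=> /andP[y0 y1]; rewrite /threshold; case: ltgtP => h; [exact: cut_cvg0|exact: cut_cvg1|].
by rewrite -h; exact: cut_cvg_half.
Qed.

Let test_threshold lam a : 0 <= lam -> test (fun x => threshold (gaussian lam a x)).
Proof.
move=> lam0; have y01 x : 0 <= gaussian lam a x <= 1.
  by have /andP[/ltW -> ->] := gaussian01 a x lam0.
have tgn n f : test f -> test (fun x => f x * gaussian lam a x ^+ n).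
  by apply: test_pow => g; exact: testM_gauss.
apply: (test_lim (h := fun n x => cut n (gaussian lam a x)) (M := 1)).
- move=> n; under eq_fun do rewrite -[cut _ _]mul1r.
  apply: (test_pow (f := fun x => 1 - gaussian lam a x ^+ n)) test1 => g tg.
  by under eq_fun do rewrite mulrBr mulr1; apply: testB => //; exact: tgn.
- by move=> n x; have /andP[h0 h1] := cut01 n (y01 x); rewrite ger0_norm.
- by move=> x; exact: threshold_cvg.
Qed.

(** With [lam = ln 2 / dl ^+ 2] the Gaussian equals 1/2 exactly at distance [dl] from [a]. *)
Let threshold_out dl a x : 0 < dl -> dl < `|x - a| -> threshold (gaussian (ln 2 / dl ^+ 2) a x) = 1.
Proof.
move=> dl0 h; have l2 : 0 < ln 2 :> R by rewrite ln_gt0// ltr1n.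
have h1 : gaussian (ln 2 / dl ^+ 2) a x < 2^-1.
  rewrite -[ltRHS]lnK ?posrE ?invr_gt0// lnV ?posrE// ltr_expR ltrN2.
  rewrite mulrAC ltr_pdivlMr ?exprn_gt0// ltr_pM2l// -[ltRHS]real_normK ?num_real//.
  by rewrite ltrXn2r ?nnegrE// ?ltW.
by rewrite /threshold h1; case: ltgtP h1.
Qed.

Let threshold_in dl a x : 0 < dl -> `|x - a| < dl -> threshold (gaussian (ln 2 / dl ^+ 2) a x) = 0.
Proof.
move=> dl0 h; have l2 : 0 < ln 2 :> R by rewrite ln_gt0// ltr1n.
have h1 : 2^-1 < gaussian (ln 2 / dl ^+ 2) a x.
  rewrite -[ltLHS]lnK ?posrE ?invr_gt0// lnV ?posrE// ltr_expR ltrN2.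
  rewrite mulrAC ltr_pdivrMr ?exprn_gt0// ltr_pM2l// -[ltLHS]real_normK ?num_real//.
  by rewrite ltrXn2r ?nnegrE// ?ltW.
by rewrite /threshold h1.
Qed.

(** The interval of centre x0 + n + 1 and radius n + 1 - 1/(n+2) grows to the ray. The shortened
    radius keeps every point up to x0 strictly outside, away from the level 1/2. *)
Let test_ray x0 : test (\1_(`]x0, +oo[%classic)).
Proof.
pose a n : R := x0 + n.+1%:R.
pose dl n : R := n.+1%:R - n.+2%:R^-1.
have inv1 n : 0 < (n.+2%:R^-1 : R) < 1 by rewrite invr_gt0 ltr0n/= invf_lt1 ?ltr1n.
have n1 n : 1 <= n.+1%:R :> R by rewrite ler1n.
have dl0 n : 0 < dl n by rewrite subr_gt0; case/andP: (inv1 n) => _ h; exact: lt_le_trans h (n1 n).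
have l0 n : 0 <= ln 2 / dl n ^+ 2 by rewrite divr_ge0 ?sqr_ge0// ln_ge0// ler1n.
have tle : test (fun x => if x <= x0 then 1 else 0).
  apply: (test_lim (h := fun n x => threshold (gaussian (ln 2 / dl n ^+ 2) (a n) x)) (M := 1)).
  - by move=> n; exact: test_threshold.
  - move=> n x; have /andP[/ltW g0 g1] := gaussian01 (a n) x (l0 n).
    apply: (cvgn_le (cvg_norm (threshold_cvg (introT andP (conj g0 g1))))) => k.
    by have /andP[h0 h1] := cut01 k (introT andP (conj g0 g1)); rewrite ger0_norm.
  move=> x; have [xx|xx] := leP x x0; apply: cvg_near_cst.
    apply: nearW => n; apply: threshold_out => //.
    move: (inv1 n) (n1 n); rewrite /a /dl; move: (n.+2%:R^-1) (n.+1%:R) => u v /andP[? ?] ?.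
    by rewrite ler0_norm; lra.
  have xx0 : 0 < x - x0 by rewrite subr_gt0.
  near=> n; apply: threshold_in => //.
  have h1 : x - x0 < n%:R by near: n; exact: nbhs_infty_gtr.
  have h2 : n.+1%:R^-1 < x - x0 by near: n; exact: (near_infty_natSinv_lt (PosNum xx0)).
  have h3 : n.+2%:R^-1 < n.+1%:R^-1 :> R by rewrite ltf_pV2 ?posrE// ltr_nat.
  have h4 := lt_trans h3 h2; have n0 : 0 <= n%:R :> R by [].
  move: (inv1 n) h1 h4 n0; rewrite ltr_norml /a /dl -(@natr1 R n).
  move: (n.+2%:R^-1) (n%:R) => u v /andP[? ?] ? ? ?.
  by apply/andP; split; lra.
(* A constant sequence: the limit lemma serves to pass to a pointwise equal function. *)
apply: (test_lim (h := fun _ x => 1 - if x <= x0 then 1 else 0) (M := 1)).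
- by move=> _; exact: testB.
- by move=> _ x; case: ifP => _; rewrite ?subrr ?subr0 ?normr0 ?normr1.
move=> x; rewrite indicE; have [xx|xx] := leP x x0.
  rewrite memNset ?subrr; last by rewrite /= in_itv/= ltNge xx.
  exact: cvg_cst.
by rewrite mem_set ?subr0; [exact: cvg_cst|rewrite /= in_itv/= xx].
Unshelve. all: by end_near.
Qed.

Lemma same_characteristic_function (B : set R) : measurable B ->
  P (X @^-1` B) = P (Y @^-1` B).
Proof.
have mZ Z : measurable_fun setT Z -> forall A : set R, measurable A -> measurable (Z @^-1` A).
  by move=> m A mA; rewrite -[X in measurable X]setTI; exact: m.
pose muX := pushforward P X; pose muY := pushforward P Y.
pose fX : {mfun Omega >-> R} := mfun_Sub (mem_set mX).
pose fY : {mfun Omega >-> R} := mfun_Sub (mem_set mY).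
apply: (@measure_unique _ R _ (@RGenOInfty.G R) (fun k => `]- k%:R, +oo[%classic)
  (RGenOInfty.measurableE R) _ _ _ (distribution P fX) (distribution P fY)).
- move=> _ _ [x ->] [y ->]; exists (Num.max x y); apply/seteqP; split => z /=.
    by rewrite !in_itv/= !andbT gt_max => -[-> ->].
  by rewrite !in_itv/= !andbT gt_max => /andP.
- by move=> k; exists (- k%:R).
- apply/seteqP; split => // x _; exists (Num.truncn `|x|).+1 => //=.
  rewrite in_itv/= andbT ltrNl; apply: le_lt_trans (ler_norm _) _.
  by rewrite normrN truncnS_gt.
- move=> _ [x ->]; have [_ _ /(_ 0 0)] := test_ray x.
  have e Z : Ex P (fun w => \1_(`]x, +oo[%classic) (Z w) * cos (0 * Z w + 0)) =
     Ex P (\1_(Z @^-1` `]x, +oo[%classic)).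
    by congr Ex; apply/funext => w; rewrite mul0r addr0 cos0 mulr1 !indicE.
  have mr : measurable (`]x, +oo[%classic : set R) by [].
  rewrite !e !Ex_indic; [|exact: mZ|exact: mZ].
  move=> h; rewrite /distribution /pushforward.
  rewrite -[LHS]fineK; last by rewrite fin_num_measure//; exact: mZ.
  by rewrite -[RHS]fineK ?h// fin_num_measure//; exact: mZ.
- move=> k; apply: (@le_lt_trans _ _ 1%E); last by rewrite ltry.
  by apply: probability_le1.
Qed.

End characteristic_function.

(** * A symmetric stable law carried by a line of H *)

Section stable_law.
Context {R : realType} {d : measure_display} {Omega : measurableType d} {U H : hilbertType R}.
Variables (P : probability Omega R) (F : R -> set (set Omega)) (L : R -> U -> Omega -> R).
Variable alpha : R.
Hypotheses (alpha_gt0 : 0 < alpha) (alpha_lt2 : alpha < 2) (sH : separable H).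
Hypotheses (Ff : filtration F) (Ls : canonical_stable P F alpha L).
Variables (u : U) (h : H).
Hypotheses (u1 : `|u| = 1) (h1 : `|h| = 1).
Implicit Types (a b s t : R).

Local Notation borel := (g_sigma_algebraType (@open H)).
Local Notation incr := (incr L).
Local Notation X := (incr 0 1 u).
Local Notation X' := (incr 1 2 u).

Lemma incr_scale s t a : 0 <= s -> s <= t ->
  {ae P, forall w, incr s t (a *: u) w = a * incr s t u w}.
Proof.
move=> s0 st; have := incr_linear Ls (a - 1) u u s0 st.
have -> : (a - 1) *: u + u = a *: u by rewrite scalerBl scale1r subrK.
apply: filterS => w ->; ring.
Qed.

Let mX : measurable_fun setT X. Proof. by apply: (measurable_incr Ff Ls); rewrite ?ler01. Qed.
Let mX' : measurable_fun setT X'. Proof. by apply: (measurable_incr Ff Ls); rewrite ?ler1n. Qed.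

Let mscale a (Z : Omega -> R) : measurable_fun setT Z -> measurable_fun setT (fun w => a * Z w).
Proof. by move=> mZ; apply: measurable_funM => //; exact: measurable_cst. Qed.

Let cosX a : Ex P (fun w => cos (a * X w)) = expR (- `|a| `^ alpha).
Proof.
have := Ex_cos_incr Ff Ls (a *: u) (lexx 0) ler01.
rewrite normrZ u1 mulr1 subr0 mulN1r => <-; apply: Ex_ae_eq.
- by apply: bm_cos; exact: mscale.
- by apply: bm_cos; apply: (measurable_incr Ff Ls); rewrite ?ler01.
by apply: filterS (incr_scale a (lexx 0) ler01) => w ->.
Qed.

Let sinX a : Ex P (fun w => sin (a * X w)) = 0.
Proof.
apply: etrans (Ex_sin_incr Ff Ls (a *: u) (lexx 0) ler01); apply: Ex_ae_eq.
- by apply: bm_sin; exact: mscale.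
- by apply: bm_sin; apply: (measurable_incr Ff Ls); rewrite ?ler01.
by apply: filterS (incr_scale a (lexx 0) ler01) => w ->.
Qed.

(** The phase [t] treats the real part (0) and the imaginary part ([pi / 2]) of the characteristic
    function together. *)
Let cos_step a b t : Ex P (fun w => cos (a * X w + b * X' w - t)) =
  Ex P (fun w => cos (a * X w - t)) * expR (- `|b| `^ alpha).
Proof.
have le12 : 1 <= 2 :> R by rewrite ler1n.
have FT : F 1 setT.
  by rewrite -setC0; apply: sigma_setC; [exact: (filt_sigma Ff ler01)|case: (filt_sigma Ff ler01)].
have mz : meas_in (F 1) (fun w => a * X w - t).
  apply: meas_inB; last exact: meas_in_cst.
  by apply: meas_inM; [exact: meas_in_cst|exact: (adapted_incr Ff Ls u (lexx 0) ler01)].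
have := cos_incr_step Ff Ls (b *: u) ler01 le12 FT mz.
have n1 : 2 - 1 = 1 :> R by ring.
rewrite normrZ u1 mulr1 n1 mulN1r.
have -> : (fun w => \1_setT w * cos (a * X w - t)) = (fun w => cos (a * X w - t)).
  by apply/funext => w; rewrite indicT mul1r.
move=> <-; have ma : measurable_fun setT (fun w => a * X w - t).
  by apply: measurable_funB; [exact: mscale|exact: measurable_cst].
apply: Ex_ae_eq.
- apply: bm_cos; apply: measurable_funB; last exact: measurable_cst.
  by apply: measurable_funD; exact: mscale.
- apply: bmM; first by apply: bm_indic.
  by apply: bm_cos; apply: measurable_funD => //; exact: (measurable_incr Ff Ls).
apply: filterS (incr_scale b ler01 le12) => w ->.
by rewrite indicT mul1r addrAC.
Qed.

Let sin_cos (x : R) : sin x = cos (x - pi / 2). Proof. by rewrite cosBpihalf. Qed.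

Lemma stable_sum_law a b (B : set R) : 0 < a -> 0 < b -> measurable B ->
  P ((fun w => a * X w + b * X' w) @^-1` B) =
  P ((fun w => (a `^ alpha + b `^ alpha) `^ alpha^-1 * X w) @^-1` B).
Proof.
move=> a0 b0; set c := _ `^ alpha^-1.
have msum s : measurable_fun setT (fun w => s * a * X w + s * b * X' w).
  by apply: measurable_funD; exact: mscale.
have cE : c `^ alpha = a `^ alpha + b `^ alpha.
  by rewrite /c -powRrM mulVf ?powRr1 ?gt_eqF// addr_ge0 ?powR_ge0.
apply: same_characteristic_function.
- by apply: measurable_funD; exact: mscale.
- exact: mscale.
- move=> s; have := cos_step (s * a) (s * b) 0.
  under [X in Ex P X = _]eq_fun do rewrite subr0.
  under [X in _ = Ex P X * _]eq_fun do rewrite subr0.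
  rewrite cosX -expRD => h2.
  under [X in Ex P X = _]eq_fun do rewrite mulrDr !mulrA.
  rewrite h2; under [X in _ = Ex P X]eq_fun do rewrite mulrA.
  rewrite cosX; congr expR.
  have c0 : 0 <= c by exact: powR_ge0.
  rewrite !normrM (gtr0_norm a0) (gtr0_norm b0) (ger0_norm c0) !powRM ?(ltW a0) ?(ltW b0)//.
  by rewrite cE; ring.
move=> s; have := cos_step (s * a) (s * b) (pi / 2).
under [X in Ex P X = _]eq_fun do rewrite -sin_cos.
under [X in _ = Ex P X * _]eq_fun do rewrite -sin_cos.
rewrite sinX mul0r => h2.
under [X in Ex P X = _]eq_fun do rewrite mulrDr !mulrA.
by rewrite h2; under [X in _ = Ex P X]eq_fun do rewrite mulrA; rewrite sinX.
Qed.

Lemma symmetric_law (B : set R) : measurable B -> P ((fun w => - X w) @^-1` B) = P (X @^-1` B).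
Proof.
apply: same_characteristic_function => //; first exact: measurable_funN.
- by move=> s; congr Ex; apply/funext => w; rewrite mulrN cosN.
- move=> s; have e : (fun w => sin (s * - X w)) = (fun w => -1 * sin (s * X w)).
    by apply/funext => w; rewrite mulrN sinN mulN1r.
  by rewrite e ExZ ?sinX ?mulr0//; apply: bm_sin; exact: mscale.
Qed.

Let line (Z : Omega -> R) (w : Omega) : borel := Z w *: h.

Let mline0 : measurable_fun setT (fun t : R => t *: h : borel).
Proof.
have openE : @measurable _ (g_sigma_algebraType (@open H)) = <<s @open H >> by [].
apply: (measurability _ openE) => _ [W oW <-]; rewrite setTI; apply: open_measurable.
apply: (@open_comp _ _ (fun t : R => t *: h)) => // t _.
by apply: cvgZl; exact: cvg_id.
Qed.

Let mline Z : measurable_fun setT Z -> measurable_fun setT (line Z).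
Proof. by move=> mZ; exact: (measurableT_comp mline0 mZ). Qed.

Let mu : probability borel R := distribution P (mfun_Sub (mem_set (mline mX))).

Let muE (A : set borel) : mu A = P [set w | A (X w *: h)].
Proof. by []. Qed.

Let line_set (A : set borel) : measurable A -> measurable [set t : R | A (t *: h)].
Proof. by move=> mA; rewrite -[X in measurable X]setTI; exact: (mline0 measurableT mA). Qed.

Lemma line_symmetric : symmetric_measure mu.
Proof.
move=> B mB; rewrite !muE -[RHS](symmetric_law (line_set mB)); congr (P _).
by apply/seteqP; split => w /=; rewrite scaleNr.
Qed.

Let joint (w : Omega) : borel * borel := (line X w, line X' w).

Let mjoint : measurable_fun setT joint.
Proof. by apply: measurable_fun_pair; exact: mline. Qed.

(** The increments over [0, 1] and [1, 2] are independent with the same law, so the product measure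
    is the law of [joint]. Everything then lives on the line through [h], where [stable_sum_law]
    applies, with centring 0. *)
Lemma line_stable : stable_measure alpha mu.
Proof.
move=> a b a0 b0; exists 0 => B mB.
have le12 : 1 <= 2 :> R by rewrite ler1n.
pose m' : probability (borel * borel)%type R := distribution P (mfun_Sub (mem_set mjoint)).
(* Measurability of the addition for the product of the Borel sigma-algebras is checked on
   coordinates; separability of [H] is what makes this enough. *)
have mS : measurable [set p : borel * borel | B (a *: (p.1 : H) + b *: (p.2 : H))].
  pose Z (p : borel * borel) : H := a *: (p.1 : H) + b *: (p.2 : H).
  suff wZ : weak_meas_in measurable Z.
    exact: (weak_borel sH (sigma_algebra_measurable _) wZ mB).
  move=> g; have mg : measurable_fun setT (fun p : borel * borel => hdot (Z p) g).
    have mh : measurable_fun setT (fun x : borel => hdot (x : H) g).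
      by apply: continuous_borel; exact: continuous_hdotl.
    have -> : (fun p => hdot (Z p) g) = (fun p : borel * borel => a * hdot (p.1 : H) g + b * hdot (p.2 : H) g).
      by apply/funext => p; rewrite hdotDl !hdotZl.
    apply: measurable_funD; apply: measurable_funM; [exact: measurable_cst| |exact: measurable_cst|].
      exact: (measurableT_comp mh measurable_fst).
    exact: (measurableT_comp mh measurable_snd).
  move=> _ C mC; rewrite setTI; apply: measurable_in.
  by rewrite -[X in measurable X]setTI; exact: (mg measurableT _ mC).
rewrite (@product_measure_unique _ _ _ _ R mu mu m')//; last first.
  move=> A1 A2 mA1 mA2.
  change (P (X @^-1` [set t | A1 (t *: h)] `&` X' @^-1` [set t | A2 (t *: h)]) =
    P (X @^-1` [set t | A1 (t *: h)]) * P (X @^-1` [set t | A2 (t *: h)]))%E.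
  have FX : F 1 (X @^-1` [set t | A1 (t *: h)]).
    apply: (meas_in_set (filt_sigma Ff ler01) _ (line_set mA1)).
    exact: (adapted_incr Ff Ls u (lexx 0) ler01).
  rewrite (incr_indep Ls u ler01 le12 FX (line_set mA2)); congr (_ * _)%E.
  rewrite (incr_law Ls u ler01 le12 (line_set mA2)) (incr_law Ls u (lexx 0) ler01 (line_set mA2)).
  by rewrite subr0 (_ : 2 - 1 = 1 :> R)//; ring.
rewrite /m' /distribution /pushforward /= muE.
transitivity (P ((fun w => a * X w + b * X' w) @^-1` [set t : R | B (t *: h)])).
  by congr (P _); apply/seteqP; split => w /=; rewrite /line !scalerA -scalerDl.
rewrite stable_sum_law//; last exact: line_set.
by congr (P _); apply/seteqP; split => w /=; rewrite addr0 scalerA.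
Qed.

Let tailE r : scaled_tail alpha mu r = ((r `^ alpha)%:E * P [set w | (r < `|X w|)%R])%E.
Proof.
rewrite /scaled_tail muE; congr (_ * P _)%E.
by apply/seteqP; split => w /=; rewrite normrZ h1 mulr1.
Qed.

Let mtail r : measurable [set w | r < `|X w|].
Proof.
have -> : [set w | r < `|X w|] = ((fun x : R => `|x|) \o X) @^-1` `]r, +oo[%classic.
  by apply/seteqP; split => w /=; rewrite in_itv/= andbT.
rewrite -[X in measurable X]setTI.
exact: (measurable_fun_continuous (@norm_continuous R R) mX).
Qed.

(** At the vector u/r the loss of the Gaussian expectation is at most 2^(alpha/2) / r^alpha, while 1
    - exp (- (X/r)^2) is at least 1 - exp (-1) where |X| > r. *)
Let tail_le : exists K : R, forall r, 0 < r -> (scaled_tail alpha mu r <= K%:E)%E.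
Proof.
have e1 : 0 < 1 - expR (-1) :> R by rewrite subr_gt0 -[ltRHS]expR0 ltr_expR ltrN10.
exists (2 `^ (alpha / 2) / (1 - expR (-1))) => r r0; rewrite tailE.
have := gauss_incr_lower alpha_gt0 alpha_lt2 Ff Ls (r^-1 *: u) (lexx 0) ler01.
have ri : 0 <= r^-1 by rewrite invr_ge0 ltW.
rewrite subr0 mul1r normrZ u1 mulr1 ger0_norm// powRM ?sqr_ge0//.
have -> : (r^-1 ^+ 2) `^ (alpha / 2) = (r `^ alpha)^-1.
  rewrite -powR_mulrn// -powRrM (_ : 2%:R * (alpha / 2) = alpha); last by field.
  by rewrite -(powR_inv1 (ltW r0)) -powRrM mulN1r powRN.
have bs (Z : Omega -> R) : measurable_fun setT Z -> bounded_measurable (fun w => expR (- (Z w ^+ 2))).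
  move=> mZ; split; last first.
    exists 1 => w; rewrite ger0_norm ?expR_ge0// -[leRHS]expR0 ler_expR oppr_le0.
    exact: sqr_ge0.
  apply: measurable_fun_continuous; first exact: continuous_expR.
  by apply: measurable_funN; exact: measurable_funX.
have mr : measurable_fun setT (fun w => r^-1 * X w) by exact: mscale.
have -> : Ex P (fun w => expR (- (incr 0 1 (r^-1 *: u) w ^+ 2))) =
    Ex P (fun w => expR (- ((r^-1 * X w) ^+ 2))).
  apply: Ex_ae_eq; [apply: bs; exact: (measurable_incr Ff Ls)|exact: bs|].
  by apply: filterS (incr_scale r^-1 (lexx 0) ler01) => w ->.
move=> lo; have up : (1 - expR (-1)) * fine (P [set w | r < `|X w|]) <=
    1 - Ex P (fun w => expR (- ((r^-1 * X w) ^+ 2))).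
  rewrite -Ex_indic// -ExZ; last exact: bm_indic.
  rewrite -[X in _ <= X - _](Ex_cst P 1) -ExB; [|exact: bm_cst|exact: bs].
  apply: Ex_le => [||w].
  - by apply: bmZ; exact: bm_indic.
  - by apply: bmB; [exact: bm_cst|exact: bs].
  rewrite indicE; case: (boolP (w \in _)) => [/set_mem/= rX|_]; last first.
    by rewrite mulr0 subr_ge0 -[leRHS]expR0 ler_expR oppr_le0 sqr_ge0.
  rewrite mulr1 lerD2l lerN2 ler_expR lerN2 -[leRHS]real_normK ?num_real//.
  by rewrite exprn_ege1// normrM ger0_norm// mulrC ler_pdivlMr// mul1r ltW.
have p0 : 0 < r `^ alpha by rewrite powR_gt0.
rewrite -[P _]fineK ?fin_num_measure// -EFinM lee_fin ler_pdivlMr//.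
have up' : (1 - expR (-1)) * fine (P [set w | r < `|X w|]) <= 2 `^ (alpha / 2) / r `^ alpha by lra.
by move: up'; rewrite ler_pdivlMr// mulrC mulrA mulrAC.
Qed.

(** Otherwise X = 0 almost surely, against E cos X = exp (-1). *)
Let tail_pos : exists2 r, 0 < r & (0 < scaled_tail alpha mu r)%E.
Proof.
apply: contrapT => no; have p0 r : 0 < r -> P [set w | r < `|X w|] = 0%E.
  move=> r0; apply/eqP; rewrite -measure_le0 leNgt; apply/negP => h0; apply: no.
  by exists r => //; rewrite tailE mule_gt0// lte_fin powR_gt0.
have X0 : {ae P, forall w, X w = 0}.
  have Xn n : {ae P, forall w, `|X w| <= n.+1%:R^-1}.
    exists [set w | n.+1%:R^-1 < `|X w|]; split => //; first by apply: p0; rewrite invr_gt0.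
    by move=> w /= /negP; rewrite -ltNge.
  apply: filterS (ae_foralln Xn) => w hw; apply/eqP; rewrite -normr_le0 leNgt; apply/negP => h0.
  have [n] := ltr_add_invr h0; rewrite add0r => hn.
  by have := lt_le_trans hn (hw n); rewrite ltxx.
have := cosX 1; rewrite normr1 powR1 => h2.
have : Ex P (fun w => cos (1 * X w)) = 1.
  rewrite -[RHS](Ex_cst P 1); apply: Ex_ae_eq; [by apply: bm_cos; exact: mscale|exact: bm_cst|].
  by apply: filterS X0 => w ->; rewrite mulr0 cos0.
rewrite h2 => /eqP; rewrite -[X in _ == X]expR0 (inj_eq (@expR_inj R)) oppr_eq0.
by rewrite oner_eq0.
Qed.

Lemma tail_constant_ge1 (c : R) : tail_constant H alpha c -> 1 <= c.
Proof.
move=> /(_ mu line_symmetric line_stable); set S := ereal_sup _ => hS.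
have [K tK] := tail_le; have [r0 r00 tr0] := tail_pos.
have inS r : 0 < r -> (scaled_tail alpha mu r <= S)%E.
  by move=> r_gt0; apply: ereal_sup_ubound; exists r => //=; rewrite in_itv/= andbT.
have S0 : (0 < S)%E by apply: lt_le_trans tr0 (inS _ r00).
have SK : (S <= K%:E)%E.
  by apply: ge_ereal_sup => _ [r /= + <-]; rewrite in_itv/= andbT; exact: tK.
have Sfin : S \is a fin_num by rewrite ge0_fin_numE ?(ltW S0)// (le_lt_trans SK)// ltry.
have [cv|ncv] := pselect (cvg (scaled_tail alpha mu r @[r --> +oo%R])); last first.
  (* a divergent limit is the default point of the extended reals, which is 0 *)
  by move: hS; rewrite (dvgP ncv) (_ : point = 0%E)// mule0 leNgt S0.
have lS : (lim (scaled_tail alpha mu r @[r --> +oo%R]) <= S)%E.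
  by apply: lime_le => //; near=> r; apply: inS; near: r; exact: nbhs_pinfty_gt.
have l0 : (0 <= lim (scaled_tail alpha mu r @[r --> +oo%R]))%E.
  by apply: lime_ge => //; apply: nearW => r; rewrite tailE mule_ge0// lee_fin powR_ge0.
(* What remains is 0 < S <= c l and l <= S with S finite, which forces 1 <= c. *)
move: hS lS l0 S0 Sfin; clear inS SK; set l := lim _; move: S => [S| |]//; case: l => [l| |]//.
  rewrite -EFinM !lee_fin lte_fin => h2 lS l0 S0 _; rewrite leNgt; apply/negP => c1.
  have h3 : 0 < l by nra.
  nra.
Unshelve. all: by end_near.
Qed.

End stable_law.

(** * Comparison of the constants *)

(** Euler's integral without the continuation in [Gamma]; the lock keeps it folded during
    computations. *)
HB.lock Definition Gam {R : realType} (z : R) : R :=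
  \int[lebesgue_measure]_(t in `]0, +oo[) (t `^ (z - 1) * expR (- t)).

Section gamma_integral.
Context {R : realType}.
Implicit Types (z t a b : R).

Definition gamma_integrand z t : R := t `^ (z - 1) * expR (- t).
Definition gamma_integral z : \bar R :=
  (\int[lebesgue_measure]_(t in `]0%R, +oo[) (gamma_integrand z t)%:E)%E.

Lemma measurable_gamma_integrand z (D : set R) : measurable_fun D (gamma_integrand z).
Proof.
apply: (@measurable_funS _ _ _ _ setT) => //; apply: measurable_funM.
  exact: (@measurable_powR R).
by apply: measurable_fun_continuous; [exact: continuous_expR|exact: measurable_funN].
Qed.

Lemma gamma_integrand_ge0 z t : 0 <= gamma_integrand z t.
Proof. by rewrite mulr_ge0 ?powR_ge0 ?expR_ge0. Qed.

Let is_derive_F z t : 0 < t -> is_derive t 1 (fun t => t `^ z * expR (- t))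
  (z * gamma_integrand z t - gamma_integrand (z + 1) t).
Proof.
move=> t0; have h1 := is_derive1_powR z t0.
have h2 : is_derive t 1 (fun t => expR (- t)) (- expR (- t)).
  by apply: is_derive_eq; rewrite ?scaler1 ?mulr1 ?mulrN1 ?scaleN1r.
have h3 : is_derive t 1 ((fun t => t `^ z) * (fun t => expR (- t)))
   (t `^ z *: (- expR (- t)) + expR (- t) *: (z * t `^ (z - 1))) := is_deriveM h1 h2.
apply: is_derive_eq h3 _; rewrite /gamma_integrand addrK /GRing.scale/=; ring.
Qed.

Let continuous_gamma_integrand z t : 0 < t -> {for t, continuous (gamma_integrand z)}.
Proof.
move=> t0; apply: continuousM.
  apply/differentiable_continuous/derivable1_diffP.
  by apply: derivable_powR; rewrite in_itv/= t0.
apply: (@continuous_comp _ _ _ (fun t : R => - t) (@expR R)); last exact: continuous_expR.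
exact: continuousN.
Qed.

(** Integration by parts: t^z exp (- t) is a primitive of the difference of the two integrands. *)
Let gamma_parts z a b : 0 < a -> a < b ->
  (\int[lebesgue_measure]_(t in `[a, b]) (z * gamma_integrand z t)%:E =
   \int[lebesgue_measure]_(t in `[a, b]) (gamma_integrand (z + 1) t)%:E +
     (b `^ z * expR (- b) - a `^ z * expR (- a))%:E)%E.
Proof.
move=> a0 ab; have pos t : t \in `[a, b] -> 0 < t.
  by rewrite in_itv/= => /andP[h _]; exact: lt_le_trans h.
have within (f : R -> R) : (forall t, 0 < t -> {for t, continuous f}) ->
    {within `[a, b], continuous f}.
  move=> cf; apply: continuous_in_subspaceT => t /set_mem h; apply: cf; exact: pos.
have cz w : {within `[a, b], continuous (fun t => z * gamma_integrand w t)}.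
  by apply: within => t t0; apply: continuousM; [exact: cvg_cst|exact: continuous_gamma_integrand].
have c1 w : {within `[a, b], continuous (gamma_integrand w)}.
  by apply: within => t; exact: continuous_gamma_integrand.
have F' t : 0 < t -> {for t, continuous (fun t => t `^ z * expR (- t))}.
  move=> t0; have [d _] := is_derive_F z t0.
  exact/differentiable_continuous/derivable1_diffP.
have := @continuous_FTC2 R (fun t => z * gamma_integrand z t - gamma_integrand (z + 1) t)
  (fun t => t `^ z * expR (- t)) a b ab.
rewrite -EFinB => <-.
- have iz : lebesgue_measure.-integrable `[a, b] (EFin \o (fun t => z * gamma_integrand z t)).
    by apply: continuous_compact_integrable; [exact: segment_compact|exact: cz].
  have i1 : lebesgue_measure.-integrable `[a, b] (EFin \o gamma_integrand (z + 1)).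
    by apply: continuous_compact_integrable; [exact: segment_compact|exact: c1].
  under [X in (_ = _ + X)%E]eq_integral do rewrite EFinB.
  rewrite integralB//= addeC subeK//; exact: integrable_fin_num.
- apply: within => t t0; apply: continuousB; last exact: continuous_gamma_integrand.
  by apply: continuousM; [exact: cvg_cst|exact: continuous_gamma_integrand].
- split.
  + move=> t; rewrite in_itv/= => /andP[at' _].
    by have [] := is_derive_F z (lt_trans a0 at').
  + by apply: cvg_at_right_filter; exact: F'.
  + by apply: cvg_at_left_filter; apply: F'; exact: lt_trans ab.
- move=> t; rewrite in_itv/= => /andP[at' _].
  by rewrite derive1E; have [_] := is_derive_F z (lt_trans a0 at').
Qed.

Let boundary_cvg z : 0 < z -> (n.+2%:R `^ z * expR (- n.+2%:R) -
   n.+2%:R^-1 `^ z * expR (- n.+2%:R^-1)) @[n --> \oo] --> (0 : R).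
Proof.
move=> z0.
have inv0 : n.+2%:R^-1 @[n --> \oo] --> (0 : R).
  by have := @cvg_harmonic R; rewrite -(cvg_shiftS (fun n => n.+1%:R^-1 : R)).
rewrite -[X in _ --> X](subrr 0); apply: cvgB.
  (* For an integer k >= z, exp x >= x^(k+1) / (k+1)! bounds the upper boundary term by (k+1)! /
     x. *)
  pose k := (Num.truncn z).+1.
  have zk : z <= k%:R by exact/ltW/truncnS_gt.
  have : k.+1`!%:R * n.+2%:R^-1 @[n --> \oo] --> (0 : R).
    by rewrite -[X in _ --> X](mulr0 (k.+1`!%:R)); exact: cvgMr.
  apply: (squeeze_cvgr _ (cvg_cst 0)); apply: nearW => n.
  rewrite mulr_ge0 ?powR_ge0 ?expR_ge0//= expRN ler_pdivrMr ?expR_gt0//.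
  have n1 : 1 <= n.+2%:R :> R by rewrite ler1n.
  apply: (@le_trans _ _ (n.+2%:R ^+ k)).
    by rewrite -powR_mulrn ?(le_trans ler01)// ler_powR.
  have := @expR_ge1Dxn R n.+2%:R k (ler0n _ _) => h.
  apply: (@le_trans _ _ (k.+1`!%:R / n.+2%:R * (n.+2%:R ^+ k.+1 / k.+1`!%:R))).
    have f0 : k.+1`!%:R != 0 :> R by rewrite pnatr_eq0 -lt0n fact_gt0.
    have x0 : n.+2%:R != 0 :> R by rewrite pnatr_eq0.
    rewrite le_eqVlt; apply/orP; left; apply/eqP; rewrite exprS.
    by move: x0 f0; move: (n.+2%:R) (k.+1`!%:R) => x f x0 f0; field; rewrite f0 x0.
  rewrite ler_wpM2l ?divr_ge0//; lra.
have : n.+2%:R^-1 `^ z @[n --> \oo] --> (0 : R) by exact: powR_seq_cvg0.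
apply: (squeeze_cvgr _ (cvg_cst 0)); apply: nearW => n.
by rewrite mulr_ge0 ?powR_ge0 ?expR_ge0//= ler_piMr ?powR_ge0.
Qed.

(** Counting from n + 2 makes the end points distinct already for n = 0, as [gamma_parts]
    demands. *)
Let cover_cvg (f : R -> \bar R) : (forall t, (0 <= f t)%E) ->
  (forall D, measurable_fun (D : set R) f) ->
  (\int[lebesgue_measure]_(t in `[(n.+2%:R^-1)%R, (n.+2%:R)%R]) f t)%E @[n --> \oo] -->
  (\int[lebesgue_measure]_(t in `]0%R, +oo[) f t)%E.
Proof.
move=> f0 mf.
have -> : `]0, +oo[%classic = \bigcup_n `[n.+2%:R^-1, n.+2%:R]%classic :> set R.
  apply/seteqP; split => t /=; last first.
    move=> [n _] /=; rewrite !in_itv/= andbT => /andP[h _]; apply: lt_le_trans h.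
    by rewrite invr_gt0.
  rewrite in_itv/= andbT => t0; have [k hk] := ltr_add_invr t0; rewrite add0r in hk.
  exists (maxn k (Num.truncn t)) => //=; rewrite in_itv/=; apply/andP; split.
    by apply: le_trans (ltW hk); rewrite lef_pV2 ?posrE// ler_nat ltnS leqW// leq_maxl.
  apply: le_trans (ltW (truncnS_gt t)) _.
  by rewrite ler_nat ltnS leqW// leq_maxr.
apply: ge0_nondecreasing_set_cvg_integral => //; last by move=> n; exact: mf.
apply/nondecreasing_seqP => n; rewrite subsetEset => t /=; rewrite !in_itv/= => /andP[h1 h2].
apply/andP; split.
  by apply: le_trans h1; rewrite lef_pV2 ?posrE// ler_nat.
by apply: le_trans h2 _; rewrite ler_nat.
Qed.

Lemma gamma_integralS z : 0 < z -> (gamma_integral (z + 1) = z%:E * gamma_integral z)%E.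
Proof.
move=> z0; rewrite /gamma_integral -ge0_integralZl//; last 3 first.
- by apply/measurable_EFinP; exact: measurable_gamma_integrand.
- by move=> t _; rewrite lee_fin gamma_integrand_ge0.
- by rewrite lee_fin ltW.
have mE w D : measurable_fun (D : set R) (fun t => (gamma_integrand w t)%:E).
  by apply/measurable_EFinP; exact: measurable_gamma_integrand.
have h1 : (\int[lebesgue_measure]_(t in `[(n.+2%:R^-1)%R, (n.+2%:R)%R]) (gamma_integrand (z + 1) t)%:E)%E
    @[n --> \oo] --> gamma_integral (z + 1).
  by apply: cover_cvg => [t|D]; [rewrite lee_fin gamma_integrand_ge0|exact: mE].
have h2 : (\int[lebesgue_measure]_(t in `[(n.+2%:R^-1)%R, (n.+2%:R)%R]) (z%:E * (gamma_integrand z t)%:E))%E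
    @[n --> \oo] --> (\int[lebesgue_measure]_(t in `]0%R, +oo[) (z%:E * (gamma_integrand z t)%:E))%E.
  apply: cover_cvg => [t|D]; first by rewrite mule_ge0 ?lee_fin ?gamma_integrand_ge0// ltW.
  by apply: measurable_funeM; exact: mE.
have h3 : ((n.+2%:R `^ z * expR (- n.+2%:R) - n.+2%:R^-1 `^ z * expR (- n.+2%:R^-1))%:E : \bar R)
    @[n --> \oo] --> (0%:E : \bar R).
  by apply: cvg_EFin; [exact: nearW|exact: boundary_cvg].
have h4 := cvgeD (fin_num_adde_defl _ (isT : 0%:E \is a fin_num)) h1 h3.
move: (h4 (eventually_filter)); rewrite adde0 => h5.
apply: (cvg_unique (@ereal_hausdorff R) h5).
apply: cvg_trans h2; apply: near_eq_cvg; apply: nearW => n /=.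
rewrite -gamma_parts ?invr_gt0//.
by rewrite (@lt_trans _ _ 1)// ?ltr1n// invf_lt1// ltr1n.
Qed.

Lemma gamma_integral1 : gamma_integral 1 = 1%E.
Proof.
rewrite /gamma_integral (@integral_itv_obnd_cbnd _ _ _ (fun t => (gamma_integrand 1 t)%:E)); last first.
  by apply/measurable_EFinP; exact: measurable_gamma_integrand.
transitivity (\int[lebesgue_measure]_(t in `[0%R, +oo[) (expR (- (t : R)))%:E)%E.
  by apply: eq_integral => t _; rewrite /gamma_integrand subrr powRr0 mul1r.
have ce : continuous (fun t : R => expR (- t)).
  by move=> t; apply: continuous_comp; [exact: continuousN|exact: continuous_expR].
have dF t : is_derive t 1 (fun t : R => - expR (- t)) (expR (- t)).
  by apply: is_derive_eq; rewrite ?scaler1 ?mulr1 ?mulrN1 ?scaleN1r ?opprK.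
rewrite (@ge0_continuous_FTC2y R _ (fun t => - expR (- t)) _ 0).
- by rewrite oppr0 expR0 EFinN oppeK add0e.
- by move=> x _; exact: expR_ge0.
- by apply: continuous_subspaceT.
- by rewrite -oppr0; apply: cvgN; exact: cvgr_expR.
- by move=> x _; have [] := dF x.
- by apply: cvg_at_right_filter; apply: cvgN; exact: ce.
- by move=> t _; rewrite derive1E; have [_] := dF t.
Qed.

Lemma gamma_integral_ge0 z : (0 <= gamma_integral z)%E.
Proof. by apply: integral_ge0 => t _; rewrite lee_fin gamma_integrand_ge0. Qed.

(** For an integer n >= z, t^z <= 1 + t^n reduces the argument z + 1 to integers, where the
    functional equation applies; the same equation returns from z + 1 to z. *)
Lemma gamma_integral_lty z : 0 < z -> (gamma_integral z < +oo)%E.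
Proof.
move=> z0; have nat_fin n : (gamma_integral n.+1%:R < +oo)%E.
  elim: n => [|n IH]; first by rewrite gamma_integral1 ltry.
  by rewrite -natr1 gamma_integralS// lte_mul_pinfty.
suff : (gamma_integral (z + 1) < +oo)%E.
  rewrite gamma_integralS//; case: (gamma_integral z) => [r| |]; rewrite ?ltry//.
  by rewrite mulry gtr0_sg// mul1e.
pose n := (Num.truncn z).+1.
have mE w : measurable_fun (`]0, +oo[%classic : set R) (fun t => (gamma_integrand w t)%:E).
  by apply/measurable_EFinP; exact: measurable_gamma_integrand.
apply: (@le_lt_trans _ _ (gamma_integral 1 + gamma_integral (n%:R + 1))%E); last first.
  by rewrite gamma_integral1 lte_add_pinfty ?ltry// natr1; exact: nat_fin.
have g0 w t : (0 <= (gamma_integrand w t)%:E)%E by rewrite lee_fin gamma_integrand_ge0.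
have -> : (gamma_integral 1 + gamma_integral (n%:R + 1) = \int[lebesgue_measure]_(t in `]0%R, +oo[)
    ((gamma_integrand 1 t)%:E + (gamma_integrand (n%:R + 1) t)%:E))%E.
  by rewrite ge0_integralD//; exact: mE.
apply: ge0_le_integral => //; [exact: mE|by apply: emeasurable_funD; exact: mE|].
move=> t; rewrite /= in_itv/= andbT => t0.
rewrite -EFinD lee_fin /gamma_integrand -mulrDl ler_wpM2r ?expR_ge0// !addrK subrr powRr0.
have [t1|t1] := leP t 1.
  apply: le_trans (_ : 1 <= _); last by rewrite lerDl powR_ge0.
  have e1 : 1 `^ z = 1 :> R by rewrite powR1.
  by rewrite -e1 ge0_ler_powR ?nnegrE ?(ltW t0)// ltW.
apply: le_trans (_ : t `^ n%:R <= _); last by rewrite lerDr.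
by rewrite ler_powR ?(ltW t1)// ltW// truncnS_gt.
Qed.

End gamma_integral.

(** * Convexity, positivity and a lower bound for Gamma *)

Section gamma_function.
Context {R : realType}.
Implicit Types (z p q a t : R).

Lemma Gam_int z : Gam z = \int[lebesgue_measure]_(t in `]0, +oo[) (t `^ (z - 1) * expR (- t)).
Proof. by rewrite unlock. Qed.

Lemma GamE z : 0 < z -> Gamma z = Gam z.
Proof.
by move=> z0; rewrite /Gamma z0 big_ord0 divr1 Gam_int addr0.
Qed.

Lemma Gam_fin z : 0 < z -> (Gam z)%:E = gamma_integral z.
Proof. by move=> z0; rewrite Gam_int /Rintegral fineK// ge0_fin_numE ?gamma_integral_ge0 ?gamma_integral_lty. Qed.

Lemma GamS z : 0 < z -> Gam (z + 1) = z * Gam z.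
Proof.
move=> z0; apply: EFin_inj; rewrite EFinM !Gam_fin ?addr_gt0//.
exact: gamma_integralS.
Qed.

Lemma Gam1 : Gam 1 = 1 :> R. Proof. by rewrite Gam_int /Rintegral [X in fine X]gamma_integral1. Qed.

Lemma Gam_ge0 z : 0 <= Gam z.
Proof. by rewrite Gam_int fine_ge0// gamma_integral_ge0. Qed.

(** Pointwise comparison of powers of t, integrated against exp (- t). Convexity, positivity and the
    bound at 1/2 are instances. *)
Lemma Gam_le z p q a b : 0 < z -> 0 < p -> 0 < q ->
  (forall t, 0 < t -> t `^ (z - 1) <= a * t `^ (p - 1) + b * t `^ (q - 1)) ->
  Gam z <= a * Gam p + b * Gam q.
Proof.
move=> z0 p0 q0 h.
have ig (w : R) : 0 < w -> lebesgue_measure.-integrable `]0, +oo[%classic (EFin \o gamma_integrand w).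
  move=> w0; apply/integrableP; split.
    by apply/measurable_EFinP; exact: measurable_gamma_integrand.
  apply: le_lt_trans (gamma_integral_lty w0); apply: ge0_le_integral => //.
  - by apply: measurableT_comp => //; apply/measurable_EFinP; exact: measurable_gamma_integrand.
  - by apply/measurable_EFinP; exact: measurable_gamma_integrand.
  - by move=> t _; rewrite /= ger0_norm ?gamma_integrand_ge0.
have iZ c (w : R) : 0 < w -> lebesgue_measure.-integrable `]0, +oo[%classic (EFin \o (fun t => c * gamma_integrand w t)).
  by move=> w0; apply: (integrableZl _ c (ig w w0)).
rewrite !Gam_int -!RintegralZl//; [|exact: ig|exact: ig].
rewrite -RintegralD//; [|exact: iZ|exact: iZ].
apply: le_Rintegral => //; first exact: ig.
  by apply: (integrableD _ (iZ a p p0) (iZ b q q0)).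
move=> t; rewrite /= in_itv/= andbT => t0.
by rewrite /gamma_integrand !mulrA -mulrDl ler_wpM2r ?expR_ge0// h.
Qed.

(** From the tangent to the exponential at the mean [m] of the two exponents. *)
Lemma powR_convex t p q a : 0 < t -> 0 <= a <= 1 ->
  t `^ ((1 - a) * p + a * q) <= (1 - a) * t `^ p + a * t `^ q.
Proof.
move=> t0 /andP[a0 a1]; rewrite /powR gt_eqF//.
set x := p * ln t; set y := q * ln t.
have -> : ((1 - a) * p + a * q) * ln t = (1 - a) * x + a * y by rewrite /x /y; ring.
set m := _ + _; have em := expR_gt0 m.
have hx : expR m * (1 + (x - m)) <= expR x.
  have -> : expR x = expR m * expR (x - m) by rewrite -expRD addrC subrK.
  by rewrite ler_wpM2l ?expR_ge1Dx// ltW.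
have hy : expR m * (1 + (y - m)) <= expR y.
  have -> : expR y = expR m * expR (y - m) by rewrite -expRD addrC subrK.
  by rewrite ler_wpM2l ?expR_ge1Dx// ltW.
have h1 := ler_wpM2l a0 hy; have a1' : 0 <= 1 - a by rewrite subr_ge0.
have h2 := ler_wpM2l a1' hx.
have : (1 - a) * (expR m * (1 + (x - m))) + a * (expR m * (1 + (y - m))) = expR m.
  by rewrite [in LHS]/m; ring.
lra.
Qed.

Lemma Gam_convex p q a : 0 < p -> 0 < q -> 0 <= a <= 1 ->
  Gam ((1 - a) * p + a * q) <= (1 - a) * Gam p + a * Gam q.
Proof.
move=> p0 q0 a01; have /andP[a0 a1] := a01; apply: Gam_le => // [|t t0].
  have [->|aN] := eqVneq a 0; first by rewrite subr0 mul1r mul0r addr0.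
  by rewrite ltr_wpDl ?mulr_ge0 ?subr_ge0 ?(ltW p0)// mulr_gt0// lt_def aN.
have -> : (1 - a) * p + a * q - 1 = (1 - a) * (p - 1) + a * (q - 1) by ring.
exact: powR_convex.
Qed.

(** Integrating t <= (3/5) t^(1/2) + (5/12) t^(3/2) against exp (- t) gives 1 <= (3/10 + 5/16) Gam
    (1/2) = (49/80) Gam (1/2), which avoids evaluating Gam (1/2). *)
Lemma Gam_half_ge : 80 / 49 <= Gam (1 / 2) :> R.
Proof.
have G2 : Gam 2 = 1 :> R by rewrite -[2]/(1 + 1) GamS// Gam1 mulr1.
have G32 : Gam (3 / 2) = Gam (1 / 2) / 2 :> R.
  have -> : 3 / 2 = 1 / 2 + 1 :> R by field.
  by rewrite GamS ?divr_gt0//; field.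
have G52 : Gam (5 / 2) = 3 / 4 * Gam (1 / 2) :> R.
  have -> : 5 / 2 = 3 / 2 + 1 :> R by field.
  by rewrite GamS ?divr_gt0// G32; field.
have := @Gam_le 2 (3 / 2) (5 / 2) (3 / 5) (5 / 12).
rewrite G2 G32 G52 ?divr_gt0// => h.
have : 1 <= 3 / 5 * (Gam (1 / 2) / 2) + 5 / 12 * (3 / 4 * Gam (1 / 2)) :> R.
  apply: h => // t t0; rewrite (_ : 3 / 2 - 1 = 2^-1); last by field.
  have -> : 5 / 2 - 1 = 2^-1 + 1 :> R by field.
  have -> : 2 - 1 = 1 :> R by ring.
  rewrite powRr1 ?(ltW t0)// powRD ?gt_eqF ?implybT// powRr1 ?(ltW t0)// powR12_sqrt ?(ltW t0)//.
  have s0 := sqrtr_ge0 t; have st : t = Num.sqrt t ^+ 2 by rewrite sqr_sqrtr ?ltW.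
  move: (Num.sqrt t) s0 st => s s0 ->.
  (* the two sides differ by 5/12 s (s - 6/5)^2 *)
  have := mulr_ge0 s0 (sqr_ge0 (s - 6 / 5)); nra.
lra.
Qed.

(** A zero at z propagates to all z + n. For n >= z, t^n <= t^(z-1) + t^(z+n), so Gam (n+1) would
    vanish as well, although the functional equation makes it positive. *)
Lemma Gam_gt0 z : 0 < z -> 0 < Gam z.
Proof.
move=> z0; rewrite lt_neqAle Gam_ge0 andbT eq_sym; apply/eqP => G0.
have Gz n : Gam (z + n%:R) = 0.
  elim: n => [|n IH]; first by rewrite addr0.
  by rewrite -natr1 addrA GamS ?IH ?mulr0// ltr_wpDr.
have Gn n : 0 < Gam n.+1%:R :> R.
  elim: n => [|n IH]; first by rewrite Gam1.
  by rewrite -natr1 GamS// mulr_gt0.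
pose n := (Num.truncn z).+1.
have zn : z <= n%:R by exact/ltW/truncnS_gt.
have := @Gam_le n.+1%:R z (z + n.+1%:R) 1 1 (ltr0Sn _ _) z0.
rewrite G0 Gz !mul1r addr0 => h; suff : Gam n.+1%:R <= 0 :> R by rewrite leNgt Gn.
apply: h => [|t t0]; first by rewrite addr_gt0.
rewrite !mul1r -natr1 addrK addrA addrK.
have [t1|/ltW t1] := leP t 1; last first.
  apply: (@le_trans _ _ (t `^ (z + n%:R))); last by rewrite lerDr powR_ge0.
  by rewrite ler_powR// lerDr ltW.
apply: (@le_trans _ _ (t `^ (z - 1))); last by rewrite lerDl powR_ge0.
rewrite /powR gt_eqF// ler_expR ler_wnM2r ?ln_le0//.
by apply: le_trans zn; rewrite gerBl.
Qed.

End gamma_function.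

(** * Numerical bounds for the two constants *)

Section constants.
Context {R : realType}.
Implicit Types (alpha x c : R).

Lemma expR_ge_quadratic x : 0 <= x -> 1 + x + x ^+ 2 / 2 <= expR x.
Proof.
move=> x0; pose f : R -> R := expR - id - 2^-1 \*: (id ^+ 2).
have fd (y : R) : is_derive y 1 f ((fun y => expR y - (1 + y)) y).
  by apply: (is_derive_eq (is_deriveB (is_deriveB (is_derive_expR y) (is_derive_id y (1 : R))) (is_deriveZ 2^-1 (is_deriveX 2 (is_derive_id y (1 : R)))))); rewrite /GRing.scale/=; field.
have : f 0 <= f x.
  by apply: (derive_ge0_le fd _ x0) => y y0; rewrite subr_ge0 expR_ge1Dx.
by rewrite /f !fctE/= expR0 expr0n scaler0 /GRing.scale/=; lra.
Qed.

(** The quartic bound makes cos (8/5) negative. *)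
Lemma pihalf_le : pi / 2 <= 8 / 5 :> R.
Proof.
rewrite leNgt; apply/negP => h.
have c0 : 0 < cos (8 / 5 : R).
  by apply: cos_gt0_pihalf; rewrite h andbT; have := @pi_gt0 R; lra.
have x0 : 0 <= 8 / 5 :> R by rewrite divr_ge0.
by have := cos_le_quartic x0; lra.
Qed.

(** [kap] is sin ((1 - alpha) pi/2) / (1 - alpha), extended by pi/2 at alpha = 1, hence bounded by
    pi/2. One or two steps of the continuation lead from Gamma (- alpha) to Gam (2 - alpha), and the
    factor 2 - alpha to Gam (3 - alpha), which stays bounded on the whole range. *)
Lemma c_stableE alpha : 0 < alpha -> alpha < 2 -> exists2 kap, 0 < kap <= 8 / 5 &
  c_stable alpha * (2 - alpha) = kap * Gam (3 - alpha).
Proof.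
move=> a0 a2; have pi0 := @pi_gt0 R; have ph := pihalf_le.
have g3 : Gam (3 - alpha) = (2 - alpha) * Gam (2 - alpha).
  by rewrite -GamS ?subr_gt0//; congr Gam; ring.
suff [kap hk kE] : exists2 kap, 0 < kap <= 8 / 5 & c_stable alpha = kap * Gam (2 - alpha).
  by exists kap => //; rewrite g3 kE; ring.
rewrite /c_stable; have [a1|a1|a1] := ltgtP alpha 1.
- have s0 : 0 < sin ((1 - alpha) * (pi / 2)).
    by apply: sin_gt0_pihalf; apply/andP; split; nra.
  have sle : sin ((1 - alpha) * (pi / 2)) <= (1 - alpha) * (pi / 2).
    by apply: sin_le_id; nra.
  have cE : cos (alpha * pi / 2) = sin ((1 - alpha) * (pi / 2)).
    by rewrite -cosBpihalf -cosN; congr cos; field.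
  have a10 : 0 < 1 - alpha by rewrite subr_gt0.
  exists (cos (alpha * pi / 2) / (1 - alpha)).
    rewrite cE divr_gt0//= ler_pdivrMr//; apply: le_trans sle _.
    by rewrite mulrC ler_wpM2r// ltW.
  have g2 : Gam (2 - alpha) = (1 - alpha) * Gam (1 - alpha).
    by rewrite -GamS//; congr Gam; ring.
  have -> : Gamma (- alpha) = Gam (1 - alpha) / (- alpha).
    rewrite /Gamma oppr_gt0 ltNge (ltW a0)/= opprK.
    have -> : Num.truncn alpha = 0%N by apply: truncn_def; rewrite (ltW a0).
    rewrite big_ord_recl big_ord0 mulr1 addr0 Gam_int.
    by rewrite (_ : - alpha + 1%:R - 1 = 1 - alpha - 1)//; ring.
  by rewrite g2; field; rewrite !gt_eqF.
- have s0 : 0 < sin ((alpha - 1) * (pi / 2)).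
    by apply: sin_gt0_pihalf; apply/andP; split; nra.
  have sle : sin ((alpha - 1) * (pi / 2)) <= (alpha - 1) * (pi / 2).
    by apply: sin_le_id; nra.
  have cE : cos (alpha * pi / 2) = - sin ((alpha - 1) * (pi / 2)).
    by rewrite -sinN -cosBpihalf -cosN; congr cos; field.
  have a10 : 0 < alpha - 1 by rewrite subr_gt0.
  exists (- cos (alpha * pi / 2) / (alpha - 1)).
    rewrite cE opprK divr_gt0//= ler_pdivrMr//; apply: le_trans sle _.
    by rewrite mulrC ler_wpM2r// ltW.
  have -> : Gamma (- alpha) = Gam (2 - alpha) / (- alpha * (1 - alpha)).
    rewrite /Gamma oppr_gt0 ltNge (ltW a0)/= opprK.
    have -> : Num.truncn alpha = 1%N by apply: truncn_def; rewrite (ltW a1).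
    rewrite !big_ord_recl big_ord0 /= mulr1 addr0 (addrC 1) Gam_int.
    by rewrite (_ : - alpha + 2%:R - 1 = 2 - alpha - 1)//; ring.
  have n1 : 1 - alpha != 0 by rewrite lt_eqF// subr_lt0.
  have n2 : alpha - 1 != 0 by rewrite gt_eqF.
  by field; rewrite n1 n2 gt_eqF.
- exists (pi / 2); first by rewrite divr_gt0.
  by rewrite a1 (_ : 2 - 1 = 1 :> R) ?Gam1 ?mulr1//; ring.
Qed.

Lemma mulr_self_ge (a b x : R) : 0 <= a -> b <= a * a -> a <= x -> b <= x * x.
Proof. by move=> a0 ba ax; apply: le_trans ba _; apply: ler_pM. Qed.

Lemma ler_pdiv (p a k s : R) : 0 <= p -> p <= a -> 0 < k -> k^-1 <= s -> p / s <= a * k.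
Proof.
move=> p0 pa k0 ks; have s0 : 0 < s by apply: lt_le_trans ks; rewrite invr_gt0.
by rewrite ler_pM ?invr_ge0 ?(ltW s0)// -(invrK k) lef_pV2 ?posrE ?invr_gt0.
Qed.

Lemma ler_pM3 (k x1 x2 x3 y1 y2 y3 : R) : 0 <= k -> 0 <= x1 -> 0 <= x2 -> 0 <= x3 ->
  x1 <= y1 -> x2 <= y2 -> x3 <= y3 -> x1 * k * x2 * x3 <= y1 * k * y2 * y3.
Proof. by move=> k0 p1 p2 p3 h1 h2 h3; rewrite !ler_pM ?mulr_ge0. Qed.

(** Each factor depending on alpha is convex and lies below its chord over [0, 1]. A polynomial
    inequality remains, linear in Gam (1/2). *)
Lemma scale_bound_small alpha : 0 < alpha -> alpha <= 1 -> exists2 x, 0 < x &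
  (2 * x) `^ (alpha / 2) / (1 - expR (- x)) * (8 / 5) * Gam (3 - alpha) * Gam ((1 + alpha) / 2)
  <= Gam (1 / 2) * (4 - alpha).
Proof.
move=> a0 a1; exists 2 => //.
(* The quadratic bound at 1/4, squared three times, reaches exp 2. *)
have e1 : 41 / 32 <= expR (1 / 4) :> R.
  by apply: le_trans (expR_ge_quadratic _) => //; lra.
have e2 : 359 / 50 <= expR 2 :> R.
  have q1 : 41 / 25 <= expR (1 / 2) :> R.
    have -> : expR (1 / 2) = expR (1 / 4) * expR (1 / 4) :> R by rewrite -expRD; congr expR; field.
    by apply: (mulr_self_ge _ _ e1); lra.
  have q2 : 67 / 25 <= expR 1 :> R.
    have -> : expR (1) = expR (1 / 2) * expR (1 / 2) :> R by rewrite -expRD; congr expR; field.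
    by apply: (mulr_self_ge _ _ q1); lra.
  have -> : expR 2 = expR 1 * expR 1 :> R by rewrite -expRD.
  by apply: (mulr_self_ge _ _ q2); lra.
have e3 : 43 / 50 <= 1 - expR (- 2) :> R.
  suff : expR (- 2) <= 7 / 50 :> R by lra.
  by rewrite expRN invf_ple ?posrE ?expR_gt0//; lra.
have p2 : (2 * 2) `^ (alpha / 2) <= 1 + alpha.
  have -> : 2 * 2 = 2 `^ 2 :> R by rewrite -[X in _ `^ X]/(2%:R) powR_mulrn.
  rewrite -powRrM (_ : 2 * (alpha / 2) = (1 - alpha) * 0 + alpha * 1); last by field.
  have a01 : 0 <= alpha <= 1 by rewrite (ltW a0).
  have t0 : 0 < 2 :> R by lra.
  by have := powR_convex 0 1 t0 a01; rewrite powRr0 powRr1//; lra.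
have g3 : Gam (3 - alpha) <= 2 - alpha.
  have -> : 3 - alpha = (1 - alpha) * 3 + alpha * 2 by ring.
  have G2 : Gam 2 = 1 :> R by rewrite -[2]/(1 + 1) GamS// Gam1 mulr1.
  have e : 3 = 2 + 1 :> R by ring.
  have G3 : Gam 3 = 2 :> R by rewrite e GamS// G2 mulr1.
  have a01 : 0 <= alpha <= 1 by rewrite (ltW a0).
  have [h3 h2] : 0 < 3 :> R /\ 0 < 2 :> R by split.
  by have := Gam_convex h3 h2 a01; rewrite G2 G3; lra.
have gh : Gam ((1 + alpha) / 2) <= (1 - alpha) * Gam (1 / 2) + alpha.
  have -> : (1 + alpha) / 2 = (1 - alpha) * (1 / 2) + alpha * 1 by field.
  have a01 : 0 <= alpha <= 1 by rewrite (ltW a0).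
  have [h2 h1] : 0 < 1 / 2 :> R /\ 0 < 1 :> R by split; lra.
  by have := Gam_convex h2 h1 a01; rewrite Gam1; lra.
have g : 80 / 49 <= Gam (1 / 2) :> R by apply: le_trans (@Gam_half_ge R); lra.
have Q : (2 * 2) `^ (alpha / 2) / (1 - expR (- 2)) <= (1 + alpha) * (50 / 43).
  by apply: ler_pdiv => //; rewrite ?powR_ge0 ?divr_gt0// invf_div; lra.
apply: (@le_trans _ _ ((1 + alpha) * (50 / 43) * (8 / 5) * (2 - alpha) * ((1 - alpha) * Gam (1 / 2) + alpha))).
  have Q0 : 0 <= (2 * 2) `^ (alpha / 2) / (1 - expR (- 2)).
    by rewrite divr_ge0 ?powR_ge0//; lra.
  by apply: ler_pM3 => //; rewrite ?Gam_ge0 ?divr_ge0.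
move: g; move: (Gam (1 / 2)) => g hg; clear - a0 a1 hg.
have a2 : 0 <= alpha ^+ 2 * (1 - alpha) by rewrite mulr_ge0 ?sqr_ge0 ?subr_ge0.
(* [K0] is the coefficient of g = Gam (1/2); being nonnegative, it reduces the claim to g =
   80/49. *)
have K0 : 0 <= (4 - alpha) - 80 / 43 * (1 + alpha) * (2 - alpha) * (1 - alpha).
  have : 0 <= alpha ^+ 2 by exact: sqr_ge0.
  by nra.
have := mulr_ge0 K0 (_ : 0 <= g - 80 / 49); rewrite subr_ge0 => /(_ hg).
(* At g = 80/49 the difference is a positive multiple of 31 alpha^2 (1 - alpha) + 80 alpha^2 - 61
   alpha + 12, whose quadratic part has its vertex near 19/50. *)
have := sqr_ge0 (alpha - 19 / 50); nra.
Qed.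

(** Chords again, over [0, 1] in v = alpha - 1. Here Gam (3 - alpha) <= 1, since Gam equals 1 at
    both 1 and 2. *)
Lemma scale_bound_large alpha : 1 <= alpha -> alpha < 2 -> exists2 x, 0 < x &
  (2 * x) `^ (alpha / 2) / (1 - expR (- x)) * (8 / 5) * Gam (3 - alpha) * Gam ((1 + alpha) / 2)
  <= Gam (1 / 2) * (4 - alpha).
Proof.
move=> a1 a2; exists (2 / 5); first by rewrite divr_gt0.
have e1 : 221 / 200 <= expR (1 / 10) :> R.
  by apply: le_trans (expR_ge_quadratic _) => //; lra.
have e2 : 186 / 125 <= expR (2 / 5) :> R.
  have q1 : 61 / 50 <= expR (1 / 5) :> R.
    have -> : expR (1 / 5) = expR (1 / 10) * expR (1 / 10) :> R by rewrite -expRD; congr expR; field.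
    by apply: (mulr_self_ge _ _ e1); lra.
  have -> : expR (2 / 5) = expR (1 / 5) * expR (1 / 5) :> R by rewrite -expRD; congr expR; field.
  by apply: (mulr_self_ge _ _ q1); lra.
have e3 : 20 / 61 <= 1 - expR (- (2 / 5)) :> R.
  suff : expR (- (2 / 5)) <= 41 / 61 :> R by lra.
  by rewrite expRN invf_ple ?posrE ?expR_gt0//; lra.
pose v := alpha - 1; have v0 : 0 <= v by rewrite /v; lra.
have v1 : v <= 1 by rewrite /v; lra.
have v01 : 0 <= v <= 1 by rewrite v0.
have -> : alpha = 1 + v by rewrite /v; ring.
have p2 : (2 * (2 / 5)) `^ ((1 + v) / 2) <= (1 - v) * (9 / 10) + v * (4 / 5).
  have -> : (1 + v) / 2 = (1 - v) * 2^-1 + v * 1 by field.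
  have t0 : 0 < 2 * (2 / 5) :> R by lra.
  apply: le_trans (powR_convex _ _ t0 v01) _.
  rewrite powRr1 ?(ltW t0)// powR12_sqrt ?(ltW t0)//.
  have sq : Num.sqrt (2 * (2 / 5)) <= 9 / 10 :> R.
    have b0 : 0 <= 9 / 10 :> R by lra.
    by rewrite -(ger0_norm b0) -sqrtr_sqr ler_wsqrtr//; lra.
  have w0 : 0 <= 1 - v by lra.
  by have := ler_wpM2l w0 sq; lra.
have g3 : Gam (3 - (1 + v)) <= 1.
  have -> : 3 - (1 + v) = (1 - v) * 2 + v * 1 by ring.
  have G2 : Gam 2 = 1 :> R by rewrite -[2]/(1 + 1) GamS// Gam1 mulr1.
  have [h2 h1] : 0 < 2 :> R /\ 0 < 1 :> R by split; lra.
  by have := Gam_convex h2 h1 v01; rewrite G2 Gam1; lra.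
have gh : Gam ((1 + (1 + v)) / 2) <= (1 - v) + v * (Gam (1 / 2) / 2).
  have -> : (1 + (1 + v)) / 2 = (1 - v) * 1 + v * (1 / 2 + 1) by field.
  have h2 : 0 < 1 / 2 :> R by lra.
  have [h3 h1] : 0 < 1 / 2 + 1 :> R /\ 0 < 1 :> R by split; lra.
  by have := Gam_convex h1 h3 v01; rewrite Gam1 GamS//; lra.
have g : 80 / 49 <= Gam (1 / 2) :> R by apply: le_trans (@Gam_half_ge R); lra.
have Q : (2 * (2 / 5)) `^ ((1 + v) / 2) / (1 - expR (- (2 / 5))) <=
    ((1 - v) * (9 / 10) + v * (4 / 5)) * (61 / 20).
  by apply: ler_pdiv => //; rewrite ?powR_ge0 ?divr_gt0// invf_div; lra.
apply: (@le_trans _ _ (((1 - v) * (9 / 10) + v * (4 / 5)) * (61 / 20) * (8 / 5) * 1 *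
    ((1 - v) + v * (Gam (1 / 2) / 2)))).
  have Q0 : 0 <= (2 * (2 / 5)) `^ ((1 + v) / 2) / (1 - expR (- (2 / 5))).
    by rewrite divr_ge0 ?powR_ge0//; lra.
  by apply: ler_pM3 => //; rewrite ?Gam_ge0 ?divr_ge0.
move: g; move: (Gam (1 / 2)) => g hg; move: v0 v1; move: v {v01 g3 gh Q p2} => v v0 v1.
clear - v0 v1 hg.
have K0 : 0 <= (3 - v) - ((1 - v) * (9 / 10) + v * (4 / 5)) * (61 / 20) * (8 / 5) * (v / 2).
  have : 0 <= v ^+ 2 by exact: sqr_ge0.
  by nra.
have := mulr_ge0 K0 (_ : 0 <= g - 80 / 49); rewrite subr_ge0 => /(_ hg).
have : v ^+ 2 <= v by nra.
nra.
Qed.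

(** After [c_stableE] the factors 2 - alpha cancel; the scale bounds are the case c = 1, kap = 8/5,
    which is the worst one. *)
Lemma c2_ge c alpha : 0 < alpha -> alpha < 2 -> 1 <= c -> exists2 x, 0 < x &
  (2 * x) `^ (alpha / 2) / (1 - expR (- x)) <= c2 c alpha.
Proof.
move=> a0 a2 c1'; have [x x0 h] : exists2 x, 0 < x &
  (2 * x) `^ (alpha / 2) / (1 - expR (- x)) * (8 / 5) * Gam (3 - alpha) * Gam ((1 + alpha) / 2)
  <= Gam (1 / 2) * (4 - alpha).
  by have [|/ltW] := leP alpha 1; [exact: scale_bound_small|move=> h; exact: scale_bound_large].
exists x => //; rewrite /c2 /c1 !GamE ?divr_gt0 ?addr_gt0//.
have d0 : 0 < 2 - alpha by rewrite subr_gt0.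
have [kap /andP[k0 k1] kE] := c_stableE a0 a2.
have -> : c_stable alpha = kap * Gam (3 - alpha) / (2 - alpha) by rewrite -kE mulfK// gt_eqF.
have g3 : 0 < Gam (3 - alpha) by apply: Gam_gt0; rewrite subr_gt0 (lt_trans a2)// ltr_nat.
have gh : 0 < Gam ((1 + alpha) / 2) by apply: Gam_gt0; rewrite divr_gt0// addr_gt0.
have gg : 0 < Gam (1 / 2 : R) by apply: Gam_gt0; rewrite divr_gt0.
set Q := _ `^ _ / _ in h *.
have Q0 : 0 <= Q.
  by rewrite divr_ge0 ?powR_ge0// subr_ge0 -[leRHS]expR0 ler_expR oppr_le0 ltW.
have -> : c * Gam (1 / 2) / (kap * Gam (3 - alpha) / (2 - alpha) * Gam ((1 + alpha) / 2)) *
   ((4 - alpha) / (2 - alpha)) =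
   c * (Gam (1 / 2) * (4 - alpha)) / (kap * Gam (3 - alpha) * Gam ((1 + alpha) / 2)).
  by field; rewrite !gt_eqF.
rewrite ler_pdivlMr ?mulr_gt0//.
apply: (@le_trans _ _ (Q * (8 / 5) * Gam (3 - alpha) * Gam ((1 + alpha) / 2))).
  rewrite !mulrA; do 2! (rewrite ler_wpM2r ?(ltW gh) ?(ltW g3)//).
  by rewrite -mulrA ler_wpM2l.
apply: le_trans h _; rewrite ler_peMl// mulr_ge0 ?(ltW gg)// subr_ge0.
by rewrite (le_trans (ltW a2))// ler_nat.
Qed.

End constants.

Section weak_type_bound.
Context {R : realType} {d : measure_display} {Omega : measurableType d} {U H : hilbertType R}.
Variables (P : probability Omega R) (F : R -> set (set Omega)) (L : R -> U -> Omega -> R).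
Variables (alpha T : R).
Hypotheses (alpha_gt0 : 0 < alpha) (alpha_lt2 : alpha < 2) (T_gt0 : 0 < T).
Hypotheses (sU : separable U) (sH : separable H).
Hypotheses (Ff : filtration F) (Ls : canonical_stable P F alpha L).
Variables (Psi : R -> Omega -> U -> H) (I : R -> Omega -> H).
Hypotheses (aPsi : admissible F T Psi) (hI : stochastic_integral P F L T Psi I).

Lemma scaled_sup_tail x (J : R) : 0 < x -> (\int[P]_w (alpha_mass alpha T Psi w)%:E = J%:E)%E ->
  (ereal_sup [set (r `^ alpha)%:E *
      P [set w | r%:E < ereal_sup [set `|I t w|%:E | t in `[0%R, T]]]
    | r in `]0%R, +oo[] <= ((2 * x) `^ (alpha / 2) / (1 - expR (- x)) * J)%:E)%E.
Proof.
move=> x0 EJ; apply: ge_ereal_sup => _ [r /= + <-]; rewrite in_itv/= andbT => r0.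
have k0 : 0 < 1 - expR (- x) by rewrite subr_gt0 -[ltRHS]expR0 ltr_expR oppr_lt0.
have lam0 : 0 <= x / r ^+ 2 by rewrite divr_ge0 ?sqr_ge0 ?ltW.
have := sup_tail alpha_gt0 alpha_lt2 T_gt0 sU sH Ff Ls aPsi hI lam0 (ltW r0) EJ.
rewrite divfK ?expf_neq0 ?gt_eqF//.
set E := [set w | _%E]; have : (0 <= P E)%E by exact: measure_ge0.
case: (P E) => [p _|_|]; [|by rewrite gt0_muley ?lte_fin|by rewrite leeNy_eq].
rewrite -!EFinM !lee_fin => h.
have rE : r `^ alpha = (r ^+ 2) `^ (alpha / 2).
  by rewrite -powR_mulrn ?ltW// -powRrM mulrC divfK.
have -> : (2 * x) `^ (alpha / 2) / (1 - expR (- x)) * J =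
    r `^ alpha * ((2 * (x / r ^+ 2)) `^ (alpha / 2) * J / (1 - expR (- x))).
  rewrite rE !mulrA -powRM ?sqr_ge0//; last by rewrite -mulrA mulr_ge0.
  rewrite [X in X `^ _ * _ / _](_ : _ = 2 * x); first by rewrite mulrAC.
  by field; rewrite gt_eqF.
by rewrite ler_pM2l ?powR_gt0// ler_pdivlMr// mulrC.
Qed.

End weak_type_bound.

Theorem theorem2 (R : realType) (alpha T c : R) (U H : hilbertType R)
    (d : measure_display) (Omega : measurableType d) (P : probability Omega R)
    (F : R -> set (set Omega)) (L : R -> U -> Omega -> R)
    (Psi : R -> Omega -> U -> H) (I : R -> Omega -> H)
    (alpha_gt0 : 0 < alpha) (alpha_lt2 : alpha < 2) (T_gt0 : 0 < T)
    (sepU : separable U) (sepH : separable H)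
    (c_gt0 : 0 < c) (c_tail : tail_constant H alpha c)
    (F_filtration : filtration F) (L_stable : canonical_stable P F alpha L)
    (Psi_admissible : admissible F T Psi)
    (I_integral : stochastic_integral P F L T Psi I) :
  (ereal_sup [set (r `^ alpha)%:E *
      P [set w | r%:E < ereal_sup [set `|I t w|%:E | t in `[0%R, T]]]
    | r in `]0%R, +oo[] <=
   (c2 c alpha)%:E *
     \int[P]_w \int[lebesgue_measure]_(s in `[0%R, T])
       (hs_norm (Psi s w) `^ alpha)%:E)%E.
Proof.
have EJ : (\int[P]_w \int[lebesgue_measure]_(s in `[0%R, T]) (hs_norm (Psi s w) `^ alpha)%:E =
    \int[P]_w (alpha_mass alpha T Psi w)%:E)%E.
  by apply: eq_integral => w _; exact: (alpha_massE alpha_gt0 T_gt0 sepU Psi_admissible).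
rewrite EJ.
have bound x J := @scaled_sup_tail _ _ _ _ _ P F L alpha T alpha_gt0 alpha_lt2 T_gt0 sepU sepH
  F_filtration L_stable Psi I Psi_admissible I_integral x J.
(* The bound 1 <= c needs unit vectors in [U] and in [H]; a value [Psi t w u <> 0] provides both. If
   [Psi] vanishes, the tail bound with J = 0 already suffices. *)
have [[t [w [tT Psi_neq0]]]|Psi0] := pselect (exists t w, 0 <= t <= T /\ Psi t w <> 0); last first.
  have J0 : (\int[P]_w (alpha_mass alpha T Psi w)%:E = 0)%E.
    rewrite -EJ; apply: integral0_eq => w _; apply: integral0_eq => t.
    rewrite /= in_itv/= => tT; rewrite (_ : Psi t w = 0) ?hs_norm0 ?powR0 ?gt_eqF//.
    by apply: contrapT => ?; apply: Psi0; exists t, w.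
  by have := bound 1 0 ltr01 J0; rewrite J0 mulr0 mule0.
have [u Psiu] : exists u, Psi t w u <> 0.
  by apply/existsNP => Psiu; apply: Psi_neq0; apply/funext.
have unit_vector (V : hilbertType R) (v : V) : v <> 0 -> `| `|v|^-1 *: v| = 1.
  move=> /eqP v0; rewrite normrZ ger0_norm ?invr_ge0//.
  by rewrite mulVf ?normr_eq0.
have u0 : u <> 0.
  move=> uE; apply: Psiu; rewrite uE; apply: linear_map0.
  by case: Psi_admissible => /(_ t w tT)[].
have u1 := unit_vector _ _ u0; have h1 := unit_vector _ _ Psiu.
have c_ge1 : 1 <= c by exact: (tail_constant_ge1 alpha_gt0 alpha_lt2 sepH F_filtration L_stable u1 h1 c_tail).
have [x x0 xc] := c2_ge alpha_gt0 alpha_lt2 c_ge1.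
have : (0 <= \int[P]_w (alpha_mass alpha T Psi w)%:E)%E.
  by apply: integral_ge0 => ? _; rewrite lee_fin alpha_mass_ge0.
have := bound x.
case: (\int[P]_w _)%E => [J tail J0|_ _|_]; last by rewrite leeNy_eq.
  by apply: le_trans (tail J x0 erefl) _; rewrite -EFinM lee_fin ler_wpM2r.
(* An infinite mass makes the right side infinite because the constant is positive. *)
rewrite gt0_muley ?leey// lte_fin; apply: lt_le_trans xc.
by rewrite divr_gt0 ?powR_gt0 ?mulr_gt0// subr_gt0 -[ltRHS]expR0 ltr_expR oppr_lt0.
Qed.
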